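(* A connected cubic graph $G$ satisfies $\alpha(G)=\frac{3}{5}\,\mathrm{diss}(G)$ if and only if $G\in\bigcup_{k\in\mathbb{N}}\mathcal{G}_k$ (where $\mathbb{N}$ is the set of positive integers).
   Context: All graphs are finite; $\alpha(G)$ is the independence number; a set $D$ of vertices is a dissociation set if the induced subgraph $G[D]$ has maximum degree at most $1$, and $\mathrm{diss}(G)$ is the maximum order of a dissociation set. Let $K_4^*$ be the graph obtained from $K_4$ with vertices $a,b,c,d$ by subdividing the edge $ab$ twice, i.e. replacing $ab$ by a path $a\,x\,y\,b$ with new vertices $x,y$ (the subdivision vertices). For a positive integer $k$, $\mathcal{H}_k$ is the set of all connected multigraphs $H$ (parallel edges allowed, no loops) of maximum degree at most $3$ such that: (i) $3n_1+2n_2+n_3=6k$, where $n_i$ is the number of vertices of degree $i$ (degree = number of incident edges); (ii) $H$ has an induced matching $M$ with $|M|=k$ covering all vertices of degree $1$; (iii) $H-M$ has an orientation in which every vertex of $H$ not incident with an edge of $M$ has exactly two outgoing edges. $\mathcal{G}_k$ is the set of all graphs $G$ obtained from some $H\in\mathcal{H}_k$ by replacing each vertex $w$ of $H$ by a gadget $G_w$ with designated attachment vertices, one per edge of $H$ at $w$, and replacing each edge $ww'$ of $H$ by an edge joining the attachment vertex of $G_w$ assigned to this edge with the attachment vertex of $G_{w'}$ assigned to this edge (distinct edges of $H$ use distinct attachment vertices). The gadgets are: if $\deg_H(w)=3$, $G_w$ is a triangle and each of its three vertices is the attachment vertex for one of the three edges at $w$; if $\deg_H(w)=2$, $G_w$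 is a copy of $K_4^*$ whose two subdivision vertices $x,y$ are the attachment vertices for the two edges at $w$; if $\deg_H(w)=1$, $G_w$ is one of the following two graphs on $9$ vertices $z,a_1,a_2,p_1,q_1,r_1,p_2,q_2,r_2$, with $z$ the attachment vertex: both have edges $za_1$, $za_2$, the triangles $p_1q_1r_1$ and $p_2q_2r_2$, and the edge $r_1r_2$; the first additionally has edges $a_1p_1,a_1q_1,a_2p_2,a_2q_2$, the second additionally has edges $a_1p_1,a_1q_2,a_2p_2,a_2q_1$. *)

(* Defs.v *)
From mathcomp Require Import all_boot all_order all_algebra.
Set Implicit Arguments. Unset Strict Implicit. Unset Printing Implicit Defensive.

(* ---------- simple graphs: a symmetric irreflexive relation on a finType -- *)
Section SimpleGraph.
Variables (T : finType) (e : rel T).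

Definition nbhd (x : T) : {set T} := [set y | e x y].
Definition cubic : Prop := forall x : T, #|nbhd x| = 3.
Definition connected_graph : Prop := 0 < #|T| /\ forall x y : T, connect e x y.

Definition independent (S : {set T}) : bool :=
  [forall x in S, forall y in S, ~~ e x y].
Definition dissociation (S : {set T}) : bool :=
  [forall x in S, #|[set y in S | e x y]| <= 1].

Definition alpha : nat := \max_(S : {set T} | independent S) #|S|.
Definition diss : nat := \max_(S : {set T} | dissociation S) #|S|.
End SimpleGraph.

Section MultiGraph.
Variables (n m : nat) (ends : 'I_m -> 'I_n * 'I_n).

Definition incident (w : 'I_n) (f : 'I_m) : bool :=
  ((ends f).1 == w) || ((ends f).2 == w).
Definition inc (w : 'I_n) : {set 'I_m} := [set f | incident w f].
(* degree = number of incident edges (no loops) *)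
Definition mdeg (w : 'I_n) : nat := #|inc w|.
Definition mloopless : Prop := forall f, (ends f).1 != (ends f).2.
Definition madj : rel 'I_n :=
  fun w w' => [exists f, (ends f == (w, w')) || (ends f == (w', w))].
Definition mconnected : Prop := 0 < n /\ forall w w', connect madj w w'.
Definition mmaxdeg3 : Prop := forall w, mdeg w <= 3.
Definition ncount (i : nat) : nat := #|[set w | mdeg w == i]|.

Definition covered (M : {set 'I_m}) (w : 'I_n) : bool :=
  [exists g in M, incident w g].
Definition matching (M : {set 'I_m}) : Prop :=
  forall f g, f \in M -> g \in M -> f != g ->
    forall w, ~~ (incident w f && incident w g).
Definition induced_matching (M : {set 'I_m}) : Prop :=
  matching M /\
  forall f, covered M (ends f).1 -> covered M (ends f).2 -> f \in M.

Definition tail (o : 'I_m -> bool) (f : 'I_m) : 'I_n :=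
  if o f then (ends f).1 else (ends f).2.
Definition good_orientation (M : {set 'I_m}) : Prop :=
  exists o : 'I_m -> bool, forall w, ~~ covered M w ->
    #|[set f | (f \notin M) && (tail o f == w)]| = 2.

Definition inHk (k : nat) : Prop :=
  [/\ mloopless, mconnected, mmaxdeg3,
      3 * ncount 1 + 2 * ncount 2 + ncount 3 = 6 * k
    & exists M : {set 'I_m},
        [/\ #|M| = k, induced_matching M,
            (forall w, mdeg w = 1 -> covered M w) & good_orientation M]].
End MultiGraph.

(* deg 3: triangle 0,1,2 (all attachment vertices).
   deg 2: K4^* with a=0,b=1,c=2,d=3,x=4,y=5 (attachments x=4,y=5).
   deg 1: z=0,a1=1,a2=2,p1=3,q1=4,r1=5,p2=6,q2=7,r2=8 (attachment z=0);
          variant false = first graph, variant true = second graph. *)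
Definition gsize (d : nat) : nat :=
  match d with 1 => 9 | 2 => 6 | 3 => 3 | _ => 0 end.

Definition gedges (d : nat) (variant : bool) : seq (nat * nat) :=
  match d with
  | 3 => [:: (0,1); (1,2); (0,2)]
  | 2 => [:: (0,2); (0,3); (1,2); (1,3); (2,3); (0,4); (4,5); (5,1)]
  | 1 => [:: (0,1); (0,2); (3,4); (4,5); (3,5); (6,7); (7,8); (6,8); (5,8)]
         ++ (if variant then [:: (1,3); (1,7); (2,6); (2,4)]
             else [:: (1,3); (1,4); (2,6); (2,7)])
  | _ => [::]
  end.

Definition gadj (d : nat) (variant : bool) (i j : 'I_9) : bool :=
  ((nat_of_ord i, nat_of_ord j) \in gedges d variant) ||
  ((nat_of_ord j, nat_of_ord i) \in gedges d variant).

Definition attset (d : nat) : {set 'I_9} :=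
  [set i : 'I_9 | match d with
                  | 3 => i < 3
                  | 2 => (i == 4 :> nat) || (i == 5 :> nat)
                  | 1 => i == 0 :> nat
                  | _ => false end].

Section Construction.
Variables (n m : nat) (ends : 'I_m -> 'I_n * 'I_n)
          (variant : 'I_n -> bool)
          (att : 'I_n -> 'I_m -> 'I_9).

Definition valid_attachment : Prop :=
  forall w : 'I_n,
    {in (inc ends w) &, injective (att w)} /\
    [set att w f | f in inc ends w] = attset (mdeg ends w).

Definition cvertex (p : 'I_n * 'I_9) : bool := p.2 < gsize (mdeg ends p.1).

Definition cadj (p q : 'I_n * 'I_9) : bool :=
  ((p.1 == q.1) && gadj (mdeg ends p.1) (variant p.1) p.2 q.2) ||
  [exists f : 'I_m,
     ((ends f == (p.1, q.1)) || (ends f == (q.1, p.1))) &&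
     (att p.1 f == p.2) && (att q.1 f == q.2)].
End Construction.

Definition inGk (T : finType) (e : rel T) (k : nat) : Prop :=
  exists (n m : nat) (ends : 'I_m -> 'I_n * 'I_n)
         (variant : 'I_n -> bool) (att : 'I_n -> 'I_m -> 'I_9)
         (phi : T -> 'I_n * 'I_9),
    [/\ inHk ends k, valid_attachment ends att,
        injective phi /\ (forall x, cvertex ends (phi x)),
        (forall p, cvertex ends p -> exists x, phi x = p)
      & forall x y, e x y = cadj ends variant att (phi x) (phi y)].

(* Main.v *)
(* Write n for the order, alpha for the independence number, diss for the
   dissociation number.  Counting the edges that leave a dissociation set D gives
   4|D| <= 2 alpha + n + e, where e is the number of vertices of D with a
   neighbour in D; with Brooks' bound n <= 3 alpha this yields
   3 diss <= 5 alpha, and equality forces n = 18k, alpha = 6k, diss = 10k and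
   a perfect matching on D.

   A cubic graph with n = 3 alpha and n > 12 is tiled by triangles, copies of K4^*
   and the two 9-vertex gadgets.  For a proper subset U with 3 alpha(U) = |U|
   this goes by induction: remove a vertex u of degree 2 in U with its
   neighbours a, b.  If a and b are not adjacent, no maximum independent set of
   the tiled rest avoids N(a) and N(b); such a set fails to exist only if three
   of these vertices fill a triangle tile, or two in each of two adjacent
   triangle tiles are used, and then u, a, b complete a K4^* or a 9-vertex
   gadget.  For the whole graph take a triangle T (in a triangle-free cubic
   graph a maximum independent set with n = 3 alpha can be enlarged by
   exchanges).  If alpha drops when T is deleted, the rest is tight.  Otherwise
   every independent set of size alpha off T contains all outer neighbours of
   T, so joining two of them by a new edge makes the rest tight and not cubic;
   a tile using the new edge can be repaired or contradicts the value of alpha.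
   The same edge trick proves Brooks' bound.

   Contracting the tiles gives H.  Each tile satisfies a linear inequality
   between its numbers of D-vertices, of D-vertices matched outside and of edges
   leaving D; summed up these are tight, which yields the induced matching (the
   edges of D between tiles) and the orientation (away from D). *)
Require Import Defs.
From mathcomp Require Import all_boot all_order all_algebra zify ring.
Set Implicit Arguments. Unset Strict Implicit. Unset Printing Implicit Defensive.

(** * Independent sets inside a vertex set *)

(* [lia] slows down badly in contexts full of Boolean membership facts. *)
Ltac nlia :=
  repeat match goal with H : ?P |- _ =>
    lazymatch P with
    | is_true (leq _ _) => fail
    | @eq nat _ _ => fail
    | _ => clear H
    end
  end; lia.

(** The inductions run on 2-degenerate sets: this class is hereditary, it satisfies |U| <= 3
    alpha(U) by a greedy argument, and it contains every proper vertex set of a connected cubic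
    graph. For the set off a triangle with a new edge, 2-degeneracy is not automatic and has to be
    derived from the value of alpha. Gadgets are vertex lists with numbered positions, so every fact
    about a single gadget becomes a finite check over positions or bit sequences. The bound n > 12
    excludes closed pieces made of the triangle and a tile using the new edge, possibly with one
    more triangle: 3 + 9 or 3 + 6 + 3 vertices. For the converse, an independent set takes at most a
    third of each gadget, so alpha <= 6k, while the matching and the orientation of H prescribe a
    dissociation set of at least 10k vertices; the inequality 3 diss <= 2 alpha + n then leaves no
    room. *)

Lemma in_nbhd (T : finType) (r : rel T) x y : (y \in nbhd r x) = r x y.
Proof. by rewrite inE. Qed.

Section IndependenceInSubsets.
Variables (T : finType) (e : rel T).
Implicit Types (U S I : {set T}).

Lemma independentP S :
  reflect (forall x y, x \in S -> y \in S -> ~~ e x y) (independent e S).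
Proof.
apply: (iffP forall_inP) => [h x y xS yS | h x xS].
  by have /forall_inP := h x xS; apply.
by apply/forall_inP => y yS; apply: h.
Qed.

Definition alpha_in U : nat :=
  \max_(S : {set T} | independent e S && (S \subset U)) #|S|.

Lemma alpha_in_ge S U : independent e S -> S \subset U -> #|S| <= alpha_in U.
Proof. by move=> iS sU; apply: leq_bigmax_cond; rewrite iS sU. Qed.

Lemma alpha_in_witness U :
  exists S, [/\ independent e S, S \subset U & #|S| = alpha_in U].
Proof.
have P0 : independent e set0 && (set0 \subset U).
  by rewrite sub0set andbT; apply/independentP => x y; rewrite inE.
case: (@arg_maxnP _ set0 (fun S => independent e S && (S \subset U)) (fun S : {set T} => #|S|) P0) => S /andP[iS sU] mS.
exists S; split => //; apply/eqP; rewrite eqn_leq alpha_in_ge //=.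
by apply/bigmax_leqP => S' /mS.
Qed.

Lemma alphaE : alpha e = alpha_in setT.
Proof. by apply: eq_bigl => S; rewrite subsetT andbT. Qed.

Lemma alpha_in_mono U U' : U \subset U' -> alpha_in U <= alpha_in U'.
Proof.
move=> sUU'; have [S [iS sS <-]] := alpha_in_witness U.
by apply: alpha_in_ge iS (subset_trans sS sUU').
Qed.

Hypotheses (e_sym : symmetric e) (e_irr : irreflexive e).

Lemma independentU S I :
  independent e S -> independent e I ->
  (forall x y, x \in S -> y \in I -> ~~ e x y) -> independent e (S :|: I).
Proof.
move=> /independentP iS /independentP iI c; apply/independentP => x y.
rewrite !inE => /orP[xS|xI] /orP[yS|yI]; try by [apply: iS|apply: iI|apply: c].
by rewrite e_sym c.
Qed.

Lemma independent1 x : independent e [set x].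
Proof. by apply/independentP => u v /set1P-> /set1P->; rewrite e_irr. Qed.

Lemma independent2 x y : ~~ e x y -> independent e [set x; y].
Proof.
move=> n; apply: independentU; rewrite ?independent1 //.
by move=> u v /set1P-> /set1P->.
Qed.

Lemma independentS S I : I \subset S -> independent e S -> independent e I.
Proof.
move=> sIS /independentP iS; apply/independentP => x y xI yI.
by apply: iS; apply: (subsetP sIS).
Qed.

Lemma independentU1 x S :
  independent e S -> (forall y, y \in S -> ~~ e x y) -> independent e (x |: S).
Proof.
by move=> iS h; apply: independentU iS _; [apply: independent1|move=> u v /set1P->; apply: h].
Qed.

(** This is 2-degeneracy. Quantifying over all nonempty subsets makes it hereditary, so it survives
    the deletions of an induction. *)
Definition degenerate U :=
  forall U' : {set T}, U' \subset U -> U' != set0 ->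
    exists2 v, v \in U' & #|nbhd e v :&: U'| <= 2.

Lemma degenerateS U U' : U' \subset U -> degenerate U -> degenerate U'.
Proof. by move=> sU dU A sA; apply: dU; apply: subset_trans sU. Qed.

Lemma alpha_in_remove U v : v \in U ->
  (alpha_in (U :\: (v |: nbhd e v))).+1 <= alpha_in U.
Proof.
move=> vU; have [S [iS sS <-]] := alpha_in_witness (U :\: (v |: nbhd e v)).
have vS : v \notin S by apply/negP => /(subsetP sS); rewrite !inE eqxx.
rewrite -[X in X < _]/(0 + _) -add1n.
have <- : #|v |: S| = 1 + #|S| by rewrite cardsU1 vS.
apply: alpha_in_ge.
  apply: independentU1 iS _ => y /(subsetP sS); rewrite !inE negb_or.
  by case/andP => /andP[].
rewrite subUset sub1set vU; apply: subset_trans sS (subsetDl _ _).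
Qed.

(** Greedy choice: a vertex of degree at most 2 gains one and costs at most three vertices. *)
Lemma alpha_in_degenerate U : degenerate U -> #|U| <= 3 * alpha_in U.
Proof.
move: {2}#|U| (leqnn #|U|) => N; elim: N U => [|N IH] U leN dU; first by lia.
have [->|U0] := eqVneq U set0; first by rewrite cards0.
have [v vU dv] := dU U (subxx _) U0.
have sU : U :\: (v |: nbhd e v) \subset U := subsetDl _ _.
have c : #|U| <= #|U :\: (v |: nbhd e v)| + 3.
  rewrite -(cardsID (v |: nbhd e v) U).
  have : #|U :&: (v |: nbhd e v)| <= #|v |: (nbhd e v :&: U)|.
    by apply/subset_leq_card/subsetP => x; rewrite !inE; case: eqP => //= _; rewrite andbC.
  rewrite cardsU1; lia.
have ltU : #|U :\: (v |: nbhd e v)| < #|U|.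
  apply: proper_card; apply/properP; split => //; exists v => //.
  by rewrite !inE eqxx.
have := IH (U :\: (v |: nbhd e v)) ltac:(lia) (degenerateS sU dU).
have := alpha_in_remove vU; lia.
Qed.

(** Deleting one end of each edge leaves an independent set, so |U| - e(U) <= alpha(U); everything
    is doubled because the degree sum counts edges twice. *)
Lemma alpha_in_degree_sum U :
  2 * #|U| <= 2 * alpha_in U + \sum_(v in U) #|nbhd e v :&: U|.
Proof.
move: {2}#|U| (leqnn #|U|) => N; elim: N U => [|N IH] U leN; first by lia.
have [/existsP[v /andP[vU dv]]|] :=
    boolP [exists v, (v \in U) && (0 < #|nbhd e v :&: U|)].
  have := IH (U :\ v); rewrite (cardsD1 v U) vU in leN *; move=> /(_ ltac:(lia)) IHv.
  have mono := alpha_in_mono (subsetDl U [set v]).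
  rewrite (big_setD1 v) //=.
  have -> : \sum_(u in U :\ v) #|nbhd e u :&: U|
     = \sum_(u in U :\ v) #|nbhd e u :&: (U :\ v)| + #|nbhd e v :&: U|.
    have -> : #|nbhd e v :&: U| = \sum_(u in U :\ v) e u v.
      rewrite -sum1dep_card big_mkcond [RHS]big_mkcond; apply: eq_bigr => u _.
      rewrite !inE [e u v]e_sym; have [->|_] := eqVneq u v; first by rewrite e_irr.
      by rewrite /=; case: (e v u); case: (u \in U).
    rewrite -big_split /=; apply: eq_bigr => u; rewrite !inE => /andP[_ uU].
    rewrite setIDA (cardsD1 v (nbhd e u :&: U)) !inE vU andbT; lia.
  lia.
rewrite negb_exists => /forallP h.
have iU : independent e U.
  apply/independentP => x y xU yU; apply/negP => exy.
  have := h x; rewrite xU /= => /negP; apply; apply/card_gt0P; exists y.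
  by rewrite !inE exy.
have := alpha_in_ge iU (subxx _); lia.
Qed.

End IndependenceInSubsets.

(** * Tilings by gadgets *)

Definition gnb (d : nat) (v : bool) (i : nat) : seq nat :=
  [seq j <- iota 0 9 | ((i, j) \in gedges d v) || ((j, i) \in gedges d v)].

(** A form of [attset] on natural numbers that evaluates, as the finite checks require. *)
Definition attpos (d i : nat) : bool :=
  match d with 3 => i < 3 | 2 => (i == 4) || (i == 5) | 1 => i == 0 | _ => false end.

Fixpoint bitseqs (n : nat) : seq bitseq :=
  if n is n'.+1 then map (cons true) (bitseqs n') ++ map (cons false) (bitseqs n')
  else [:: [::]].

Lemma mem_bitseqs b : b \in bitseqs (size b).
Proof.
elim: b => //= x b IH; rewrite mem_cat; case: x; apply/orP; [left|right];
  exact: map_f.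
Qed.

Lemma forall_degree (P : nat -> bool -> bool) :
  all (fun d => P d true && P d false) [:: 1; 2; 3] ->
  forall d v, d \in [:: 1; 2; 3] -> P d v.
Proof. by move=> /allP h d [] /h /andP[]. Qed.

Lemma gnb_spec d v i : d \in [:: 1; 2; 3] -> i < gsize d ->
  [/\ size (gnb d v i) = 3 - attpos d i, uniq (gnb d v i)
    & all (fun j => j < gsize d) (gnb d v i)].
Proof.
move=> dd; have := @forall_degree (fun d v => all (fun i =>
  [&& size (gnb d v i) == 3 - attpos d i, uniq (gnb d v i)
    & all (fun j => j < gsize d) (gnb d v i)]) (iota 0 (gsize d))) isT d v dd.
move=> /allP /(_ i); rewrite mem_iota /= add0n => h /h /and3P[/eqP ? ? ?].
by split.
Qed.

Lemma mem_gnb d v i j : d \in [:: 1; 2; 3] -> i < gsize d -> j < gsize d ->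
  (j \in gnb d v i) = (((i, j) \in gedges d v) || ((j, i) \in gedges d v)).
Proof.
move=> dd ilt jlt; rewrite mem_filter mem_iota /= add0n.
have -> : j < 9 by move: dd jlt; rewrite !inE => /or3P[] /eqP-> /=; lia.
by rewrite andbT.
Qed.

Lemma gedges_lt d v p : d \in [:: 1; 2; 3] -> p \in gedges d v ->
  [/\ p.1 < gsize d, p.2 < gsize d & p.1 != p.2].
Proof.
move=> dd; have := @forall_degree (fun d v => all (fun p => [&& p.1 < gsize d,
  p.2 < gsize d & p.1 != p.2]) (gedges d v)) isT d v dd.
by move=> /allP h /h /and3P.
Qed.

(** By enumeration of all bit sequences; [b] marks the chosen positions of a gadget. *)
Lemma independent_bits d v b : d \in [:: 1; 2; 3] -> size b = gsize d ->
  all (fun p => ~~ (nth false b p.1 && nth false b p.2)) (gedges d v) ->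
  3 * count id b <= size b.
Proof.
move=> dd sb; have := @forall_degree (fun d v => all (fun b =>
  all (fun p => ~~ (nth false b p.1 && nth false b p.2)) (gedges d v) ==>
   (3 * count id b <= size b)) (bitseqs (gsize d))) ltac:(vm_compute; reflexivity)
   d v dd.
by move=> /allP /(_ b); rewrite -sb mem_bitseqs => /(_ isT) /implyP.
Qed.

Section Tilings.
Variables (T : finType) (x0 : T) (e : rel T).
Implicit Types (U S I W : {set T}) (g : bool * seq T) (L : seq (bool * seq T)).

(** Gadgets have 3(4 - d) vertices, so the length of the list determines the degree d of the
    contracted vertex. *)
Definition gdeg (s : seq T) : nat := 4 - size s %/ 3.

(** Only the presence of the gadget edges is asked. Under maximum degree 3 such a tile is induced
    anyway: inner positions are saturated, and two attachment positions are adjacent in every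
    gadget. *)
Definition gadget g : bool :=
  (size g.2 \in [:: 3; 6; 9]) &&
  all (fun p => e (nth x0 g.2 p.1) (nth x0 g.2 p.2)) (gedges (gdeg g.2) g.1).

Definition cells L : seq T := flatten (map snd L).

Definition tiling U L := [/\ all gadget L, uniq (cells L) & cells L =i U].

Lemma gadget_size g : gadget g ->
  gdeg g.2 \in [:: 1; 2; 3] /\ size g.2 = gsize (gdeg g.2).
Proof. by case/andP; rewrite /gdeg !inE => /or3P[] /eqP->. Qed.

Lemma card_tiling U L : tiling U L -> #|U| = size (cells L).
Proof. by case=> _ /card_uniqP <- /eq_card ->. Qed.

Lemma tiling_cell U L g : tiling U L -> g \in L ->
  [/\ gadget g, uniq g.2 & {subset g.2 <= U}].
Proof.
case=> /allP gL uL cL gin; split; first exact: gL.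
  by move: uL; rewrite /cells; elim: L gin {gL cL} => //= h L IH;
     rewrite inE cat_uniq => /orP[/eqP->|/IH h'] /and3P[].
by move=> x xg; rewrite -cL; apply/flattenP; exists g.2 => //; apply: map_f.
Qed.

Lemma tiling_perm U L L' : perm_eq L L' -> tiling U L -> tiling U L'.
Proof.
move=> p [gL uL cL].
have pc : perm_eq (cells L) (cells L') by apply/perm_flatten/perm_map.
split; first by rewrite -(perm_all _ p).
  by rewrite -(perm_uniq pc).
by move=> x; rewrite -(perm_mem pc).
Qed.

Lemma tiling_behead U L g : tiling U (g :: L) -> tiling (U :\: [set x in g.2]) L.
Proof.
case=> /= /andP[gg gL]; rewrite /cells /= cat_uniq => /and3P[ug hg uL] cL.
split => // x; rewrite !inE -cL mem_cat.
case xg : (x \in g.2) => //=; apply/negP => xL.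
by move/hasPn: hg => /(_ x xL); rewrite xg.
Qed.

Lemma tiling_eq U U' L : U = U' -> tiling U L -> tiling U' L.
Proof. by move=> ->. Qed.

Hypotheses (e_sym : symmetric e) (e_irr : irreflexive e).

Definition gnbs g i : {set T} :=
  [set x in [seq nth x0 g.2 j | j <- gnb (gdeg g.2) g.1 i]].

Lemma gnbs_sub g i : gadget g -> i < size g.2 ->
  gnbs g i \subset nbhd e (nth x0 g.2 i) :&: [set x in g.2].
Proof.
move=> gg ilt; have [dd sz] := gadget_size gg.
apply/subsetP => x; rewrite inE => /mapP[j jn ->].
rewrite sz in ilt; have [_ _ /allP/(_ j jn) jlt] := gnb_spec g.1 dd ilt.
rewrite !inE mem_nth ?sz // andbT.
move: jn; rewrite mem_gnb //; case/andP: gg => _ /allP gg /orP[/gg//|/gg /=].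
by rewrite e_sym.
Qed.

Lemma card_gnbs g i : gadget g -> uniq g.2 -> i < size g.2 ->
  #|gnbs g i| = 3 - attpos (gdeg g.2) i.
Proof.
move=> gg ug ilt; have [dd sz] := gadget_size gg.
rewrite sz in ilt; have [<- un /allP al] := gnb_spec g.1 dd ilt.
rewrite cardsE (card_uniqP _) ?size_map // map_inj_in_uniq // => j k jn kn /eqP.
by rewrite nth_uniq ?sz ?al // => /eqP.
Qed.

(** The gadget already supplies three neighbours, or two at an attachment position, and the degree
    in [U] is at most three. *)
Lemma card_outer_nbrs U g i : gadget g -> uniq g.2 -> {subset g.2 <= U} ->
  i < size g.2 -> #|nbhd e (nth x0 g.2 i) :&: U| <= 3 ->
  #|(nbhd e (nth x0 g.2 i) :&: U) :\: gnbs g i| <= attpos (gdeg g.2) i.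
Proof.
move=> gg ug sg ilt dle.
have sub : gnbs g i \subset nbhd e (nth x0 g.2 i) :&: U.
  apply: (subset_trans (gnbs_sub gg ilt)); apply: setIS.
  by apply/subsetP => x; rewrite inE => /sg.
rewrite cardsD (setIidPr sub) card_gnbs //; lia.
Qed.

Lemma inner_nbrs U g i : gadget g -> uniq g.2 -> {subset g.2 <= U} ->
  i < size g.2 -> #|nbhd e (nth x0 g.2 i) :&: U| <= 3 ->
  ~~ attpos (gdeg g.2) i -> nbhd e (nth x0 g.2 i) :&: U = gnbs g i.
Proof.
move=> gg ug sg ilt dle /negbTE na.
have := card_outer_nbrs gg ug sg ilt dle.
rewrite na leqn0 cards_eq0 setD_eq0 => sub; apply/eqP; rewrite eqEsubset sub /=.
apply: (subset_trans (gnbs_sub gg ilt)); apply: setIS.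
by apply/subsetP => x; rewrite inE => /sg.
Qed.

Lemma mem_gnbs g i j : gadget g -> uniq g.2 -> i < size g.2 -> j < size g.2 ->
  (nth x0 g.2 j \in gnbs g i) = (j \in gnb (gdeg g.2) g.1 i).
Proof.
move=> gg ug ilt jlt; have [dd sz] := gadget_size gg.
rewrite inE; apply/mapP/idP => [[k kn /eqP]|jn]; last by exists j.
have ilt' := ilt; rewrite sz in ilt'.
have [_ _ /allP/(_ k kn) klt] := gnb_spec g.1 dd ilt'.
by rewrite nth_uniq // ?sz // => /eqP->.
Qed.

End Tilings.

(** * Independent sets avoiding a few vertices of a tiled set *)

Section Transversals.
Variables (T : finType) (e : rel T) (c : T -> nat).
Hypotheses (e_sym : symmetric e) (e_irr : irreflexive e).
Implicit Types (A I : {set T}).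

Definition part A k : {set T} := [set x in A | c x == k].

(** In use, [c] is the index of the tile and [A] consists of vertices of triangle tiles, each of
    which has at most one edge leaving its tile. *)
Definition sparse_between_parts A := forall x y z, x \in A -> y \in A -> z \in A ->
  e x y -> e x z -> c y != c x -> c z != c x -> y = z.

Lemma sparseS A A' : A' \subset A ->
  sparse_between_parts A -> sparse_between_parts A'.
Proof. by move=> /subsetP s h x y z /s xA /s yA /s zA; apply: h. Qed.

Lemma part_same A r k : (forall y, y \in A -> e r y -> c y != k) ->
  part (A :\: nbhd e r) k = part A k.
Proof.
move=> h; apply/setP => y; rewrite !inE; case yA : (y \in A); rewrite ?andbF //=.
by case er : (e r y) => //=; rewrite (negbTE (h _ yA er)).
Qed.

Lemma part_loss A r k : sparse_between_parts A -> r \in A -> c r != k ->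
  #|part A k| <= (#|part (A :\: nbhd e r) k|).+1.
Proof.
move=> sp rA rk.
have [/existsP[y /and3P[yA ery /eqP cy]]|] :=
    boolP [exists y, [&& y \in A, e r y & c y == k]]; last first.
  rewrite negb_exists => /forallP h; rewrite part_same // => y yA ery.
  by have := h y; rewrite yA ery.
apply: leq_trans (_ : #|y |: part (A :\: nbhd e r) k| <= _); last first.
  by rewrite cardsU1; case: (_ \notin _).
apply/subset_leq_card/subsetP => z; rewrite !inE => /andP[zA /eqP cz].
rewrite zA cz eqxx !andbT; case erz : (e r z); rewrite ?orbT //= orbF.
by apply/eqP; apply: (sp r) => //; rewrite ?cz ?cy eq_sym.
Qed.

(** Greedy choice: the vertex [r] picked in [k0] has at most one neighbour in the other parts. The
    part containing it may shrink to one vertex and is served next; all other parts keep two. *)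
Lemma transversal (ks : seq nat) k0 A : uniq (k0 :: ks) ->
  sparse_between_parts A -> part A k0 != set0 ->
  (forall k, k \in ks -> 2 <= #|part A k|) ->
  exists I, [/\ independent e I, I \subset A, #|I| = (size ks).+1
    & forall x, x \in I -> c x \in k0 :: ks].
Proof.
move: {2}(size ks) (erefl (size ks)) => n.
elim: n ks k0 A => [|n IH] ks k0 A sz uk sp /set0Pn[r]; rewrite inE => /andP[rA /eqP cr] big.
  exists [set r]; split; first exact: independent1.
  - by rewrite sub1set.
  - by rewrite cards1 sz.
  - by move=> x /set1P->; rewrite cr mem_head.
pose A' := A :\: nbhd e r.
have sA' : A' \subset A := subsetDl _ _.
have /= /andP[k0ks uks] := uk.
(* [k1] is the part that fell below two vertices, if there is one; otherwise any part will do. *)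
have [k1 k1ks k1P] : exists2 k1, k1 \in ks &
    forall k, k \in ks -> k != k1 -> 2 <= #|part A' k|.
  have [/hasP[k1 k1ks lt1]|] := boolP (has (fun k => #|part A' k| < 2) ks).
    exists k1 => // k kks nk.
    have [/existsP[y /and3P[yA ery /eqP cy]]|] :=
        boolP [exists y, [&& y \in A, e r y & c y == k1]]; last first.
      rewrite negb_exists => /forallP h; move: lt1; rewrite part_same.
        by have := big _ k1ks; lia.
      by move=> y yA ery; have := h y; rewrite yA ery.
    rewrite part_same ?big // => z zA erz; apply/negP => /eqP cz.
    move/negP: nk; apply; rewrite -cz -cy; apply/eqP; congr c.
    apply: (sp r) => //; rewrite ?cz ?cy cr.
      by apply: contraNneq k0ks => <-.
    by apply: contraNneq k0ks => <-.
  move=> /hasPn h; case: ks sz h {IH uk big k0ks uks} => // k1 ks _ h.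
  by exists k1; rewrite ?mem_head // => k kin _; have := h _ kin; rewrite -leqNgt.
have k1k0 : k0 != k1 by apply: contraNneq k0ks => ->.
have [|||||I [iI sI cI cc]] := IH (rem k1 ks) k1 A'.
- by rewrite size_rem // sz.
- by rewrite /= mem_rem_uniq // inE eqxx rem_uniq.
- exact: sparseS sp.
- have := @part_loss A r k1 sp rA; rewrite cr => /(_ k1k0).
  have := big _ k1ks; rewrite -card_gt0 /A'; lia.
- by move=> k; rewrite mem_rem_uniq // inE => /andP[nk kks]; apply: k1P.
have pk : k1 :: rem k1 ks =i ks.
  by move=> k; rewrite -(perm_mem (perm_to_rem k1ks)).
exists (r |: I); split.
- apply: independentU1 iI _ => // y /(subsetP sI); rewrite !inE.
  by case/andP.
- by rewrite subUset sub1set rA (subset_trans sI).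
- rewrite cardsU1 cI size_rem // sz; suff -> : r \notin I by lia.
  by apply/negP => /cc; rewrite cr pk (negbTE k0ks).
- move=> x; rewrite in_setU1 inE => /orP[/eqP->|/cc]; first by rewrite cr eqxx.
  by rewrite pk => ->; rewrite orbT.
Qed.

(** Fixing [r1] costs each other part at most one vertex, so three become two, and [r2] survives as
    the start of the greedy choice. *)
Lemma transversal2 (ks : seq nat) k1 k2 r1 r2 A : uniq [:: k1, k2 & ks] ->
  sparse_between_parts A -> r1 \in part A k1 -> r2 \in part A k2 -> ~~ e r1 r2 ->
  (forall k, k \in ks -> 3 <= #|part A k|) ->
  exists I, [/\ independent e I, I \subset A, #|I| = (size ks).+2
    & forall x, x \in I -> c x \in [:: k1, k2 & ks]].
Proof.
rewrite !inE => /= /andP[]; rewrite inE negb_or => /andP[k12 k1ks] uk sp.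
move=> /andP[r1A /eqP c1] /andP[r2A /eqP c2] n12 big.
have [|||I [iI sI cI cc]] := @transversal ks k2 (A :\: nbhd e r1) uk.
- by apply: sparseS sp; apply: subsetDl.
- by apply/set0Pn; exists r2; rewrite !inE n12 r2A c2 eqxx.
- move=> k kks; have := big _ kks.
  have : c r1 != k by rewrite c1; apply: contraNneq k1ks => ->.
  move=> /(part_loss sp r1A); lia.
exists (r1 |: I); split.
- apply: independentU1 iI _ => // y /(subsetP sI); rewrite !inE.
  by case/andP.
- by rewrite subUset sub1set r1A (subset_trans sI (subsetDl _ _)).
- rewrite cardsU1 cI; suff -> : r1 \notin I by lia.
  by apply/negP => /cc; rewrite c1 inE (negbTE k12) (negbTE k1ks).
- move=> x; rewrite in_setU1 inE => /orP[/eqP->|/cc]; first by rewrite c1 eqxx.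
  by move=> ->; rewrite orbT.
Qed.

End Transversals.

Section Blocks.
Variables (T : finType) (x0 : T) (e : rel T).
Implicit Types (U S I W : {set T}) (g : bool * seq T) (L : seq (bool * seq T)).

Definition g0 : bool * seq T := (false, [::]).
Definition blk L x : nat := find (fun g => x \in g.2) L.

Lemma blk_lt U L x : tiling x0 e U L -> x \in U -> blk L x < size L.
Proof.
case=> _ _ cL; rewrite -cL => /flattenP[s /mapP[g gL ->] xg].
by rewrite -has_find; apply/hasP; exists g.
Qed.

Lemma blk_mem U L x : tiling x0 e U L -> x \in U -> x \in (nth g0 L (blk L x)).2.
Proof.
move=> tL xU; have := blk_lt tL xU.
by rewrite -has_find => /(nth_find g0).
Qed.

Lemma blk_eq U L x k : tiling x0 e U L -> k < size L -> x \in (nth g0 L k).2 ->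
  blk L x = k.
Proof.
case=> _ uL _; elim: L k uL => //= g L IH k; rewrite /cells /= cat_uniq.
rewrite /blk /= => /and3P[_ h uL]; case: k => [|k] /=; first by move=> _ ->.
move=> klt xk; case: ifPn => [xg|_]; last by congr S; apply: IH.
case/hasP: h; exists x => //; apply/flattenP.
by exists (nth g0 L k).2 => //; apply: map_f; apply: mem_nth.
Qed.

Hypotheses (e_sym : symmetric e) (e_irr : irreflexive e).

(** The vertices a, b of K4^* and a1, a2, r1 of the 9-vertex gadgets: independent, a third of the
    tile, and none of them an attachment vertex, so choosing them blocks nothing outside. A triangle
    offers no such vertex. *)
Definition picks (n : nat) : seq nat :=
  match n with 6 => [:: 0; 1] | 9 => [:: 1; 2; 5] | _ => [::] end.
Definition pick_in g : seq T := [seq nth x0 g.2 i | i <- picks (size g.2)].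

Lemma picks_spec g i : gadget x0 e g -> i \in picks (size g.2) ->
  [/\ i < size g.2, ~~ attpos (gdeg g.2) i &
   forall j, j \in picks (size g.2) -> j \notin gnb (gdeg g.2) g.1 i].
Proof.
case/andP; rewrite /gdeg !inE => /or3P[] /eqP-> _ //=; rewrite !inE.
  by case: g.1 => /orP[] /eqP->; split => // j; rewrite !inE => /orP[] /eqP->.
by case: g.1 => /or3P[] /eqP->; split => // j; rewrite !inE => /or3P[] /eqP->.
Qed.

Lemma pick_in_spec g : gadget x0 e g -> uniq g.2 ->
  [/\ uniq (pick_in g), {subset pick_in g <= g.2}
    & 3 * size (pick_in g) + 3 * (size g.2 == 3) = size g.2].
Proof.
move=> gg ug; split.
- rewrite map_inj_in_uniq; last first.
    move=> i j /(picks_spec gg)[il _ _] /(picks_spec gg)[jl _ _] /eqP.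
    by rewrite nth_uniq // => /eqP.
  by case/andP: gg; rewrite !inE => /or3P[] /eqP->.
- by move=> x /mapP[i /(picks_spec gg)[il _ _] ->]; apply: mem_nth.
- by rewrite size_map; case/andP: gg; rewrite !inE => /or3P[] /eqP->.
Qed.

Lemma picks_flatten L : all (gadget x0 e) L -> uniq (cells L) ->
  [/\ uniq (flatten (map pick_in L)), {subset flatten (map pick_in L) <= cells L}
    & 3 * size (flatten (map pick_in L)) + 3 * count (fun g => size g.2 == 3) L
      = size (cells L)].
Proof.
elim: L => //= g L IH /andP[gg gL]; rewrite /cells /= cat_uniq => /and3P[ug h uL].
have [u1 s1 z1] := IH gL uL; have [u2 s2 z2] := pick_in_spec gg ug.
split; last by rewrite !size_cat -/(cells L); lia.
  rewrite cat_uniq u1 u2 andbT /=; apply/hasPn => x /s1 xL.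
  by apply: contra (hasPn h x xL) => /s2.
by move=> x; rewrite !mem_cat => /orP[/s2->|/s1 ->]; rewrite ?orbT.
Qed.

(* K4^* and the 9-vertex gadgets have a maximum independent set made of
   saturated vertices, so only the triangles compete for vertices. *)
Lemma tiling_avoid U L W : tiling x0 e U L ->
  (forall x, x \in U -> #|nbhd e x :&: U| <= 3) ->
  (forall w, w \in W -> w \in U -> #|nbhd e w :&: U| <= 2) -> #|W| <= 4 ->
  [\/ exists I, [/\ independent e I, I \subset U :\: W & 3 * #|I| = #|U|],
      exists g, [/\ g \in L, size g.2 = 3 & {subset g.2 <= W}] |
      exists k1 k2 r1 r2, [/\ [/\ k1 < size L, k2 < size L & k1 != k2],
        [/\ size (nth g0 L k1).2 = 3, size (nth g0 L k2).2 = 3 & e r1 r2],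
        [/\ r1 \in (nth g0 L k1).2, r1 \notin W &
            {subset rem r1 (nth g0 L k1).2 <= W}] &
        [/\ r2 \in (nth g0 L k2).2, r2 \notin W &
            {subset rem r2 (nth g0 L k2).2 <= W}]] ].
Proof.
move=> tL deg3 degW cW; have [gL uL cL] := tL.
pose sz3 k := size (nth g0 L k).2 == 3.
pose A := [set x in U :\: W | sz3 (blk L x)].
pose ks := [seq k <- iota 0 (size L) | sz3 k].
have sA x : x \in A -> [/\ x \in U, x \notin W & sz3 (blk L x)].
  by rewrite !inE => /andP[/andP[]].
have memk k x : k < size L -> x \in (nth g0 L k).2 -> x \in U /\ blk L x = k.
  move=> kl xk; have [_ _ sub] := tiling_cell tL (mem_nth g0 kl).
  by split; [apply: sub | apply: blk_eq tL kl xk].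
have sp : sparse_between_parts e (blk L) A.
  move=> x y z /sA[xU _ x3] /sA[yU _ _] /sA[zU _ _] exy exz ny nz.
  have bl := blk_lt tL xU; have bm := blk_mem tL xU.
  have [gg ug sub] := tiling_cell tL (mem_nth g0 bl).
  set g := nth g0 L (blk L x) in x3 bm gg ug sub.
  have il : index x g.2 < size g.2 by rewrite index_mem.
  have := card_outer_nbrs e_sym gg ug sub il; rewrite nth_index // => /(_ (deg3 _ xU)).
  set O := _ :\: _ => cO.
  have inO w : w \in U -> e x w -> blk L w != blk L x -> w \in O.
    move=> wU exw nw; rewrite !inE exw wU !andbT; apply/negP => wg.
    have := subsetP (gnbs_sub e_sym gg il) w.
    rewrite !inE => /(_ wg) /andP[_ wg'].
    by move: nw; rewrite (blk_eq tL bl wg') eqxx.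
  have c1 : #|O| <= 1 by apply: leq_trans cO _; case: (attpos _ _).
  by apply: (card_le1_eqP c1); apply: inO.
have partE k : k \in ks -> part (blk L) A k = [set x in (nth g0 L k).2] :\: W.
  rewrite mem_filter mem_iota /= add0n => /andP[k3 kl]; apply/setP => x.
  rewrite !inE; apply/andP/andP => [[/andP[/andP[xW xU] _] /eqP cx]|[xW xk]].
    by rewrite xW -cx; split => //; apply: (blk_mem tL).
  by have [xU cx] := memk _ _ kl xk; rewrite xW xU cx k3 eqxx.
have card3 k : k \in ks -> #|[set x in (nth g0 L k).2]| = 3.
  rewrite mem_filter mem_iota /= add0n => /andP[/eqP k3 kl].
  have [gg ug sub] := tiling_cell tL (mem_nth g0 kl).
  by rewrite cardsE (card_uniqP ug).
have cardP k : k \in ks ->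
    #|part (blk L) A k| + #|W :&: [set x in (nth g0 L k).2]| = 3.
  move=> kks; rewrite partE // setIC -(card3 _ kks) addnC.
  exact: cardsID.
have uks : uniq ks by rewrite filter_uniq ?iota_uniq.
pose F := [set x in flatten (map pick_in L)].
have [uF sF zF] := picks_flatten gL uL.
have FP x : x \in F -> exists g i, [/\ g \in L, i \in picks (size g.2) & x = nth x0 g.2 i].
  rewrite inE => /flattenP[s /mapP[g gin ->]] /mapP[i ip ->].
  by exists g, i.
have szks : size ks = count (fun g => size g.2 == 3) L.
  by rewrite size_filter -{2}(mkseq_nth g0 L) /mkseq count_map.
(* One independent vertex per triangle tile extends by the picks [F] of the other tiles to a third
   of [U]. *)
have finish I : independent e I -> I \subset A -> #|I| = size ks ->
    exists I, [/\ independent e I, I \subset U :\: W & 3 * #|I| = #|U|].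
  move=> iI /subsetP IA cI.
  have FU x : x \in F -> [/\ x \in U, x \notin W & forall y, e x y -> y \in F :|: I -> False].
    move=> xF; have [g [i [gin ip xE]]] := FP x xF.
    have [gg ug sub] := tiling_cell tL gin.
    have [il ia ni] := picks_spec gg ip.
    have xU : x \in U by rewrite xE; apply/sub/mem_nth.
    have nb : nbhd e x :&: U = gnbs x0 g i.
      by rewrite xE; apply: inner_nbrs => //; rewrite -xE deg3.
    split => //.
      (* A pick has three neighbours in [U], whereas the members of [W] in [U] have at most two. *)
      apply/negP => xW; have := degW _ xW xU.
      by rewrite nb (card_gnbs gg ug il) (negbTE ia).
    move=> y exy yFI.
    have gk : index g L < size L by rewrite index_mem.
    have yU : y \in U.
      case/setUP: yFI => [yF|/IA/sA[]//].
      by move: yF; rewrite inE => /sF; rewrite cL.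
    have yn : y \in gnbs x0 g i by rewrite -nb !inE exy.
    have yg : y \in g.2.
      by have := subsetP (gnbs_sub e_sym gg il) y yn; rewrite !inE => /andP[].
    have yb : blk L y = index g L by apply: (blk_eq tL gk); rewrite nth_index.
    case/setUP: yFI => [yF|/IA/sA[_ _]]; last first.
      by rewrite yb /sz3 nth_index // => /eqP s3; move: ip; rewrite s3.
    have [h [j [hin jp yE]]] := FP y yF.
    have [gh uh subh] := tiling_cell tL hin.
    have [jl _ _] := picks_spec gh jp.
    have hk : index h L < size L by rewrite index_mem.
    have yh : blk L y = index h L.
      by apply: (blk_eq tL hk); rewrite nth_index // yE mem_nth.
    have hg : h = g by rewrite -(nth_index g0 hin) -yh yb nth_index.
    subst h; move: yn; rewrite yE (mem_gnbs gg ug il jl); apply/negP; exact: ni.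
  exists (F :|: I); split.
  - apply: independentU => //.
      apply/independentP => x y /FU[_ _ h] yF; apply/negP => exy.
      by apply: (h y exy); rewrite inE yF.
    move=> x y /FU[_ _ h] yI; apply/negP => exy.
    by apply: (h y exy); rewrite inE yI orbT.
  - apply/subsetP => x; case/setUP => [/FU[xU xW _]|/IA/sA[xU xW _]];
    by rewrite !inE xU xW.
  - have dFI : [disjoint F & I].
      rewrite disjoints_subset; apply/subsetP => x xF; rewrite inE; apply/negP => xI.
      have [g [i [gin ip xE]]] := FP x xF; have [gg ug sub] := tiling_cell tL gin.
      have [il _ _] := picks_spec gg ip.
      have gk : index g L < size L by rewrite index_mem.
      have := IA x xI; case/sA => _ _.
      rewrite (blk_eq tL gk) ?nth_index //; last by rewrite xE mem_nth.
      by rewrite /sz3 nth_index // => /eqP s3; move: ip; rewrite s3.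
    have := leq_card_setU F I; rewrite dFI => -[_ /eqP->].
    rewrite cardsE (card_uniqP uF) cI szks (card_tiling tL) -zF; lia.
have [/hasP[k kks p0]|] := boolP (has (fun k => part (blk L) A k == set0) ks).
  apply: Or32; exists (nth g0 L k).
  move: (kks); rewrite mem_filter mem_iota /= add0n => /andP[/eqP k3 kl].
  split => //; first exact: mem_nth.
  move=> x xk; move: p0; rewrite partE // setD_eq0 => /subsetP /(_ x).
  by rewrite inE => /(_ xk).
move=> /hasPn pne.
have [/hasP[k1 k1ks p1]|] := boolP (has (fun k => #|part (blk L) A k| == 1) ks);
    last first.
  move=> /hasPn pn1; apply: Or31.
  case eks : ks => [|k0 ks'].
    by apply: (finish set0); rewrite ?sub0set ?cards0 ?eks //;
       apply/independentP => x y; rewrite inE.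
  have [|||I [iI sI cI _]] := @transversal _ e (blk L) e_sym e_irr ks' k0 A _ sp.
  - by rewrite -eks.
  - by apply: pne; rewrite eks mem_head.
  - move=> k kin; have kks : k \in ks by rewrite eks inE kin orbT.
    by rewrite ltn_neqAle eq_sym (pn1 k kks) card_gt0 (pne k kks).
  by apply: (finish I); rewrite ?eks.
have pk1 := perm_to_rem k1ks.
have [/hasP[k2 k2ks p2]|] :=
    boolP (has (fun k => #|part (blk L) A k| == 1) (rem k1 ks)); last first.
  move=> /hasPn pn1; apply: Or31.
  have [|||I [iI sI cI _]] := @transversal _ e (blk L) e_sym e_irr (rem k1 ks) k1 A _ sp.
  - by rewrite -(perm_uniq pk1).
  - exact: pne.
  - move=> k kin; have kks : k \in ks by apply: mem_rem kin.
    by rewrite ltn_neqAle eq_sym (pn1 k kin) card_gt0 (pne k kks).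
  by apply: (finish I); rewrite ?(perm_size pk1).
have pk2 := perm_to_rem k2ks.
have k2ks' : k2 \in ks := mem_rem k2ks.
have nk12 : k1 != k2.
  by move: k2ks; rewrite mem_rem_uniq // inE eq_sym => /andP[].
case/cards1P: p1 => r1 p1; case/cards1P: p2 => r2 p2.
have W1 := cardP _ k1ks; have W2 := cardP _ k2ks'.
rewrite p1 cards1 in W1; rewrite p2 cards1 in W2.
have disj k k' : k \in ks -> k' \in ks -> k != k' ->
    [disjoint W :&: [set x in (nth g0 L k).2] & W :&: [set x in (nth g0 L k').2]].
  rewrite !mem_filter !mem_iota /= !add0n => /andP[_ kl] /andP[_ kl'] nk.
  rewrite disjoints_subset; apply/subsetP => x; rewrite !inE => /andP[-> xk] /=.
  apply/negP => xk'; move/negP: nk; apply; apply/eqP.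
  by rewrite -(memk _ _ kl xk).2 (memk _ _ kl' xk').2.
have remW k r : k \in ks -> part (blk L) A k = [set r] ->
    [/\ r \in (nth g0 L k).2, r \notin W & {subset rem r (nth g0 L k).2 <= W}].
  move=> kks pr; have : r \in part (blk L) A k by rewrite pr set11.
  rewrite partE // !inE => /andP[rW rk]; split => // x.
  move: (kks); rewrite mem_filter mem_iota /= add0n => /andP[_ kl].
  have [gg ug sub] := tiling_cell tL (mem_nth g0 kl).
  rewrite mem_rem_uniq // inE => /andP[nx xk]; apply/negPn/negP => xW.
  have : x \in part (blk L) A k by rewrite partE // !inE xW xk.
  by rewrite pr inE (negbTE nx).
have inks k : k \in ks -> size (nth g0 L k).2 = 3 /\ k < size L.
  by rewrite mem_filter mem_iota /= add0n => /andP[/eqP].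
have [e12|n12] := boolP (e r1 r2).
  apply: Or33; exists k1, k2, r1, r2.
  by have [? ?] := inks _ k1ks; have [? ?] := inks _ k2ks'; split => //; apply: remW.
apply: Or31.
have [||||I [iI sI cI _]] := @transversal2 _ e (blk L) e_sym e_irr (rem k2 (rem k1 ks)) k1 k2 r1 r2 A _ sp _ _ n12.
- have : perm_eq ks [:: k1, k2 & rem k2 (rem k1 ks)].
    by apply: (perm_trans pk1); rewrite perm_cons.
  by move=> /perm_uniq <-.
- by rewrite p1 set11.
- by rewrite p2 set11.
(* The tiles [k1] and [k2] absorb two vertices of [W] each, hence all four; every other triangle is
   untouched. *)
- move=> k; rewrite mem_rem_uniq ?rem_uniq // inE mem_rem_uniq // inE.
  case/and3P => nk2 nk1 kks; have := cardP _ kks.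
  suff : #|W :&: [set x in (nth g0 L k).2]| = 0 by nlia.
  set Wk := W :&: [set x in (nth g0 L k).2].
  set Wa := W :&: [set x in (nth g0 L k1).2] in W1.
  set Wb := W :&: [set x in (nth g0 L k2).2] in W2.
  have dab : [disjoint Wa & Wb] by apply: disj.
  have dabk : [disjoint Wa :|: Wb & Wk].
    by rewrite -setI_eq0 setIUl setU_eq0 !setI_eq0 !disj // eq_sym.
  have := leq_card_setU (Wa :|: Wb) Wk; rewrite dabk => -[_ /eqP].
  have := leq_card_setU Wa Wb; rewrite dab => -[_ /eqP].
  have : Wa :|: Wb :|: Wk \subset W by rewrite !subUset !subsetIl.
  move=> /subset_leq_card; nlia.
apply: (finish I) => //; rewrite cI (perm_size pk1) /= (perm_size pk2) //.
Qed.

End Blocks.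

(** * Extending tilings by a path *)

Ltac lia_counts :=
  repeat match goal with |- context [nat_of_bool ?b] =>
    generalize (nat_of_bool b) end; clear; lia.

Section Steps.
Variables (T : finType) (x0 : T) (e : rel T).
Hypotheses (e_sym : symmetric e) (e_irr : irreflexive e).
Implicit Types (U S I W : {set T}) (g : bool * seq T) (L : seq (bool * seq T)).

Lemma retile U t L L' : tiling x0 e (U :\: [set x in t]) L ->
  uniq t -> {subset t <= U} -> all (gadget x0 e) L' ->
  perm_eq (cells L') (t ++ cells L) -> tiling x0 e U L'.
Proof.
case=> _ uL cL ut sub gL' p; split => //.
  rewrite (perm_uniq p) cat_uniq ut uL andbT /=.
  by apply/hasPn => x; rewrite cL !inE => /andP[].
move=> x; rewrite (perm_mem p) mem_cat cL !inE.
by case xt : (x \in t) => //=; rewrite sub.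
Qed.

Lemma triangle_gadget v p q r :
  gadget x0 e (v, [:: p; q; r]) = [&& e p q, e q r & e p r].
Proof. by rewrite /gadget /= andbT. Qed.

Lemma triangle_clique g x y : gadget x0 e g -> size g.2 = 3 ->
  x \in g.2 -> y \in g.2 -> x != y -> e x y.
Proof.
case: g => v [|a [|b [|c [|]]]] //=; rewrite triangle_gadget.
move=> /and3P[ab bc ac] _; rewrite !inE.
have [ba cb ca] : [/\ e b a, e c b & e c a] by rewrite !(e_sym _ a) (e_sym c).
by move=> /or3P[] /eqP-> /or3P[] /eqP->; rewrite ?eqxx.
Qed.

Lemma triangle_perm g p q r : gadget x0 e g -> perm_eq g.2 [:: p; q; r] ->
  uniq g.2 -> [/\ e p q, e q r & e p r].
Proof.
move=> gg pg; rewrite (perm_uniq pg) /= !inE negb_or andbT.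
move=> /andP[/andP[pq pr] qr].
have m x : x \in [:: p; q; r] -> x \in g.2 by rewrite (perm_mem pg).
by split; apply: (triangle_clique gg (perm_size pg)) => //; apply: m; rewrite !inE eqxx ?orbT.
Qed.

Lemma card_nbrs_removed U U' u v : U' \subset U -> u \in U -> u \notin U' -> e v u ->
  #|nbhd e v :&: U'| < #|nbhd e v :&: U|.
Proof.
move=> sU uU uU' evu; apply: proper_card; apply/properP; split; first exact: setIS.
by exists u; rewrite !inE evu ?uU // (negbTE uU').
Qed.

Lemma uniq_path u a b : a != b -> e u a -> e u b -> uniq [:: u; a; b].
Proof.
move=> ab ua ub; rewrite /= !inE ab negb_or /= !andbT.
by apply/andP; split; [apply: contraTneq ua|apply: contraTneq ub] => ->; rewrite e_irr.
Qed.

Section Path.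
Variables (U : {set T}) (u a b : T).
Hypotheses (deg3 : forall x, x \in U -> #|nbhd e x :&: U| <= 3)
  (uU : u \in U) (aU : a \in U) (bU : b \in U) (ab : a != b)
  (eua : e u a) (eub : e u b).
Let U' := U :\: [set x in [:: u; a; b]].

Let sub_path : {subset [:: u; a; b] <= U}.
Proof. by move=> x; rewrite !inE => /or3P[] /eqP->. Qed.

(** [a] and [r] are the ends of the subdivided edge, [u] and [b] its subdivision vertices: the path
    is a u b r. *)
Lemma step_K4 L g p q r : tiling x0 e U' (g :: L) -> uniq g.2 -> perm_eq g.2 [:: p; q; r] ->
  e a p -> e a q -> e b r -> exists L', tiling x0 e U L'.
Proof.
move=> tL ug pg ap aq br; have [/= /andP[gg gL] _ _] := tL.
have [pq qr pr] := triangle_perm gg pg ug.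
exists ((false, [:: a; r; p; q; u; b]) :: L); apply: retile tL (uniq_path ab eua eub) _ _ _ => //.
  rewrite /= gL andbT /gadget /= ap aq [e r p]e_sym [e r q]e_sym pr qr pq.
  by rewrite [e a u]e_sym eua eub br.
apply/permP => P; rewrite /cells /= !count_cat (permP pg) /=; lia_counts.
Qed.

(** [u] becomes the attachment vertex z; [v] tells whether [a] and [b] attach to one triangle each
    or to both. *)
Lemma step_nine v L g1 g2 p1 q1 r1 p2 q2 r2 : tiling x0 e U' [:: g1, g2 & L] ->
  uniq g1.2 -> uniq g2.2 -> perm_eq g1.2 [:: p1; q1; r1] -> perm_eq g2.2 [:: p2; q2; r2] -> e r1 r2 ->
  e a p1 -> e b p2 -> (if v then e a q2 && e b q1 else e a q1 && e b q2) ->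
  exists L', tiling x0 e U L'.
Proof.
move=> tL ug1 ug2 pg1 pg2 r12 ap1 bp2 hv; have [/= /and3P[gg1 gg2 gL] _ _] := tL.
have [pq1 qr1 pr1] := triangle_perm gg1 pg1 ug1.
have [pq2 qr2 pr2] := triangle_perm gg2 pg2 ug2.
exists ((v, [:: u; a; b; p1; q1; r1; p2; q2; r2]) :: L).
apply: retile tL (uniq_path ab eua eub) _ _ _ => //.
  rewrite /= gL andbT /gadget /= eua eub pq1 qr1 pr1 pq2 qr2 pr2 r12 /=.
  by case: v hv => /andP[/= -> ->]; rewrite ap1 bp2.
apply/permP => P; rewrite /cells /= !count_cat (permP pg1) (permP pg2) /=; lia_counts.
Qed.

End Path.

Lemma perm3_rem (s : seq T) r : uniq s -> size s = 3 -> r \in s ->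
  exists p q, rem r s = [:: p; q] /\ perm_eq s [:: p; q; r].
Proof.
move=> us sz rs; have := size_rem rs; rewrite sz.
case E : (rem r s) => [|p [|q [|]]] // _; exists p, q; split => //.
by apply: (perm_trans (perm_to_rem rs)); rewrite E (perm_catCA [:: r] [:: p; q] [::]).
Qed.

(** [u] may have a third neighbour in [U], so this serves the induction as well as the repair of
    tiles in the whole cubic graph. *)
Lemma tiling_step U u a b L :
  (forall x, x \in U -> #|nbhd e x :&: U| <= 3) ->
  u \in U -> a \in U -> b \in U -> a != b -> e u a -> e u b -> ~~ e a b ->
  tiling x0 e (U :\: [set x in [:: u; a; b]]) L -> 3 * alpha_in e U <= #|U| ->
  exists L', tiling x0 e U L'.
Proof.
move=> deg3 uU aU bU ab eua eub nab tL al.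
have [eau ebu] : e a u /\ e b u by rewrite !(e_sym _ u).
set U' := _ :\: _ in tL.
have sU' : U' \subset U := subsetDl _ _.
have [uU' aU' bU'] : [/\ u \notin U', a \notin U' & b \notin U'].
  by rewrite !inE !eqxx !orbT.
pose Wa := nbhd e a :&: U'; pose Wb := nbhd e b :&: U'.
have cWa : #|Wa| <= 2.
  have := card_nbrs_removed sU' uU uU' eau; have := deg3 a aU; rewrite -/Wa; nlia.
have cWb : #|Wb| <= 2.
  have := card_nbrs_removed sU' uU uU' ebu; have := deg3 b bU; rewrite -/Wb; nlia.
have deg3' x : x \in U' -> #|nbhd e x :&: U'| <= 3.
  move=> /(subsetP sU') /deg3; apply: leq_trans.
  by apply/subset_leq_card/setIS.
have degW w : w \in Wa :|: Wb -> w \in U' -> #|nbhd e w :&: U'| <= 2.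
  move=> wW wU'; have d := deg3 w (subsetP sU' w wU').
  case/setUP: wW; rewrite !inE => /andP[ew _].
    have ewa : e w a by rewrite e_sym.
    have := card_nbrs_removed sU' aU aU' ewa; nlia.
  have ewb : e w b by rewrite e_sym.
  have := card_nbrs_removed sU' bU bU' ewb; nlia.
have cW : #|Wa :|: Wb| <= 4.
  apply: leq_trans (leq_card_setU _ _) _; nlia.
have WaE x : x \in Wa -> e a x by rewrite !inE => /andP[].
have WbE x : x \in Wb -> e b x by rewrite !inE => /andP[].
have [[I [iI sI cI]]|[g [gin g3 gW]]|[k1 [k2 [r1 [r2 H]]]]] :=
  tiling_avoid e_sym e_irr tL deg3' degW cW.
- have iab : independent e ([set a; b] :|: I).
    apply: independentU => //; first exact: independent2.
    move=> x y xab /(subsetP sI); rewrite !inE !negb_or.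
    case/andP => /andP[ya yb] yU'; move: ya yb; rewrite yU' !andbT.
    by case/set2P: xab => ->.
  have sab : [set a; b] :|: I \subset U.
    rewrite !subUset !sub1set aU bU /=; apply: subset_trans sU'.
    exact: subset_trans sI (subsetDl _ _).
  have := alpha_in_ge iab sab.
  have -> : #|[set a; b] :|: I| = 2 + #|I|.
    have d : [disjoint [set a; b] & I].
      rewrite disjoints_subset; apply/subsetP => x xab; rewrite inE; apply/negP.
      move=> /(subsetP sI) /setDP[xU' _]; move: xab xU'.
      by case/set2P => ->; apply/negP.
    by have := leq_card_setU [set a; b] I; rewrite d cards2 ab => -[_ /eqP->].
  have : #|U'| = #|U| - 3.
    rewrite /U' cardsD.
    have -> : U :&: [set x in [:: u; a; b]] = [set x in [:: u; a; b]].
      by apply/setIidPr/subsetP => x; rewrite !inE => /or3P[] /eqP->.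
    by rewrite cardsE (card_uniqP (uniq_path ab eua eub)).
  have : 3 <= #|U|.
    apply: (@leq_trans #|[set x in [:: u; a; b]]|).
      by rewrite cardsE (card_uniqP (uniq_path ab eua eub)).
    by apply/subset_leq_card/subsetP => x; rewrite !inE => /or3P[] /eqP->.
  nlia.
- have [gg ug sub] := tiling_cell tL gin.
  have tL' : tiling x0 e U' (g :: rem g L) by apply: tiling_perm tL; apply: perm_to_rem.
  case: g gin g3 gW gg ug sub tL' => v [|x [|y [|z [|]]]] //= gin _ gW gg ug sub tL'.
  have ug3 : uniq [:: x; y; z] := ug.
  move: (gg); rewrite triangle_gadget => /and3P[xy yz xz].
  have [nxy nxz nyz] : [/\ x != y, x != z & y != z].
    by move: ug; rewrite /= !inE negb_or => /and3P[/andP[]].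
  have [xU yU zU] : [/\ x \in U', y \in U' & z \in U'] by split; apply: sub; rewrite !inE eqxx ?orbT.
  have [xW yW zW] : [/\ x \in Wa :|: Wb, y \in Wa :|: Wb & z \in Wa :|: Wb].
    by split; apply: gW; rewrite !inE eqxx ?orbT.
  have c3 (A : {set T}) : #|A| <= 2 -> x \in A -> y \in A -> z \in A -> False.
    move=> cA xA yA zA; suff : 3 <= 2 by [].
    apply: leq_trans cA; have <- : #|[set t in [:: x; y; z]]| = 3 by rewrite cardsE (card_uniqP ug3).
    by apply/subset_leq_card/subsetP => t; rewrite !inE => /or3P[] /eqP->.
  have stepA := fun p q r pg pa qa rb => step_K4 uU aU bU ab eua eub (p:=p) (q:=q) (r:=r) tL' ug3 pg (WaE _ pa) (WaE _ qa) (WbE _ rb).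
  have tL'' : tiling x0 e (U :\: [set x in [:: u; b; a]]) ((v, [:: x; y; z]) :: rem (v, [:: x; y; z]) L).
    by apply: tiling_eq tL'; congr (_ :\: _); apply/setP => t; rewrite !inE; do 3 case: eqP.
  have ba : b != a by rewrite eq_sym.
  have stepB := fun p q r pg pa qa rb => step_K4 uU bU aU ba eub eua (p:=p) (q:=q) (r:=r) tL'' ug3 pg (WbE _ pa) (WbE _ qa) (WaE _ rb).
  have p1 : perm_eq [:: x; y; z] [:: x; y; z] by [].
  have p2 : perm_eq [:: x; y; z] [:: x; z; y] by apply/permP => P /=; lia_counts.
  have p3 : perm_eq [:: x; y; z] [:: y; z; x] by apply/permP => P /=; lia_counts.
  (* Since [Wa] and [Wb] have at most two elements, one of [a], [b] is joined to two vertices of the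
     triangle and the other to the third. *)
  case/setUP: xW => xW; case/setUP: yW => yW; case/setUP: zW => zW.
  + by case: (c3 _ cWa).
  + exact: stepA p1 xW yW zW.
  + exact: stepA p2 xW zW yW.
  + exact: stepB p3 yW zW xW.
  + exact: stepA p3 yW zW xW.
  + exact: stepB p2 xW zW yW.
  + exact: stepB p1 xW yW zW.
  + by case: (c3 _ cWb).
- case: H => [[k1l k2l k12] [s1 s2 er] [r1in _ W1] [r2in _ W2]].
  set g1 := nth (g0 T) L k1 in s1 r1in W1; set g2 := nth (g0 T) L k2 in s2 r2in W2.
  have [gg1 ug1 sub1] := tiling_cell tL (mem_nth (g0 T) k1l).
  have [gg2 ug2 sub2] := tiling_cell tL (mem_nth (g0 T) k2l).
  have [p1 [q1 [e1 pg1]]] := perm3_rem ug1 s1 r1in.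
  have [p2 [q2 [e2 pg2]]] := perm3_rem ug2 s2 r2in.
  have n12 : g1 != g2.
    apply: contra_neq k12 => g12.
    by rewrite -(blk_eq tL k1l r1in) (blk_eq tL k2l) // -/g2 -g12.
  have tL1 : tiling x0 e U' [:: g1, g2 & rem g2 (rem g1 L)].
    apply: tiling_perm tL; apply: (perm_trans (perm_to_rem (mem_nth (g0 T) k1l))).
    rewrite perm_cons; apply: perm_to_rem.
    have : g2 \in L by apply: mem_nth.
    by rewrite (perm_mem (perm_to_rem (mem_nth (g0 T) k1l))) inE eq_sym (negbTE n12).
  have [pq1 qr1 pr1] := triangle_perm gg1 pg1 ug1.
  have [pq2 qr2 pr2] := triangle_perm gg2 pg2 ug2.
  have [p1W q1W] : p1 \in Wa :|: Wb /\ q1 \in Wa :|: Wb.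
    by split; apply: W1; rewrite e1 !inE eqxx ?orbT.
  have [p2W q2W] : p2 \in Wa :|: Wb /\ q2 \in Wa :|: Wb.
    by split; apply: W2; rewrite e2 !inE eqxx ?orbT.
  have u4 : uniq [:: p1; q1; p2; q2].
    have [_ + _] := tL1; rewrite /cells /= !catA cat_uniq => /andP[+ _].
    have pp : perm_eq (g1.2 ++ g2.2) ([:: p1; q1; p2; q2] ++ [:: r1; r2]).
      by apply/permP => P; rewrite !count_cat (permP pg1) (permP pg2) /=; lia_counts.
    by rewrite (perm_uniq pp) cat_uniq => /andP[].
  have c3 (A : {set T}) s : #|A| <= 2 -> uniq s -> {subset s <= A} -> size s <= 2.
    move=> cA us sA; apply: leq_trans cA; rewrite -(card_uniqP us).
    by apply/subset_leq_card/subsetP => t /sA.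
  have tL2 : tiling x0 e (U :\: [set x in [:: u; b; a]]) [:: g1, g2 & rem g2 (rem g1 L)].
    by apply: tiling_eq tL1; congr (_ :\: _); apply/setP => t; rewrite !inE; do 3 case: eqP.
  have ba : b != a by rewrite eq_sym.
  have stepA := fun v p1 q1 p2 q2 h1 h2 => @step_nine U u a b uU aU bU ab eua eub
    v _ g1 g2 p1 q1 r1 p2 q2 r2 tL1 ug1 ug2 h1 h2 er.
  have stepB := fun v p1 q1 p2 q2 h1 h2 => @step_nine U u b a uU bU aU ba eub eua
    v _ g1 g2 p1 q1 r1 p2 q2 r2 tL2 ug1 ug2 h1 h2 er.
  have pg1' : perm_eq g1.2 [:: q1; p1; r1].
    by apply: perm_trans pg1 _; apply/permP => P /=; lia_counts.
  have pg2' : perm_eq g2.2 [:: q2; p2; r2].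
    by apply: perm_trans pg2 _; apply/permP => P /=; lia_counts.
  have u3 : [/\ uniq [:: p1; q1; p2], uniq [:: p1; q1; q2], uniq [:: p1; p2; q2] & uniq [:: q1; p2; q2]].
    move: u4; rewrite /= !inE !negb_or !andbT.
    by move=> /and3P[/and3P[h1 h2 h3] /andP[h4 h5] h6]; rewrite h1 h2 h3 h4 h5 h6.
  case: u3 => ua ub uc ud.
  have no3 (A : {set T}) x y z : #|A| <= 2 -> uniq [:: x; y; z] -> x \in A -> y \in A -> z \in A -> False.
    move=> cA us xA yA zA; suff /(c3 _ _ cA us) : {subset [:: x; y; z] <= A} by [].
    by move=> t; rewrite !inE => /or3P[] /eqP->.
  (* Each of [a], [b] takes exactly two of the four vertices: two of the same triangle give the
     first 9-vertex gadget, one of each triangle the second. *)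
  case/setUP: p1W => w1; case/setUP: q1W => w2;
  case/setUP: p2W => w3; case/setUP: q2W => w4;
  try (by case: (no3 Wa p1 q1 p2)); try (by case: (no3 Wa p1 q1 q2));
  try (by case: (no3 Wa p1 p2 q2)); try (by case: (no3 Wa q1 p2 q2));
  try (by case: (no3 Wb p1 q1 p2)); try (by case: (no3 Wb p1 q1 q2));
  try (by case: (no3 Wb p1 p2 q2)); try (by case: (no3 Wb q1 p2 q2)).
  + by apply: (stepA false p1 q1 p2 q2); rewrite // ?WaE ?WbE.
  + by apply: (stepA true p1 q1 q2 p2); rewrite // ?WaE ?WbE.
  + by apply: (stepA true p1 q1 p2 q2); rewrite // ?WaE ?WbE.
  + by apply: (stepB true p1 q1 p2 q2); rewrite // ?WaE ?WbE.
  + by apply: (stepB true p1 q1 q2 p2); rewrite // ?WaE ?WbE.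
  + by apply: (stepB false p1 q1 p2 q2); rewrite // ?WaE ?WbE.
Qed.

End Steps.

(** * Tight degenerate sets and triangles in cubic graphs *)

Section Existence.
Variables (T : finType) (x0 : T) (e : rel T).
Hypotheses (e_sym : symmetric e) (e_irr : irreflexive e).
Implicit Types (U S I W : {set T}) (L : seq (bool * seq T)).

Lemma tiling_triangle U u a b L : u \in U -> a \in U -> b \in U ->
  e u a -> e a b -> e u b -> tiling x0 e (U :\: [set x in [:: u; a; b]]) L ->
  tiling x0 e U ((false, [:: u; a; b]) :: L).
Proof.
move=> uU aU bU ua ab ub tL; have [gL _ _] := tL.
have nab : a != b by apply: contraTneq ab => ->; rewrite e_irr.
apply: retile tL (uniq_path e_irr nab ua ub) _ _ _ => //.
  by move=> x; rewrite !inE => /or3P[] /eqP->.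
by rewrite /= triangle_gadget ua ab ub.
Qed.

Lemma tiling_exists U : degenerate e U ->
  (forall x, x \in U -> #|nbhd e x :&: U| <= 3) ->
  3 * alpha_in e U <= #|U| -> exists L, tiling x0 e U L.
Proof.
move: {2}#|U| (leqnn #|U|) => N; elim: N U => [|N IH] U leN dU deg3 al.
  exists [::]; split => // x; have : #|U| = 0 by nlia.
  by move=> /cards0_eq ->; rewrite inE.
have [U0|U0] := eqVneq U set0.
  by exists [::]; split => // x; rewrite U0 inE.
have [u uU du] := dU U (subxx _) U0.
pose N' := nbhd e u :&: U; rewrite -/N' in du.
pose U1 := U :\: (u |: nbhd e u).
have U1E : U1 = U :\: (u |: N').
  by apply/setP => x; rewrite !inE; case: eqP => //= _; case: (x \in U); rewrite ?andbF ?andbT.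
have uN : u \notin N' by rewrite !inE e_irr.
have sN : u |: N' \subset U by rewrite subUset sub1set uU subsetIr.
have cU1 : #|U1| + 1 + #|N'| = #|U|.
  rewrite U1E -(cardsID (u |: N') U) (setIidPr sN) cardsU1 uN; nlia.
have sU1 : U1 \subset U := subsetDl _ _.
have dU1 : degenerate e U1 := degenerateS sU1 dU.
have a1 := alpha_in_remove e_sym e_irr uU; rewrite -/U1 in a1.
have a2 := alpha_in_degenerate e_sym e_irr dU1.
(* Tightness is inherited: |U| >= 3 alpha(U) >= 3 alpha(U1) + 3 >= |U1| + 3, while at most three
   vertices were removed. *)
have /cards2P[a [b [ab NE]]] : #|N'| == 2 by apply/eqP; nlia.
have [aU eua] : a \in U /\ e u a.
  by move: (set21 a b); rewrite -NE !inE => /andP[].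
have [bU eub] : b \in U /\ e u b.
  by move: (set22 a b); rewrite -NE !inE => /andP[].
have U1E' : U1 = U :\: [set x in [:: u; a; b]].
  by rewrite U1E NE; congr (_ :\: _); apply/setP => x; rewrite !inE.
have [||x xU||L tL] := IH U1.
- rewrite NE cards2 ab in cU1; nlia.
- exact: dU1.
- apply: leq_trans (deg3 x (subsetP sU1 x xU)).
  exact/subset_leq_card/setIS.
- rewrite NE cards2 ab in cU1; nlia.
rewrite U1E' in tL.
have [eab|nab] := boolP (e a b).
  by eexists; apply: tiling_triangle tL.
exact: tiling_step tL al.
Qed.

(** Exchange argument: [B] can replace [A] in the maximum independent set [S]. *)
Lemma alpha_in_swap S (A B : {set T}) : independent e S -> #|S| = alpha_in e setT ->
  independent e B -> A \subset S -> [disjoint B & S] ->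
  (forall x y, x \in B -> y \in S -> e x y -> y \in A) -> #|B| <= #|A|.
Proof.
move=> iS mS iB sAS dBS h.
have iSB : independent e ((S :\: A) :|: B).
  apply: independentU => //; first exact: independentS (subsetDl _ _) iS.
  move=> x y; rewrite inE => /andP[xA xS] yB; apply/negP => exy; move/negP: xA; apply.
  by apply: (h y) => //; rewrite e_sym.
have := alpha_in_ge iSB (subsetT _); rewrite -mS.
have d : [disjoint S :\: A & B].
  rewrite disjoint_sym; apply: disjointWr dBS; exact: subsetDl.
have := leq_card_setU (S :\: A) B; rewrite d => -[_ /eqP->].
rewrite cardsD (setIidPr sAS); have := subset_leq_card sAS; nlia.
Qed.

Hypothesis e_cubic : cubic e.

Lemma cubic_deg3 x U : #|nbhd e x :&: U| <= 3.
Proof. by rewrite -(e_cubic x) subset_leq_card // subsetIl. Qed.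

Lemma cubic_third x y z : e x y -> e x z -> y != z ->
  exists2 o, nbhd e x = [set y; z; o] & o \notin [set y; z].
Proof.
move=> xy xz nyz; have s : [set y; z] \subset nbhd e x.
  by rewrite subUset !sub1set !inE xy.
have : #|nbhd e x :\: [set y; z]| == 1.
  by rewrite cardsD (setIidPr s) e_cubic cards2 nyz.
case/cards1P => o oE; exists o.
  apply/setP => w; have /setP/(_ w) := oE; have := subsetP s w; rewrite !inE.
  by case: (_ || _) => /=; [move=> /(_ isT) -> | move=> _ ->].
by have : o \in [set o] := set11 o; rewrite -oE inE => /andP[].
Qed.

Lemma cubic_two_others x y : e x y ->
  exists a b, nbhd e x = [set y; a; b] /\ uniq [:: y; a; b].
Proof.
move=> xy; have [z] : exists z, z \in nbhd e x :\ y.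
  apply/card_gt0P; have := e_cubic x; rewrite (cardsD1 y) !inE xy; nlia.
rewrite !inE => /andP[nzy xz]; rewrite eq_sym in nzy.
have [o oE] := cubic_third xy xz nzy; rewrite !inE negb_or => /andP[oy oz].
by exists z, o; rewrite /= !inE negb_or nzy !(eq_sym _ o) oy oz.
Qed.

(** * Triangle-free cubic graphs have fewer than 3 alpha vertices *)

Section TriangleFree.
Hypotheses (T_gt0 : 0 < #|T|) (al : 3 * alpha e <= #|T|)
  (tf : forall x y z, e x y -> e y z -> ~~ e x z).
Variable S : {set T}.
Hypotheses (iS : independent e S) (mS : #|S| = alpha_in e setT).

Let sd x := #|nbhd e x :&: S|.
(** The private neighbours of [y]: those with no other neighbour in [S]. *)
Let priv y := [set x | nbhd e x :&: S == [set y]].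

Let swap A B := @alpha_in_swap S A B iS mS.

Let nS x y : x \in S -> e x y -> y \notin S.
Proof. by move=> xS xy; apply: contraL xy => yS; apply: (independentP _ _ iS). Qed.

Let sd_gt0 x : x \notin S -> 0 < sd x.
Proof.
move=> xS; rewrite card_gt0; apply/negP => /eqP s0.
have h := @swap set0 [set x] (independent1 e_irr x) (sub0set _).
rewrite cards0 cards1 disjoints1 xS in h.
suff : 1 <= 0 by []; apply: h => // u y /set1P-> yS exy.
by move/setP/(_ y): s0; rewrite !inE exy yS.
Qed.

Let priv_nbr y x : x \in priv y -> e x y /\ sd x = 1.
Proof.
rewrite inE => /eqP p; rewrite /sd p cards1; split => //.
by have := set11 y; rewrite -p !inE => /andP[].
Qed.

Let priv_only y x z : x \in priv y -> z \in S -> e x z -> z = y.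
Proof.
by rewrite inE => /eqP p zS xz; apply/set1P; rewrite -p !inE xz.
Qed.

Let privS y x : y \in S -> x \in priv y -> x \notin S.
Proof. by move=> yS /priv_nbr[xy _]; apply: (nS yS); rewrite e_sym. Qed.

(** Two private neighbours are nonadjacent, for want of triangles, and could replace [y]. *)
Let priv_le1 y : y \in S -> #|priv y| <= 1.
Proof.
move=> yS; apply/card_le1_eqP => x x' xp xp'; apply/eqP; apply: contraT; rewrite eq_sym => nxx.
have [xy _] := priv_nbr xp; have [xy' _] := priv_nbr xp'.
have := @swap [set y] [set x; x']; rewrite cards1 cards2 nxx sub1set yS => h.
suff : 2 <= 1 by [].
apply: h => //.
- by apply: independent2 => //; apply: (tf xy); rewrite e_sym.
- rewrite disjoints_subset subUset !sub1set !inE.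
  by rewrite (privS yS xp) (privS yS xp').
- move=> u z /set2P[] -> zS uz; rewrite inE; apply/eqP;
  by [apply: priv_only uz|apply: (priv_only xp')].
Qed.

Let sum_sd : \sum_(x in ~: S) sd x = 3 * #|S|.
Proof.
have -> : \sum_(x in ~: S) sd x = \sum_(x in ~: S) \sum_(y in S) e x y.
  apply: eq_bigr => x _; rewrite /sd -sum1dep_card big_mkcond [RHS]big_mkcond.
  by apply: eq_bigr => y _; rewrite !inE; case: (y \in S); rewrite ?andbF //=; case: (e x y).
rewrite exchange_big /= mulnC -sum_nat_const; apply: eq_bigr => y yS.
rewrite -(e_cubic y) -sum1dep_card big_mkcond [RHS]big_mkcond; apply: eq_bigr => x _.
rewrite !inE [e x y]e_sym; case yx : (e y x); last by case: ifP.
by rewrite (nS yS yx).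
Qed.

Let sum_priv : \sum_(x in ~: S) (sd x == 1) <= \sum_(y in S) #|priv y|.
Proof.
have -> : \sum_(y in S) #|priv y| = \sum_(y in S) \sum_(x in ~: S) (x \in priv y).
  apply: eq_bigr => y yS; rewrite -sum1_card big_mkcond [RHS]big_mkcond.
  apply: eq_bigr => x _; case: ifP => [xp|]; last by rewrite if_same.
  by rewrite inE (privS yS xp).
rewrite exchange_big /=; apply: leq_sum => x _.
have [/cards1P[y yE]|//] := boolP (sd x == 1).
have yS : y \in S by have := set11 y; rewrite -yE inE => /andP[].
by rewrite (bigD1 y) //= inE yE eqxx.
Qed.

(* Double counting the edges at [S] leaves no slack: every vertex of [S] has
   exactly one private neighbour and every other neighbour is shared by
   exactly two vertices of [S]. *)
Let tight : (forall x, x \notin S -> sd x <= 2) /\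
  (forall y, y \in S -> exists l, priv y = [set l]).
Proof.
have cS : #|S| + #|~: S| = #|T| by exact: cardsC.
move: al; rewrite alphaE -mS => al'.
have lo x : x \notin S -> 2 <= sd x + (sd x == 1).
  by move=> /sd_gt0; case: (sd x) => [|[|]].
have hi : \sum_(y in S) #|priv y| <= #|S|.
  rewrite -sum1_card; apply: leq_sum => y; exact: priv_le1.
have tot : \sum_(x in ~: S) (sd x + (sd x == 1)) <= 3 * #|S| + \sum_(y in S) #|priv y|.
  by rewrite big_split /= sum_sd leq_add2l.
have low : 2 * #|~: S| <= \sum_(x in ~: S) (sd x + (sd x == 1)).
  by rewrite mulnC -sum_nat_const; apply: leq_sum => x; rewrite inE => /lo.
split=> [x xS|y yS].
  rewrite leqNgt; apply/negP => big.
  have : 2 * #|~: S| < \sum_(x in ~: S) (sd x + (sd x == 1)).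
    rewrite (cardsD1 x) inE xS (big_setD1 x) ?inE //= mulnDr.
    rewrite -addSn leq_add //; first by rewrite muln1 (leq_trans big) ?leq_addr.
    rewrite mulnC -sum_nat_const; apply: leq_sum => z; rewrite !inE => /andP[_ /lo //].
  nlia.
have /cards1P[l lE] : #|priv y| == 1; last by exists l.
rewrite eqn_leq priv_le1 //= lt0n; apply/negP => /eqP p0.
have : \sum_(y in S) #|priv y| < #|S|.
  rewrite (big_setD1 y) //= p0 add0n (cardsD1 y S) yS ltnS -sum1_card.
  by apply: leq_sum => z; rewrite inE => /andP[_]; apply: priv_le1.
nlia.
Qed.

Let sd2 := tight.1.

Let shared x y z w : x \notin S -> y \in S -> z \in S -> w \in S -> y != z ->
  e x y -> e x z -> e x w -> (w == y) || (w == z).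
Proof.
move=> xS yS zS wS yz xy xz xw; apply/negPn/negP; rewrite negb_or => /andP[wy wz].
have := sd2 xS; apply/negP; rewrite -ltnNge.
apply: (@leq_trans #|[set t in [:: w; y; z]]|).
  by rewrite cardsE (card_uniqP _) //= !inE negb_or wy wz yz.
by apply/subset_leq_card/subsetP => t; rewrite !inE => /or3P[] /eqP->; rewrite ?xy ?xz ?xw.
Qed.

Let sd_two x y z : y \in S -> z \in S -> y != z -> e x y -> e x z -> 1 < sd x.
Proof.
move=> yS zS yz xy xz; have <- : #|[set y; z]| = 2 by rewrite cards2 yz.
by apply/subset_leq_card/subsetP => t /set2P[] ->; rewrite !inE ?xy ?xz.
Qed.

(** Otherwise [x], [l], [m] could replace [y] and [z]. *)
Let privates_adjacent x y z l m : y \in S -> z \in S -> y != z ->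
  e x y -> e x z -> l \in priv y -> m \in priv z -> e l m.
Proof.
move=> yS zS yz xy xz ly mz; apply/negPn/negP => nlm.
have xS : x \notin S by apply: (nS yS); rewrite e_sym.
have [l1 sl] := priv_nbr ly; have [m1 sm] := priv_nbr mz.
have sx := sd_two yS zS yz xy xz.
have nlx : l != x by apply: contraTneq sx => <-; rewrite sl.
have nmx : m != x by apply: contraTneq sx => <-; rewrite sm.
have nlm' : l != m.
  by apply: contraNneq yz => lm; apply/eqP; apply: (priv_only mz) => //; rewrite -lm.
have := @swap [set y; z] (x |: [set l; m]).
rewrite cardsU1 !cards2 yz nlm' !inE negb_or !(eq_sym x) nlx nmx => h.
suff : 3 <= 2 by [].
apply: h.
- apply: independentU1 => //; first exact: independent2.
  move=> t /set2P[] ->; [apply: (tf xy)|apply: (tf xz)]; by rewrite e_sym.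
- by rewrite subUset !sub1set yS.
- rewrite disjoints_subset !subUset !sub1set !inE xS.
  by rewrite (privS yS ly) (privS zS mz).
- move=> u w; rewrite !inE => /or3P[] /eqP-> wS uw.
  + exact: shared xS yS zS wS yz xy xz uw.
  + by rewrite (priv_only ly wS uw) eqxx.
  + by rewrite (priv_only mz wS uw) eqxx orbT.
Qed.

Let star y : y \in S -> exists l a b c d, [/\ nbhd e y = [set l; a; b],
  uniq [:: l; a; b], l \in priv y,
  [/\ c \in S, c != y, e a c & a \notin S] &
  [/\ d \in S, d != y, e b d & b \notin S]].
Proof.
move=> yS; have [l lE] := tight.2 y yS.
have lp : l \in priv y by rewrite lE set11.
have [ly _] := priv_nbr lp; rewrite e_sym in ly.
have [a [b [nE u3]]] := cubic_two_others ly; have /= := u3.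
rewrite !inE negb_or andbT => /andP[/andP[la lb] _].
have other z : z \in nbhd e y -> l != z ->
    exists2 c, [/\ c \in S, c != y & e z c] & z \notin S.
  rewrite inE => yz lz; have zS := nS yS yz.
  have : z \notin priv y by rewrite lE inE eq_sym.
  rewrite inE => zp; have ysz : y \in nbhd e z :&: S by rewrite !inE yS e_sym yz.
  have : nbhd e z :&: S :\ y != set0.
    apply: contraNneq zp => z0; rewrite eqEsubset sub1set ysz andbT.
    by rewrite -setD_eq0 z0.
  case/set0Pn => c; rewrite !inE => /and3P[cy zc cS].
  by exists c.
have [||c [cS cy ac] aS] := other a; rewrite ?nE ?inE ?eqxx ?orbT //.
have [||d [dS dy bd] bS] := other b; rewrite ?nE ?inE ?eqxx ?orbT //.
by exists l, a, b, c, d.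
Qed.

(** The neighbours of [m] are used up by [d], by the private neighbour [l] of [y], and by the
    private neighbour [k] of [f], where [f] is the second vertex of [S] at the other shared
    neighbour [b'] of [d]. If [f = y], then [b'] must be [a], whose neighbours in [S] are only [y]
    and [c]. *)
Let shared_not_private y a b c d m : y \in S -> e y a -> e y b -> a != b ->
  c \in S -> c != y -> e a c -> d \in S -> d != y -> e b d -> c != d ->
  m \in priv d -> ~~ e a m.
Proof.
move=> yS ya yb nab cS ncy ac dS ndy bd ncd md.
have [l lE] := tight.2 y yS.
have ly : l \in priv y by rewrite lE set11.
have [ay by'] : e a y /\ e b y by rewrite !(e_sym _ y).
have lm : e l m by apply: (privates_adjacent yS dS _ by' bd ly md); rewrite eq_sym.
have aS := nS yS ya.
have sa : 1 < sd a by apply: (sd_two yS cS _ ay ac); rewrite eq_sym.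
have [dm sm] := priv_nbr md; have [yl sl] := priv_nbr ly.
have [m' [x1 [x2 [c1 [c2 [nE u3 m'p [c1S c1d x1c x1S] [c2S c2d x2c x2S]]]]]]] := star dS.
have mm : m' = m.
  have [k kE] := tight.2 d dS.
  by move: m'p md; rewrite kE => /set1P-> /set1P->.
subst m'.
have [dx1 dx2] : e x1 d /\ e x2 d.
  by rewrite !(e_sym _ d); split; have := in_set (e d);
     move=> h; rewrite -[e d _]h -/(nbhd e d) nE !inE eqxx ?orbT.
have [b' bE] : exists b' c', [/\ b' != b, e b' d, c' \in S, c' != d & e b' c'].
  have [bx|bx] := eqVneq b x1.
    exists x2, c2; split => //.
    by rewrite bx eq_sym; move: u3; rewrite /= !inE => /and3P[].
  by exists x1, c1; split => //; rewrite eq_sym.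
case: bE => f [b'b b'd fS fd b'f].
have [k kE] := tight.2 f fS.
have kf : k \in priv f by rewrite kE set11.
have mk : e m k by apply: (privates_adjacent dS fS _ b'd b'f md kf); rewrite eq_sym.
apply/negP => am.
have [fy|nfy] := eqVneq f y.
  subst f; have b'y : b' \in nbhd e y by rewrite inE e_sym.
  have b'l : b' != l.
    by apply: contra_eq_neq sl => <-; rewrite neq_ltn (sd_two yS dS _ b'f b'd) ?orbT // eq_sym.
  have aB : a \in nbhd e y by rewrite inE.
  have bB : b \in nbhd e y by rewrite inE.
  have lB : l \in nbhd e y by rewrite inE e_sym.
  have bl : b != l.
    by apply: contra_eq_neq sl => <-; rewrite neq_ltn (sd_two yS dS _ by' bd) ?orbT // eq_sym.
  have al' : a != l by apply: contra_eq_neq sl => <-; rewrite neq_ltn sa orbT.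
  have b'a : b' = a.
    apply/eqP/negPn/negP => nb'a.
    suff : 4 <= #|nbhd e y| by rewrite e_cubic.
    apply: (@leq_trans #|[set t in [:: b'; a; b; l]]|).
      by rewrite cardsE (card_uniqP _) //= !inE !negb_or nb'a b'b b'l nab al' bl.
    by apply/subset_leq_card/subsetP => t; rewrite inE !in_cons orbF => /or4P[] /eqP->.
  subst b'; have := shared aS yS cS dS _ ay ac b'd; rewrite eq_sym ncy => /(_ isT).
  by rewrite (negbTE ndy) eq_sym (negbTE ncd).
have kl : k != l.
  by apply: contraNneq nfy => kl; apply/eqP; rewrite kl in kf; apply: (priv_only ly fS);
     have [] := priv_nbr kf.
have [fk sk] := priv_nbr kf.
have ak : a != k by apply: contraTneq sa => ->; rewrite sk.
have al' : a != l by apply: contraTneq sa => ->; rewrite sl.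
have ad : a != d by apply: contraNneq aS => ->.
have dk : d != k by apply: contraTneq dS => ->; apply: privS kf.
have dl : d != l by apply: contraTneq dS => ->; apply: privS ly.
suff : 4 <= #|nbhd e m| by rewrite e_cubic.
apply: (@leq_trans #|[set t in [:: a; d; k; l]]|).
  by rewrite cardsE (card_uniqP _) //= !inE !negb_or ad ak al' dk dl kl.
apply/subset_leq_card/subsetP => t; rewrite !inE => /or4P[] /eqP-> //;
by rewrite e_sym.
Qed.

(** An exchange around [y] gains one vertex: [l], [a], [b] for [y], [c] if [c = d], and [a], [b],
    [m1], [m2] for [y], [c], [d] otherwise. *)
Lemma triangle_free_absurd : False.
Proof.
have [y yS] : exists y, y \in S.
  have /card_gt0P[x _] := T_gt0; have [xS|xS] := boolP (x \in S); first by exists x.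
  by have /card_gt0P[y] := sd_gt0 xS; rewrite inE => /andP[_ ?]; exists y.
have [l [a [b [c [d [nE u3 lp [cS cy ac aS] [dS dy bd bS]]]]]]] := star yS.
have [la [lb ab]] : l != a /\ l != b /\ a != b.
  by move: u3; rewrite /= !inE negb_or => /and3P[/andP[]].
have ny z : z \in [set l; a; b] -> e y z by rewrite -nE inE.
have [yl ya yb] : [/\ e y l, e y a & e y b] by split; apply: ny; rewrite !inE eqxx ?orbT.
have [ay by'] : e a y /\ e b y by rewrite !(e_sym _ y).
have nab : ~~ e a b by apply: tf ay yb.
have [cd|ncd] := eqVneq c d.
  subst d.
  have := @swap [set y; c] (l |: [set a; b]).
  rewrite cardsU1 !cards2 ab !inE negb_or la lb (eq_sym y) cy => h.
  suff : 3 <= 2 by [].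
  apply: h.
  - apply: independentU1 => //; first exact: independent2.
    by move=> t /set2P[] ->; apply: (tf (y := y)) => //; rewrite e_sym.
  - by rewrite subUset !sub1set yS.
  - by rewrite disjoints_subset !subUset !sub1set !inE aS bS (privS yS lp).
  - have yc : y != c by rewrite eq_sym.
    move=> u w; rewrite !inE => /or3P[] /eqP-> wS uw.
    + by rewrite (priv_only lp wS uw) eqxx.
    + exact: shared aS yS cS wS yc ay ac uw.
    + exact: shared bS yS cS wS yc by' bd uw.
have [m1 m1E] := tight.2 c cS; have [m2 m2E] := tight.2 d dS.
have p1 : m1 \in priv c by rewrite m1E set11.
have p2 : m2 \in priv d by rewrite m2E set11.
have yc : y != c by rewrite eq_sym.
have yd : y != d by rewrite eq_sym.
have lm1 := privates_adjacent yS cS yc ay ac lp p1.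
have lm2 := privates_adjacent yS dS yd by' bd lp p2.
have n12 : ~~ e m1 m2 by apply: (tf (y := l)) => //; rewrite e_sym.
have am1 : ~~ e a m1 by apply: (tf (y := c)) => //; rewrite e_sym; case: (priv_nbr p1).
have bm2 : ~~ e b m2 by apply: (tf (y := d)) => //; rewrite e_sym; case: (priv_nbr p2).
have am2 : ~~ e a m2 := shared_not_private yS ya yb ab cS cy ac dS dy bd ncd p2.
have bm1 : ~~ e b m1.
  apply: (shared_not_private yS yb ya _ dS dy bd cS cy ac _ p1); by rewrite eq_sym.
have [_ s1] := priv_nbr p1; have [_ s2] := priv_nbr p2.
have sa := sd_two yS cS yc ay ac; have sb := sd_two yS dS yd by' bd.
have a1 : a != m1 by apply: contraTneq sa => ->; rewrite s1.
have a2 : a != m2 by apply: contraTneq sa => ->; rewrite s2.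
have b1 : b != m1 by apply: contraTneq sb => ->; rewrite s1.
have b2 : b != m2 by apply: contraTneq sb => ->; rewrite s2.
have m12 : m1 != m2.
  by apply: contraNneq ncd => m; apply/eqP; apply: (priv_only p2) => //; rewrite -m; case: (priv_nbr p1).
have := @swap (y |: [set c; d]) ([set a; b] :|: [set m1; m2]).
have -> : #|[set a; b] :|: [set m1; m2]| = 4.
  have := leq_card_setU [set a; b] [set m1; m2].
  rewrite !cards2 ab m12 => -[_]; suff -> : [disjoint [set a; b] & [set m1; m2]] by move/eqP.
  by rewrite disjoints_subset subUset !sub1set !inE !negb_or a1 a2 b1 b2.
rewrite cardsU1 !cards2 ncd !inE negb_or yc yd => h.
suff : 4 <= 3 by [].
apply: h.
- apply: independentU; rewrite ?independent2 //.
  by move=> u v /set2P[] -> /set2P[] ->.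
- by rewrite !subUset !sub1set yS cS.
- by rewrite disjoints_subset !subUset !sub1set !inE aS bS (privS cS p1) (privS dS p2).
- move=> u w; rewrite !inE -!orbA => /or4P[] /eqP-> wS uw.
  + by have := shared aS yS cS wS yc ay ac uw => /orP[] ->; rewrite ?orbT.
  + by have := shared bS yS dS wS yd by' bd uw => /orP[] ->; rewrite ?orbT.
  + by rewrite (priv_only p1 wS uw) eqxx orbT.
  + by rewrite (priv_only p2 wS uw) eqxx !orbT.
Qed.

End TriangleFree.

Lemma cubic_triangle : 0 < #|T| -> 3 * alpha e <= #|T| ->
  exists x y z, [/\ e x y, e y z & e x z].
Proof.
move=> T0 al.
have [/existsP[x /existsP[y /existsP[z /and3P[? ? ?]]]]|h] :=
  boolP [exists x, exists y, exists z, [&& e x y, e y z & e x z]].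
  by exists x, y, z.
have [S [iS _ mS]] := alpha_in_witness e setT.
case: (triangle_free_absurd T0 al _ iS mS) => x y z xy yz.
apply: contra h => xz; apply/existsP; exists x; apply/existsP; exists y.
by apply/existsP; exists z; rewrite xy yz xz.
Qed.

End Existence.

(** * Linking two outer neighbours of a triangle *)

Section Connected.
Variables (T : finType) (e : rel T).
Hypotheses (e_sym : symmetric e) (e_irr : irreflexive e)
  (e_conn : connected_graph e) (e_cubic : cubic e).
Implicit Types (A B U S I W : {set T}).

Lemma connected_closed U : U != set0 ->
  (forall x y, x \in U -> e x y -> y \in U) -> U = setT.
Proof.
case/set0Pn => x xU cl; apply/setP => y; rewrite inE.
have /connectP[p pp ->] := e_conn.2 x y.
by elim: p x xU pp => //= z p IH x xU /andP[/(cl _ _ xU) zU]; apply: IH.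
Qed.

Lemma cubic_full U x : 3 <= #|nbhd e x :&: U| -> nbhd e x \subset U.
Proof.
rewrite -(e_cubic x) => c; apply/setIidPl/eqP.
by rewrite eqEcard subsetIl c.
Qed.

(** A nonempty set in which every vertex has three inner neighbours is closed under adjacency, hence
    everything. *)
Lemma degenerate_proper U : U != setT -> degenerate e U.
Proof.
move=> UT U' sU' U0; apply/exists_inP; apply: contraT => /exists_inPn h.
case/eqP: UT; apply/eqP; rewrite -subTset -(connected_closed U0) //.
move=> x y xU xy; have := h x xU; rewrite -ltnNge => /cubic_full /subsetP; apply.
by rewrite inE.
Qed.

Lemma alpha_in_subU U A B : U \subset A :|: B ->
  alpha_in e U <= alpha_in e A + alpha_in e B.
Proof.
move=> sU; have [S [iS sS <-]] := alpha_in_witness e U.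
have -> : S = (S :&: A) :|: (S :&: B).
  by rewrite -setIUr; apply/esym/setIidPl/(subset_trans sS).
apply: leq_trans (leq_card_setU _ _) _.
by apply: leq_add; apply: alpha_in_ge; rewrite ?subsetIr //;
  apply: independentS iS; rewrite subsetIl.
Qed.

Lemma alpha_in_disconnected A B : [disjoint A & B] ->
  (forall x y, x \in A -> y \in B -> ~~ e x y) ->
  exists S, [/\ independent e S, S \subset A :|: B
    & #|S| = alpha_in e A + alpha_in e B].
Proof.
move=> dAB nAB; have [S [iS sS cS]] := alpha_in_witness e A.
have [S' [iS' sS' cS']] := alpha_in_witness e B.
exists (S :|: S'); split; last 1 first.
- have := leq_card_setU S S'; rewrite (disjointWl sS) ?(disjointWr sS') //.
  by rewrite -cS -cS' => -[_ /eqP].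
- apply: independentU => // x y /(subsetP sS) xA /(subsetP sS').
  exact: nAB.
- exact: setUSS.
Qed.

Definition link (o1 o2 : T) : rel T := fun x y =>
  [|| e x y, (x == o1) && (y == o2) | (x == o2) && (y == o1)].

Lemma link_sym o1 o2 : symmetric (link o1 o2).
Proof. by move=> x y; rewrite /link e_sym orbC -orbA orbC -!orbA;
  do !case: (_ == _); rewrite ?orbT ?orbF //=; case: (e _ _). Qed.

Lemma link_irr o1 o2 : o1 != o2 -> irreflexive (link o1 o2).
Proof.
move=> n x; rewrite /link e_irr /=.
by have [->|_] := eqVneq x o1; rewrite ?(negbTE n) ?andbF.
Qed.

(* The case [o3 = o1] is that of a triangle contained in a diamond. *)
Definition framed_triangle (t1 t2 t3 o1 o2 o3 : T) : Prop :=
  [/\ [/\ nbhd e t1 = [set t2; t3; o1], nbhd e t2 = [set t1; t3; o2]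
        & nbhd e t3 = [set t1; t2; o3]],
      uniq [:: t1; t2; t3],
      [/\ o1 \notin [:: t1; t2; t3], o2 \notin [:: t1; t2; t3]
        & o3 \notin [:: t1; t2; t3]],
      o1 != o2 & (o3 == o1) || (o3 \notin [:: o1; o2])].

Lemma frame_exists x y z : e x y -> e y z -> e x z -> 4 < #|T| ->
  exists t1 t2 t3 o1 o2 o3, framed_triangle t1 t2 t3 o1 o2 o3.
Proof.
move=> xy yz xz T4.
have nxy : x != y by apply: contraTneq xy => ->; rewrite e_irr.
have nyz : y != z by apply: contraTneq yz => ->; rewrite e_irr.
have nxz : x != z by apply: contraTneq xz => ->; rewrite e_irr.
have third a b c : e a b -> e a c -> b != c ->
    exists2 o, nbhd e a = [set b; c; o] & o \notin [:: a; b; c].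
  move=> ab ac bc; have [o oE no] := cubic_third e_cubic ab ac bc.
  exists o => //; move: no; rewrite !inE !negb_or => ->; rewrite andbT.
  move/setP/(_ o): oE; rewrite !inE eqxx orbT => ao.
  by apply: contraTneq ao => ->; rewrite e_irr.
have [yx zy zx] : [/\ e y x, e z y & e z x] by rewrite !(e_sym _ x) (e_sym z).
have [o1 n1 h1] := third x y z xy xz nyz.
have [o2 n2 h2] := third y x z yx yz nxz.
have [o3 n3 h3] := third z x y zx zy nxy.
have frame a b c p q r : nbhd e a = [set b; c; p] -> nbhd e b = [set a; c; q] ->
    nbhd e c = [set a; b; r] -> uniq [:: a; b; c] ->
    p \notin [:: a; b; c] -> q \notin [:: a; b; c] -> r \notin [:: a; b; c] ->
    p != q -> exists t1 t2 t3 o1 o2 o3, framed_triangle t1 t2 t3 o1 o2 o3.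
  move=> na nb nc u hp hq hr pq.
  (* If [r = q], exchanging the first two triangle vertices turns this into the permitted case
     [o3 = o1]. *)
  have [rq|rq] := eqVneq r q; last first.
    by exists a, b, c, p, q, r; split=> //; rewrite !inE (negbTE rq) orbF orbN.
  exists b, a, c, q, p, r; split => //.
  - by split => //; rewrite nc (setUC [set a]).
  - by move: u; rewrite /= !inE !negb_or (eq_sym b a) => /and3P[/andP[-> ->] -> _].
  - by split; [move: hq|move: hp|move: hr]; rewrite !inE; do !case: eqP.
  - by rewrite eq_sym.
  - by rewrite rq eqxx.
have u : uniq [:: x; y; z] by rewrite /= !inE negb_or nxy nxz nyz.
have h2' : o2 \notin [:: x; y; z] by move: h2; rewrite !inE; do !case: eqP.
have h3' : o3 \notin [:: x; y; z] by move: h3; rewrite !inE; do !case: eqP.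
have [o12|] := eqVneq o1 o2; last exact: frame n1 n2 n3 u h1 h2' h3'.
have [o13|] := eqVneq o1 o3; last first.
  apply: (frame x z y o1 o3 o2) => //.
  - by rewrite n1 (setUC [set y]).
  - by move: u; rewrite /= !inE !negb_or (eq_sym z y) => /and3P[/andP[-> ->] -> _].
  - by move: h1; rewrite !inE; do !case: eqP.
  - by move: h3'; rewrite !inE; do !case: eqP.
  - by move: h2'; rewrite !inE; do !case: eqP.
(* With a single outer neighbour the triangle lies in a component K4. *)
subst o2 o3.
pose K := [set w in [:: x; y; z; o1]].
have memn a w : w \in nbhd e a -> e a w by rewrite inE.
have no : nbhd e o1 = [set x; y; z].
  apply/esym/eqP; rewrite eqEcard e_cubic; apply/andP; split; last first.
    have -> : [set x; y; z] = [set w in [:: x; y; z]] by apply/setP => w; rewrite !inE orbA.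
    by rewrite cardsE (card_uniqP u).
  by rewrite !subUset !sub1set !inE !(e_sym o1);
     rewrite !memn // ?n1 ?n2 ?n3 !inE eqxx ?orbT.
have KT : K = setT.
  apply: connected_closed; first by apply/set0Pn; exists x; rewrite !inE eqxx.
  have nb a b : e a b -> b \in nbhd e a by rewrite inE.
  move=> a b; rewrite !inE => /or4P[] /eqP-> /nb; rewrite ?n1 ?n2 ?n3 ?no !inE -?orbA;
  by case/or3P => ->; rewrite ?orbT.
suff : #|T| <= 4 by rewrite leqNgt T4.
by rewrite -cardsT -KT cardsE card_size.
Qed.

Section Frame.
Variables t1 t2 t3 o1 o2 o3 : T.
Hypothesis fr : framed_triangle t1 t2 t3 o1 o2 o3.

Definition off_triangle : {set T} := ~: [set x in [:: t1; t2; t3]].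
Local Notation U := off_triangle.

Let n1 : nbhd e t1 = [set t2; t3; o1]. Proof. by case: fr => -[]. Qed.
Let n2 : nbhd e t2 = [set t1; t3; o2]. Proof. by case: fr => -[]. Qed.
Let n3 : nbhd e t3 = [set t1; t2; o3]. Proof. by case: fr => -[]. Qed.

Lemma in_off x : (x \in U) = (x \notin [:: t1; t2; t3]).
Proof. by rewrite /off_triangle in_setC in_set. Qed.

Lemma frame_edges : [/\ [/\ e t1 t2, e t2 t3 & e t1 t3],
  [/\ e o1 t1, e o2 t2 & e o3 t3] & [/\ o1 \in U, o2 \in U & o3 \in U]].
Proof.
have m a w : w \in nbhd e a -> e a w by rewrite inE.
split; last by case: fr => _ _ [? ? ?] _ _; rewrite !in_off.
  by split; apply: m; rewrite ?n1 ?n2 ?n3 !inE eqxx ?orbT.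
by split; rewrite e_sym; apply: m; rewrite ?n1 ?n2 ?n3 !inE eqxx ?orbT.
Qed.

Lemma frame_nbr x t : t \in [:: t1; t2; t3] -> x \in U -> e x t ->
  (t == t1) && (x == o1) || (t == t2) && (x == o2) || (t == t3) && (x == o3).
Proof.
move=> tin xU xt; have xn : x \in nbhd e t by rewrite inE e_sym.
move: xU tin; rewrite in_off !inE !negb_or => /and3P[x1 x2 x3].
by case/or3P => /eqP tE; move: xn; rewrite tE ?n1 ?n2 ?n3 !inE
  ?(negbTE x1) ?(negbTE x2) ?(negbTE x3) /= => ->; rewrite ?eqxx ?orbT.
Qed.

Lemma card_off_triangle : #|U| + 3 = #|T|.
Proof.
have <- : #|[set x in [:: t1; t2; t3]]| = 3 by case: fr => _ u *; rewrite cardsE (card_uniqP u).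
by rewrite addnC; apply: cardsC.
Qed.

Lemma off_triangle_proper : U != setT.
Proof. by apply/eqP => UT; have := card_off_triangle; rewrite UT cardsT; nlia. Qed.

(** [t] can be added to [S], since [o] is its only neighbour off the triangle. *)
Lemma alpha_extend S t o : (t == t1) && (o == o1) || (t == t2) && (o == o2) ||
    (t == t3) && (o == o3) -> independent e S -> S \subset U -> o \notin S ->
  #|S| < alpha e.
Proof.
move=> to iS sS oS; rewrite alphaE.
have tin : t \in [:: t1; t2; t3] by move: to; rewrite -!orbA => /or3P[] /andP[/eqP-> _]; rewrite !inE eqxx ?orbT.
have tS : t \notin S.
  by apply/negP => /(subsetP sS); rewrite in_off tin.
suff : #|t |: S| <= alpha_in e setT by rewrite cardsU1 tS.
apply: alpha_in_ge (subsetT _).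
apply: independentU1 => // y yS; apply/negP => ty.
have := subsetP sS y yS; move=> yU.
have yt : e y t by rewrite e_sym.
have := frame_nbr tin yU yt; case: fr => _ + _ _ _; rewrite /= !inE negb_or.
move=> /and3P[/andP[t12 t13] t23 _]; move: to yS; rewrite -!orbA.
by case/or3P => /andP[/eqP-> /eqP ?]; subst o;
   rewrite ?eqxx ?(negbTE t12) ?(negbTE t13) ?(negbTE t23) ?(eq_sym t2 t1) ?(eq_sym t3 t1)
     ?(eq_sym t3 t2) ?(negbTE t12) ?(negbTE t13) ?(negbTE t23) /= ?orbF => yS /eqP yo;
   rewrite -yo yS in oS.
Qed.

(** A set independent in the linked graph misses [o1] or [o2], so [t1] or [t2] can be added. *)
Lemma alpha_link : alpha_in (link o1 o2) U < alpha e.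
Proof.
have [S [/independentP iS sS <-]] := alpha_in_witness (link o1 o2) U.
have iS' : independent e S.
  by apply/independentP => x y xS yS; apply: contra (iS x y xS yS); rewrite /link => ->.
have [o1S|o1S] := boolP (o1 \in S); last first.
  by apply: (alpha_extend (t := t1) (o := o1)); rewrite ?eqxx.
apply: (alpha_extend (t := t2) (o := o2)); rewrite ?eqxx ?orbT //.
apply/negP => o2S; have := iS o1 o2 o1S o2S.
by rewrite /link !eqxx orbT.
Qed.

(** At [o1] and [o2] the new edge takes the place of an edge to the triangle. *)
Lemma link_deg3 x : x \in U -> #|nbhd (link o1 o2) x :&: U| <= 3.
Proof.
move=> xU; have [_ [a1 a2 a3] [u1 u2 u3]] := frame_edges.
have cnt t o : x = o -> e o t -> t \notin U -> #|nbhd e x :&: U| <= 2.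
  move=> -> ot tU; have := cubic_deg3 e_cubic o setT.
  have := card_nbrs_removed (subsetT U) (in_setT t) tU ot; nlia.
have step o t t' : x = o -> o != t -> e o t' -> t' \notin U ->
   nbhd (link o1 o2) x :&: U \subset t |: (nbhd e x :&: U) ->
   #|nbhd (link o1 o2) x :&: U| <= 3.
  move=> xo ot et tU /subset_leq_card; rewrite cardsU1.
  have := cnt _ _ xo et tU; case: (_ \notin _) => /=; nlia.
have nU t : t \in [:: t1; t2; t3] -> t \notin U by rewrite in_off negbK.
have no12 : o1 != o2 by case: fr.
have [xo1|x1] := eqVneq x o1.
  apply: (@step o1 o2 t1) => //; first by apply: nU; rewrite !inE eqxx.
  apply/subsetP => y; rewrite !inE xo1 /link eqxx (negbTE no12) /= orbF.
  by case/andP => /orP[->|/eqP->]; rewrite ?eqxx // => ->; rewrite orbT.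
have [xo2|x2] := eqVneq x o2.
  apply: (@step o2 o1 t2) => //; first by rewrite eq_sym.
    by apply: nU; rewrite !inE eqxx orbT.
  apply/subsetP => y; rewrite !inE xo2 /link eqxx eq_sym (negbTE no12) /=.
  by case/andP => /orP[->|/eqP->]; rewrite ?eqxx // => ->; rewrite orbT.
apply: leq_trans (cubic_deg3 e_cubic x U); apply/subset_leq_card/subsetP => y.
by rewrite !inE /link (negbTE x1) (negbTE x2) !orbF.
Qed.

(** Suppose all linked degrees in [U'] are three. Then [U'] contains [o1] and [o2] but not [o3], and
    no edge joins it to [W], the rest of [U]. Independent sets of size alpha in [U] contain all
    outer neighbours, so alpha drops when [o1] leaves [U'] and when [o3] leaves [W]. Thus |U'| - 1
    <= 3(alpha(U') - 1), likewise for [W], and the sum gives |T| <= 3 alpha - 1. *)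
Lemma link_degenerate : 3 * alpha e <= #|T| -> alpha e <= alpha_in e U ->
  degenerate (link o1 o2) U.
Proof.
move=> al aU U' sU' U0; apply/exists_inP; apply: contraT => /exists_inPn h.
have {}h v : v \in U' -> 3 <= #|nbhd (link o1 o2) v :&: U'|.
  by move=> /h; rewrite -ltnNge.
have [_ [a1 a2 a3] [u1 u2 u3]] := frame_edges.
have tU t : t \in [:: t1; t2; t3] -> t \notin U by rewrite in_off negbK.
have tU' t : t \in [:: t1; t2; t3] -> t \notin U'.
  by move=> /tU; apply: contra => /(subsetP sU').
have [m1 m2 m3] : [/\ t1 \notin U', t2 \notin U' & t3 \notin U'].
  by split; apply: tU'; rewrite !inE eqxx ?orbT.
have no12 : o1 != o2 by case: fr.
have inner v : v \in U' -> v != o1 -> v != o2 -> nbhd e v \subset U'.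
  move=> vU v1 v2; apply: cubic_full; apply: leq_trans (h v vU) _.
  by apply/subset_leq_card/subsetP => y; rewrite !inE /link (negbTE v1) (negbTE v2) !orbF.
have outer o o' t : (o == o1) && (o' == o2) || (o == o2) && (o' == o1) ->
    o \in U' -> e o t -> t \notin U' -> o' \in U' /\ nbhd e o :\ t \subset U'.
  move=> oo oU ot tU2.
  have sub : nbhd (link o1 o2) o :&: U' \subset (nbhd e o :&: U') :|: ([set o'] :&: U').
    apply/subsetP => y; rewrite !inE; case: (y \in U'); rewrite ?andbF ?andbT //.
    rewrite /link; case: (e o y) => //=; case/orP: oo => /andP[/eqP-> /eqP->];
    rewrite ?eqxx ?(negbTE no12) ?(eq_sym o2 o1) ?(negbTE no12) //= ?orbF //.
  have c1 : #|nbhd e o :\ t| = 2.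
    have := e_cubic o; rewrite (cardsD1 t) inE ot; nlia.
  have c2 : #|nbhd e o :&: U'| <= 2.
    rewrite -c1; apply/subset_leq_card/subsetP => y; rewrite !inE => /andP[-> yU].
    by rewrite andbT; apply: contraNneq tU2 => <-.
  have := leq_trans (h o oU) (leq_trans (subset_leq_card sub) (leq_card_setU _ _)).
  have c3 : #|[set o'] :&: U'| <= 1 by rewrite -(cards1 o') subset_leq_card ?subsetIl.
  move=> c4; split.
    have /card_gt0P[y] : 0 < #|[set o'] :&: U'| by nlia.
    by rewrite !inE => /andP[/eqP->].
  have /eqP -> : nbhd e o :\ t == nbhd e o :&: U'; last exact: subsetIr.
  rewrite eq_sym eqEcard c1; apply/andP; split; last by nlia.
  apply/subsetP => y; rewrite !inE => /andP[-> yU].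
  by rewrite andbT; apply: contraNneq tU2 => <-.
have outer1 : o1 \in U' -> o2 \in U' /\ nbhd e o1 :\ t1 \subset U'.
  by move=> o1U; apply: outer; rewrite ?eqxx.
have outer2 : o2 \in U' -> o1 \in U' /\ nbhd e o2 :\ t2 \subset U'.
  by move=> o2U; apply: outer; rewrite ?eqxx ?orbT.
(* Each of [o1], [o2] needs the new edge to reach degree three, so [U'] contains both or neither;
   with neither it would be closed under adjacency. *)
have o1U' : o1 \in U'.
  apply: contraT => o1U; have o2U : o2 \notin U' by apply: contra o1U => /outer2[].
  case/negP: m1; rewrite (connected_closed U0) ?inE // => x y xU xy.
  apply: (subsetP (inner x xU _ _)); rewrite ?inE //.
    by apply: contraNneq o1U => <-.
  by apply: contraNneq o2U => <-.
have [o2U' s1] := outer1 o1U'; have [_ s2] := outer2 o2U'.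
(* Otherwise the neighbour [t3] of [o3] would be drawn into [U']. *)
have o3U' : o3 \notin U'.
  apply/negP => o3U; have t31 : t3 != t1.
    by rewrite eq_sym; case: fr => _ + _ _ _; rewrite /= !inE negb_or => /and3P[/andP[]].
 
  have t32 : t3 != t2 by rewrite eq_sym; case: fr => _ + _ _ _; rewrite /= !inE => /and3P[].
  case/negP: m3.
  have [o31|n31] := eqVneq o3 o1; first by apply: (subsetP s1); rewrite !inE t31 -o31.
  have [o32|n32] := eqVneq o3 o2; first by apply: (subsetP s2); rewrite !inE t32 -o32.
  by apply: (subsetP (inner o3 o3U n31 n32)); rewrite inE.
pose W := U :\: U'.
have nUW x y : x \in U' -> y \in W -> ~~ e x y.
  move=> xU; rewrite inE => /andP[yU' yU]; apply/negP => xy.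
  have ny t : t \in [:: t1; t2; t3] -> y != t by move=> /tU; apply: contraNneq => <-.
  case/negP: yU'; have [x1|n1x] := eqVneq x o1.
    by apply: (subsetP s1); rewrite !inE -x1 xy andbT; apply: ny; rewrite !inE eqxx.
  have [x2|n2x] := eqVneq x o2.
    by apply: (subsetP s2); rewrite !inE -x2 xy andbT; apply: ny; rewrite !inE eqxx orbT.
  by apply: (subsetP (inner x xU n1x n2x)); rewrite inE.
have dUW : [disjoint U' & W] by rewrite disjoints_subset; apply/subsetP => x; rewrite !inE => ->.
have UUW : U = U' :|: W.
  apply/setP => x; rewrite /W in_setU in_setD; case xU : (x \in U') => //=.
  by rewrite (subsetP sU').
have cUW : #|U'| + #|W| = #|U|.
  by have := leq_card_setU U' W; rewrite dUW -UUW => -[_ /eqP->].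
have dg A : A \subset U -> #|A| <= 3 * alpha_in e A.
  move=> sA; apply: alpha_in_degenerate => //.
  apply: degenerate_proper; apply: contraNneq off_triangle_proper => AT.
  by rewrite -subTset -AT.
have sW : W \subset U := subsetDl _ _.
have o3W : o3 \in W by rewrite inE o3U'.
have [S1 [iS1 sS1 cS1]] : exists S, [/\ independent e S, S \subset (U' :\ o1) :|: W
    & #|S| = alpha_in e (U' :\ o1) + alpha_in e W].
  apply: alpha_in_disconnected; first by apply: disjointWl dUW; apply: subsetDl.
  by move=> x y /setD1P[_]; apply: nUW.
have [S2 [iS2 sS2 cS2]] : exists S, [/\ independent e S, S \subset U' :|: (W :\ o3)
    & #|S| = alpha_in e U' + alpha_in e (W :\ o3)].
  apply: alpha_in_disconnected; first by apply: disjointWr dUW; apply: subsetDl.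
  by move=> x y xU /setD1P[_]; apply: nUW.
have [S3 [iS3 _ cS3]] := alpha_in_disconnected dUW nUW.
have b1 : #|S1| < alpha e.
  apply: (alpha_extend (t := t1) (o := o1)) => //; first by rewrite !eqxx.
    by apply: subset_trans sS1 _; rewrite UUW setSU ?subsetDl.
  by apply/negP => /(subsetP sS1); rewrite !inE eqxx o1U'.
have b2 : #|S2| < alpha e.
  apply: (alpha_extend (t := t3) (o := o3)) => //; first by rewrite !eqxx orbT.
    by apply: subset_trans sS2 _; rewrite UUW setUS ?subsetDl.
  by apply/negP => /(subsetP sS2); rewrite !inE eqxx (negbTE o3U').
have b3 : #|S3| <= alpha e by rewrite alphaE; apply: alpha_in_ge.
have b4 : alpha_in e U <= alpha_in e U' + alpha_in e W by apply: alpha_in_subU; rewrite UUW.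
have d1 : #|U' :\ o1| <= 3 * alpha_in e (U' :\ o1).
  by apply: dg; apply: subset_trans sU'; apply: subsetDl.
have d2 : #|W :\ o3| <= 3 * alpha_in e (W :\ o3).
  by apply: dg; apply: subset_trans sW; apply: subsetDl.
have e1 := cardsD1 o1 U'; rewrite o1U' in e1.
have e2 := cardsD1 o3 W; rewrite o3W in e2.
have e3 := card_off_triangle.
exfalso; clearbody W; nlia.
Qed.

End Frame.

(** A counterexample has a triangle; on the n - 3 vertices off it alpha drops, by itself or after
    linking, and in both cases the greedy bound applies. *)
Lemma cubic_alpha_ge : 4 < #|T| -> #|T| <= 3 * alpha e.
Proof.
move=> T4; rewrite leqNgt; apply/negP => al.
have T0 : 0 < #|T| by apply: leq_trans T4.
have [x [y [z [xy yz xz]]]] := cubic_triangle e_sym e_irr e_cubic T0 (ltnW al).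
have [t1 [t2 [t3 [o1 [o2 [o3 fr]]]]]] := frame_exists xy yz xz T4.
have cU := card_off_triangle fr.
have [aU|aU] := leqP (alpha e) (alpha_in e (off_triangle t1 t2 t3)).
  have dg := link_degenerate fr (ltnW al) aU.
  have no12 : o1 != o2 by case: fr.
  have := alpha_in_degenerate (@link_sym o1 o2) (link_irr no12) dg.
  have := alpha_link fr; nlia.
have := alpha_in_degenerate e_sym e_irr (degenerate_proper (off_triangle_proper fr)).
nlia.
Qed.

End Connected.

(** * Tilings of cubic graphs with independence ratio 1/3 *)

Lemma gedges_asym d v p : d \in [:: 1; 2; 3] -> p \in gedges d v ->
  (p.2, p.1) \notin gedges d v.
Proof.
move=> dd; have /allP := @forall_degree (fun d v =>
  all (fun p => (p.2, p.1) \notin gedges d v) (gedges d v)) isT d v dd.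
exact.
Qed.

(** Positions that are independent once the edge [(i, j)] is missing. Other pairs of attachment
    positions are excluded, since only saturation of one end rules out an additional edge. *)
Definition admissible d v (i j : nat) (ps : seq nat) : bool :=
  all (fun p => all (fun q => [|| p == q, (p, q) == (i, j), (p, q) == (j, i) |
    (q \notin gnb d v p) && ~~ (attpos d p && attpos d q)]) ps) ps.

(** Each edge of the 9-vertex gadgets is critical: without it some four positions are independent,
    as an enumeration shows. *)
Lemma nine_admissible v p : p \in gedges 1 v -> exists ps,
  [/\ admissible 1 v p.1 p.2 ps, size ps = 4, uniq ps
    & [&& all (fun q => q < 9) ps, p.1 \in ps & p.2 \in ps]].
Proof.
(* [if] rather than [&&], which [vm_compute] would evaluate eagerly. *)
pose good p ps := if [&& size ps == 4, p.1 \in ps & p.2 \in ps] then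
  [&& admissible 1 v p.1 p.2 ps, uniq ps & all (fun q => q < 9) ps] else false.
have : all (fun p => has (good p)
  [seq [seq q <- iota 0 9 | nth false b q] | b <- bitseqs 9]) (gedges 1 v).
  by rewrite /good; case: v {good}; vm_compute.
move=> /allP h /h /hasP[ps _]; rewrite /good; case: ifP => // /and3P[/eqP sp h1 h2].
by case/and3P => adm u al; exists ps; rewrite h1 h2 al.
Qed.

Section CubicTiling.
Variables (T : finType) (x0 : T) (e : rel T).
Hypotheses (e_sym : symmetric e) (e_irr : irreflexive e)
  (e_conn : connected_graph e) (e_cubic : cubic e).
Hypotheses (T12 : 12 < #|T|) (al : 3 * alpha e = #|T|).
Implicit Types (U S I W : {set T}) (L : seq (bool * seq T)).

(** * Tiles that use the new edge *)

Section BadTile.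
Variables t1 t2 t3 o1 o2 o3 : T.
Hypothesis fr : framed_triangle e t1 t2 t3 o1 o2 o3.
Local Notation U := (off_triangle t1 t2 t3).
Local Notation e2 := (link e o1 o2).

Let no12 : o1 != o2. Proof. by case: fr. Qed.
Let e2_sym : symmetric e2. Proof. exact: link_sym. Qed.
Let e2_irr : irreflexive e2. Proof. exact: link_irr. Qed.
Let ut : uniq [:: t1; t2; t3]. Proof. by case: fr. Qed.

Variables (v : bool) (s : seq T) (L : seq (bool * seq T)) (i j : nat).
Let d := gdeg s.
Hypotheses (gs : gadget x0 e2 (v, s)) (us : uniq s) (sU : {subset s <= U})
  (tL : tiling x0 e (U :\: [set x in s]) L)
  (ij : (i, j) \in gedges d v) (nij : ~~ e (nth x0 s i) (nth x0 s j)).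
Local Notation "'s_ k" := (nth x0 s k) (at level 8, k at level 2, format "''s_' k").

Let dd : d \in [:: 1; 2; 3]. Proof. by have [] := gadget_size gs. Qed.
Let sz : size s = gsize d. Proof. by have [] := gadget_size gs. Qed.

Let edge_lt p : p \in gedges d v -> (p.1 < size s) /\ (p.2 < size s).
Proof. by rewrite sz => /gedges_lt[]. Qed.

Let edge2 p : p \in gedges d v -> e2 's_(p.1) 's_(p.2).
Proof. by case/andP: gs => _ /allP h /h. Qed.

Let ends_o : ('s_i = o1 /\ 's_j = o2) \/ ('s_i = o2 /\ 's_j = o1).
Proof.
have := edge2 ij; rewrite /link (negbTE nij) /=.
by case/orP => /andP[/eqP-> /eqP->]; [left|right].
Qed.

Let ends_in : o1 \in s /\ o2 \in s.
Proof.
have [/= i1 j1] := edge_lt ij.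
have [iin jin] : 's_i \in s /\ 's_j \in s by split; apply: mem_nth.
by case: ends_o iin jin => -[-> ->].
Qed.

Let intact p : p \in gedges d v -> p != (i, j) -> e 's_(p.1) 's_(p.2).
Proof.
move=> pE pij; have [p1 p2] := edge_lt pE; have [/= i1 j1] := edge_lt ij.
have := edge2 pE; rewrite /link => /orP[//|h].
have : ((p.1 == i) && (p.2 == j)) || ((p.1 == j) && (p.2 == i)).
  rewrite -!(nth_uniq x0 _ _ us) //.
  by case: ends_o h => -[-> ->]; rewrite // orbC.
case/orP => /andP[/eqP p1E /eqP p2E].
  by move: pij; rewrite -p1E -p2E -surjective_pairing eqxx.
have /negP[] := gedges_asym dd ij; rewrite /= -p1E -p2E.
by rewrite -surjective_pairing.
Qed.

Let e_e2 x y : e x y -> e2 x y. Proof. by rewrite /link => ->. Qed.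

Let inner_e p x : p < size s -> ~~ attpos d p -> x \in U -> e 's_p x ->
  x \in gnbs x0 (v, s) p.
Proof.
move=> pl na xU ex.
have pU : 's_p \in U := sU (mem_nth x0 pl).
have <- := inner_nbrs e2_sym gs us sU pl (link_deg3 e_sym e_cubic fr pU) na.
by rewrite in_setI xU andbT inE; apply: e_e2.
Qed.

Let nonadjacent p q : p < size s -> q < size s -> ~~ (attpos d p && attpos d q) ->
  q \notin gnb d v p -> ~~ e 's_p 's_q.
Proof.
move=> pl ql att nq; apply/negP => epq.
have [ap|ap] := boolP (attpos d p); last first.
  have := inner_e pl ap (sU (mem_nth x0 ql)) epq.
  by rewrite (mem_gnbs gs us pl ql) => nq'; rewrite nq' in nq.
rewrite ap /= in att; rewrite e_sym in epq.
have := inner_e ql att (sU (mem_nth x0 pl)) epq.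
rewrite (mem_gnbs gs us ql pl); move: nq.
by rewrite !mem_gnb -?sz // orbC => /negP.
Qed.

(** Triangle and broken tile are cut anew into gadgets [G] and a path with nonadjacent ends, which
    [tiling_step] on the whole graph absorbs. *)
Let path_finish u a b G : e u a -> e u b -> ~~ e a b -> a != b ->
  all (gadget x0 e) G -> perm_eq ([:: u; a; b] ++ cells G) ([:: t1; t2; t3] ++ s) ->
  exists L', tiling x0 e setT L'.
Proof.
move=> ua ub nab dab gG pG; have [gL _ _] := tL.
have u_all : uniq ([:: t1; t2; t3] ++ s).
  rewrite cat_uniq ut us andbT /=; apply/hasPn => x /sU.
  by rewrite in_off.
have := u_all; rewrite -(perm_uniq pG) cat_uniq => /and3P[up hp uG].
apply: (@tiling_step _ x0 e e_sym e_irr setT u a b (G ++ L)) => //.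
- by move=> x _; apply: cubic_deg3.
- apply: (@retile _ x0 e _ (cells G) L).
  + apply: tiling_eq tL; apply/setP => x; rewrite in_setD in_off !in_setD in_setT andbT !in_set.
    have := perm_mem pG x; rewrite !mem_cat => h.
    by rewrite -!negb_or orbC -h orbC.
  + exact: uG.
  + by move=> x xG; rewrite in_setD in_setT andbT in_set (hasPn hp).
  + by rewrite all_cat gG gL.
  + by rewrite /cells map_cat flatten_cat.
- by rewrite -alphaE al cardsT.
Qed.

Let t2_nbr y : y \in U -> e y t2 -> y = o2.
Proof.
move=> yU yt; have := frame_nbr e_sym fr (_ : t2 \in [:: t1; t2; t3]) yU yt.
rewrite !inE eqxx orbT => /(_ isT).
have := ut; rewrite /= !inE negb_or => /and3P[/andP[n12 _] n23 _].
by rewrite (eq_sym t2 t1) (negbTE n12) (negbTE n23) /= orbF => /eqP.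
Qed.

Let t3_nbr y : y \in U -> e y t3 -> y = o3.
Proof.
move=> yU yt; have := frame_nbr e_sym fr (_ : t3 \in [:: t1; t2; t3]) yU yt.
rewrite !inE eqxx !orbT => /(_ isT).
have := ut; rewrite /= !inE negb_or => /and3P[/andP[_ n13] n23 _].
by rewrite !(eq_sym t3) (negbTE n13) (negbTE n23) /= => /eqP.
Qed.

(** [o3] has lost its edge to [t3]; if [o3 = o1], it has lost two edges and gained the new one. *)
Let deg_o3 : #|nbhd e2 o3 :&: U| <= 2.
Proof.
have [_ [a1 a2 a3] [u1 u2 u3]] := frame_edges e_sym fr.
have tU t : t \in [:: t1; t2; t3] -> t \notin U by rewrite in_off negbK.
have [t1U t3U] : t1 \notin U /\ t3 \notin U by split; apply: tU; rewrite !inE eqxx ?orbT.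
case: (fr) => _ _ _ _ /orP[/eqP o31|].
  have t13 : t1 != t3 by move: ut; rewrite /= !inE negb_or => /and3P[/andP[]].
  apply: (@leq_trans #|o2 |: (nbhd e o1 :\: [set t1; t3])|).
    apply/subset_leq_card/subsetP => y; rewrite o31 in_setI => /andP[+ yU].
    rewrite inE /link (negbTE no12) eqxx /= orbF !inE => /orP[ey|->//].
    rewrite ey andbT negb_or; apply/orP; right.
    by apply/andP; split; apply: contraTneq yU => ->.
  have c : #|nbhd e o1 :\: [set t1; t3]| = 1.
    rewrite cardsD (setIidPr _) ?cards2 ?t13 ?e_cubic //.
    by rewrite subUset !sub1set !inE a1 -o31 a3.
  by rewrite cardsU1 c; case: (_ \notin _).
rewrite !inE negb_or => /andP[n1 n2].
have -> : nbhd e2 o3 = nbhd e o3.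
  by apply/setP => y; rewrite !inE /link (negbTE n1) (negbTE n2) !orbF.
have := card_nbrs_removed (subsetT U) (in_setT t3) t3U a3.
have := cubic_deg3 e_cubic o3 setT; nlia.
Qed.

(** A linked degree of at most two rules out an inner position and is used up by the gadget
    neighbours of an attachment position. *)
Let o3_att p : p < size s -> 's_p = o3 -> attpos d p /\
  forall x, x \in U -> e o3 x -> x \in s.
Proof.
move=> pl po; have c := card_gnbs gs us pl.
have sub : gnbs x0 (v, s) p \subset nbhd e2 o3 :&: U.
  rewrite -po; apply: subset_trans (gnbs_sub e2_sym gs pl) _; apply: setIS.
  by apply/subsetP => x; rewrite inE => /sU.
have ap : attpos d p.
  apply: contraT => na; have := leq_trans (subset_leq_card sub) deg_o3.
  by rewrite c (negbTE na).
split=> // x xU ox; have /eqP E : gnbs x0 (v, s) p == nbhd e2 o3 :&: U.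
  by rewrite eqEcard sub c ap deg_o3.
have : x \in gnbs x0 (v, s) p by rewrite E in_setI xU andbT inE; apply: e_e2.
by move/(subsetP (gnbs_sub e2_sym gs pl)); rewrite !inE => /andP[].
Qed.

(** This is where n > 12 enters. *)
Let closed_absurd (K : seq T) : size K <= 12 -> t1 \in K ->
  (forall x y, x \in K -> e x y -> y \in K) -> False.
Proof.
move=> K12 K1 cl; suff : #|T| <= 12 by rewrite leqNgt T12.
apply: leq_trans K12; apply: leq_trans (card_size K); rewrite -cardsT.
rewrite -(connected_closed e_conn (U := [set x in K])) ?cardsE //.
  by apply/set0Pn; exists t1; rewrite inE.
by move=> x y; rewrite !inE => xK /cl; apply.
Qed.

Let tri_closed x y : x \in [:: t1; t2; t3] -> e x y ->
  [\/ y \in [:: t1; t2; t3], y \in s | (x == t3) && (y == o3)].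
Proof.
have os := ends_in.
move=> xt xy; have [yt|yt] := boolP (y \in [:: t1; t2; t3]); first exact: Or31.
have yU : y \in U by rewrite in_off.
rewrite e_sym in xy; have := frame_nbr e_sym fr xt yU xy.
rewrite -!orbA; case/or3P => /andP[xE yE]; last by apply: Or33; rewrite xE.
  by apply: Or32; rewrite (eqP yE) os.1.
by apply: Or32; rewrite (eqP yE) os.2.
Qed.

(** * Independent sets of excessive size in a broken tile *)

Section Excess.
Variable ps : seq nat.
Hypotheses (adm : admissible d v i j ps) (ups : uniq ps)
  (lps : all (fun p => p < size s) ps) (cps : 3 * size ps = size s + 3)
  (o3ps : o3 \notin [seq 's_p | p <- ps]).

Let I0 : {set T} := [set x in [seq 's_p | p <- ps]].
Let out_at p : {set T} := (nbhd e2 's_p :&: U) :\: gnbs x0 (v, s) p.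
(** [t3] and [I0] together exceed a third of triangle and tile by one; they are compatible because
    [o3] is not chosen. [W] holds their neighbours outside, so a third of the remaining vertices,
    independent and off [W], would contradict the value of alpha. *)
Let W : {set T} := (U :\: [set x in s]) :&: (o3 |: \bigcup_(p <- ps) out_at p).

Let I0P x : x \in I0 -> exists p, [/\ p \in ps, p < size s & x = 's_p].
Proof.
rewrite inE => /mapP[p pin ->]; exists p; split => //.
exact: (allP lps).
Qed.

Let cI0 : #|I0| = size ps.
Proof.
rewrite cardsE (card_uniqP _) ?size_map // map_inj_in_uniq // => p q pin qin /eqP.
by rewrite nth_uniq ?(allP lps) // => /eqP.
Qed.

Let iI0 : independent e I0.
Proof.
apply/independentP => x y /I0P[p [pin pl ->]] /I0P[q [qin ql ->]].
have /allP /(_ _ qin) := allP adm _ pin.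
case/or4P => [/eqP->|/eqP[-> ->]|/eqP[-> ->]|/andP[nq att]].
- by rewrite e_irr.
- exact: nij.
- by rewrite e_sym.
- exact: nonadjacent.
Qed.

Let card_outs : #|\bigcup_(p <- ps) out_at p| <= count (attpos d) ps.
Proof.
elim: ps lps => [|p qs IH] /=; first by rewrite big_nil cards0.
move=> /andP[pl ql]; rewrite big_cons; apply: leq_trans (leq_card_setU _ _) _.
apply: leq_add; last exact: IH.
have h := card_outer_nbrs e2_sym gs us sU pl (link_deg3 e_sym e_cubic fr (sU (mem_nth x0 pl))).
exact: h.
Qed.

Let in_outs p x : p \in ps -> x \in out_at p -> x \in \bigcup_(p <- ps) out_at p.
Proof. by move=> pin xp; rewrite (big_rem p) //= inE xp. Qed.

Let W_nbr x y : x \in t3 |: I0 -> y \in U -> y \notin s -> e x y -> y \in W.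
Proof.
move=> xI yU ys xy; rewrite inE in_setD in_set ys yU /= in_setU1.
case/setU1P: xI => [x3|/I0P[p [pin pl xp]]].
  by subst x; rewrite e_sym in xy; rewrite (t3_nbr yU xy) eqxx.
apply/orP; right; apply: in_outs pin _; rewrite in_setD in_setI yU andbT -xp.
apply/andP; split; last by rewrite inE; apply: e_e2.
apply: contra ys.
by move/(subsetP (gnbs_sub e2_sym gs pl)); rewrite !inE => /andP[].
Qed.

Let W_adj x : x \in W -> x \notin s /\ exists2 y, y \in t3 |: I0 & e y x.
Proof.
rewrite inE in_setD in_set => /andP[/andP[xs xU] xW]; split => //.
case/setU1P: xW => [->|].
  exists t3; first by rewrite !inE eqxx.
  by have [_ [_ _ ?] _] := frame_edges e_sym fr; rewrite e_sym.
move=> xb; have [p pin] : exists2 p, p \in ps & x \in out_at p.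
  elim: ps xb => [|q qs IH]; first by rewrite big_nil inE.
  rewrite big_cons inE => /orP[xq|/IH[p pin xp]]; first by exists q; rewrite ?mem_head.
  by exists p => //; rewrite inE pin orbT.
rewrite !inE => /andP[_ /andP[xp _]].
exists 's_p; first by rewrite !inE map_f ?orbT.
have pl := allP lps _ pin.
have [o1s o2s] := ends_in.
move: xp; rewrite /link => /orP[//|/orP[] /andP[_ /eqP xE]];
by move: xs; rewrite xE ?o1s ?o2s.
Qed.

(** The alternative with two adjacent triangle tiles would need four vertices of [W]. *)
Let excess_triangle : #|W| <= 3 -> exists h, [/\ h \in L, size h.2 = 3 & {subset h.2 <= W}].
Proof.
move=> cW; have [_ [a1 a2 a3] [u1 u2 u3]] := frame_edges e_sym fr.
have t3s : t3 \notin s by apply/negP => /sU; rewrite in_off !inE eqxx !orbT.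
have I0s x : x \in I0 -> x \in s by move=> /I0P[p [_ pl ->]]; apply: mem_nth.
have deg3 x : x \in U :\: [set x in s] -> #|nbhd e x :&: (U :\: [set x in s])| <= 3.
  by move=> _; apply: cubic_deg3.
have degW w : w \in W -> w \in U :\: [set x in s] ->
    #|nbhd e w :&: (U :\: [set x in s])| <= 2.
  move=> /W_adj[_ [y yI yw]] _; rewrite e_sym in yw.
  have yn : y \notin U :\: [set x in s].
    case/setU1P: yI => [->|/I0s ys]; last by rewrite in_setD in_set ys.
    by rewrite in_setD in_off !inE eqxx !orbT andbF.
  have := card_nbrs_removed (subsetT (U :\: [set x in s])) (in_setT y) yn yw.
  have := cubic_deg3 e_cubic w setT; nlia.
have cW4 : #|W| <= 4 by apply: leq_trans cW _.
have [[I [iI sI cI]]|//|[k1 [k2 [r1 [r2 H]]]]] := tiling_avoid e_sym e_irr tL deg3 degW cW4.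
- have sIx x : x \in I -> [/\ x \in U, x \notin s & x \notin W].
    by move=> /(subsetP sI); rewrite in_setD => /andP[-> /setDP[-> ]]; rewrite inE.
  have iJ : independent e (t3 |: I0).
    apply: independentU1 => // y yI; apply/negP => ty.
    have yU : y \in U by apply: sU; apply: I0s.
    rewrite e_sym in ty; have yo := t3_nbr yU ty.
    by move: yI o3ps; rewrite inE yo => ->.
  have iJI : independent e ((t3 |: I0) :|: I).
    apply: independentU => // x y xJ /sIx[yU ys yW]; apply: contra yW.
    exact: W_nbr.
  have d1 : [disjoint t3 |: I0 & I].
    rewrite disjoints_subset; apply/subsetP => x xJ; rewrite inE; apply/negP => /sIx[xU xs _].
    case/setU1P: xJ => [x3|/I0s]; last by rewrite (negbTE xs).
    by move: xU; rewrite x3 in_off !inE eqxx !orbT.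
  have t3I : t3 \notin I0 by apply: contra t3s => /I0s.
  have := alpha_in_ge iJI (subsetT _); rewrite -alphaE.
  have := leq_card_setU (t3 |: I0) I; rewrite d1 => -[_ /eqP->].
  rewrite cardsU1 t3I cI0; have := card_off_triangle fr.
  have : #|U :\: [set x in s]| + size s = #|U|.
    have cs : #|[set x in s]| = size s by rewrite cardsE (card_uniqP us).
    have ss : [set x in s] \subset U by apply/subsetP => x; rewrite inE => /sU.
    by rewrite cardsD (setIidPr ss) -cs subnK // subset_leq_card.
  by move: cI cps al; nlia.
- exfalso; case: H => [[k1l k2l k12] [s1 s2 er] [r1in _ W1] [r2in _ W2]].
  have [gg1 ug1 sub1] := tiling_cell tL (mem_nth (g0 T) k1l).
  have [gg2 ug2 sub2] := tiling_cell tL (mem_nth (g0 T) k2l).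
  have u4 : uniq (rem r1 (nth (g0 T) L k1).2 ++ rem r2 (nth (g0 T) L k2).2).
    rewrite cat_uniq !rem_uniq //= andbT; apply/hasPn => x /mem_rem x2.
    apply/negP => /mem_rem x1; move/negP: k12; apply; apply/eqP.
    by rewrite -(blk_eq tL k1l x1) (blk_eq tL k2l x2).
  suff : 4 <= #|W| by rewrite leqNgt ltnS cW.
  have <- : size (rem r1 (nth (g0 T) L k1).2 ++ rem r2 (nth (g0 T) L k2).2) = 4.
    by rewrite size_cat !size_rem // s1 s2.
  rewrite -(card_uniqP u4); apply/subset_leq_card/subsetP => x.
  by rewrite mem_cat => /orP[/W1|/W2].
Qed.

Let W_le : #|W| <= (count (attpos d) ps).+1.
Proof.
apply: leq_trans (subset_leq_card (subsetIr _ _)) _.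
rewrite cardsU1; have := card_outs; case: (_ \notin _) => /=; nlia.
Qed.

Lemma few_attachments : count (attpos d) ps <= 1 -> False.
Proof.
move=> c; have cW : #|W| <= 2 by apply: leq_trans W_le _; rewrite ltnS.
have [h [hL h3 hW]] := excess_triangle (leq_trans cW (leqnSn _)).
have [_ uh _] := tiling_cell tL hL.
have : 3 <= #|W|.
  by rewrite -h3 -(card_uniqP uh); apply/subset_leq_card/subsetP.
by rewrite leqNgt ltnS cW.
Qed.

(** [W] has to be a triangle tile [h] containing [o3]. Then no edge leaves the 3 + 6 + 3 vertices of
    triangle, broken tile and [h]. *)
Lemma two_attachments : size s = 6 -> count (attpos d) ps <= 2 ->
  (forall p, p < size s -> attpos d p -> p \in ps) -> False.
Proof.
move=> s6 c hp; have cW : #|W| <= 3 by apply: leq_trans W_le _; rewrite ltnS.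
have [h [hL h3 hW]] := excess_triangle cW.
have [gh uh _] := tiling_cell tL hL.
have hset : #|[set x in h.2]| = 3 by rewrite cardsE (card_uniqP uh).
have hWset : [set x in h.2] \subset W by apply/subsetP => x; rewrite inE => /hW.
have /eqP hE : [set x in h.2] == W by rewrite eqEcard hWset hset.
have o3h : o3 \in h.2.
  apply: contraT => o3h; suff : 3 <= 2 by [].
  rewrite -{1}hset; apply: leq_trans c; apply: leq_trans card_outs.
  apply/subset_leq_card/subsetP => x xh; have := subsetP hWset x xh.
  rewrite in_setI in_setU1 => /andP[_ /orP[/eqP xo|//]].
  by move: o3h xh; rewrite inE xo => /negbTE ->.
apply: (@closed_absurd ([:: t1; t2; t3] ++ s ++ h.2)).
- by rewrite !size_cat s6 h3.
- by rewrite !mem_cat !inE eqxx.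
- move=> x y; rewrite !mem_cat => /or3P[xt|xs|xh] xy.
  + have [->//|->|/andP[_ /eqP->]] := tri_closed xt xy; first by rewrite orbT.
    by rewrite o3h !orbT.
  + have [//|yt] := boolP (y \in [:: t1; t2; t3]).
    have [_|ys] := boolP (y \in s); first by rewrite orbT.
    have yU : y \in U by rewrite in_off.
    have pl : index x s < size s by rewrite index_mem.
    have xE : 's_(index x s) = x by rewrite nth_index.
    have [ap|ap] := boolP (attpos d (index x s)).
      have : y \in W.
        apply: (@W_nbr x y) => //.
        by rewrite !inE -xE map_f ?orbT // hp.
      by rewrite -hE inE => ->; rewrite !orbT.
    rewrite -xE in xy; have := inner_e pl ap yU xy.
    move/(subsetP (gnbs_sub e2_sym gs pl)); rewrite !inE => /andP[_ ys'].
    by rewrite ys' in ys.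
  + have [xs [w wI wx]] := W_adj (hW x xh); rewrite e_sym in wx.
    have [p [q [remE pq]]] := perm3_rem uh h3 xh.
    have [a b _] : [/\ e p q, e q x & e p x] := triangle_perm e_sym gh pq uh.
    have ph : p \in h.2 by rewrite (perm_mem pq) !inE eqxx.
    have qh : q \in h.2 by rewrite (perm_mem pq) !inE eqxx !orbT.
    have upq : uniq [:: p; q; x] by rewrite -(perm_uniq pq).
    have [xp xq] : e x p /\ e x q.
      by split; [apply: (triangle_clique e_sym gh)|rewrite e_sym] => //;
         move: upq; rewrite /= !inE negb_or (eq_sym x) => /and3P[/andP[]].
    have hs z : z \in h.2 -> z \notin t3 |: I0.
      move=> zh; have zW := hW z zh; have [zs _] := W_adj zW.
      rewrite in_setU1 negb_or; apply/andP; split; last first.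
        by apply: contra zs => /I0P[k [_ kl ->]]; apply: mem_nth.
      move: zW; rewrite in_setI in_setD => /andP[/andP[_ zU] _].
      by apply: contraTneq zU => ->; rewrite in_off !inE eqxx !orbT.
    have wp : w != p by apply: contraTneq wI => ->; apply: hs.
    have wq : w != q by apply: contraTneq wI => ->; apply: hs.
    have npq : p != q by move: upq; rewrite /= !inE negb_or => /and3P[/andP[]].
    have /eqP nx : [set z in [:: w; p; q]] == nbhd e x.
      rewrite eqEcard e_cubic cardsE (card_uniqP _) ?leqnn ?andbT; last first.
        by rewrite /= !inE negb_or wp wq npq.
      by apply/subsetP => z; rewrite !inE => /or3P[] /eqP->.
    have : y \in nbhd e x by rewrite inE.
    rewrite -nx !inE => /or3P[] /eqP->; rewrite ?ph ?qh ?orbT //.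
    case/setU1P: wI => [->|/I0P[k [_ kl ->]]]; first by rewrite !eqxx !orbT.
    by rewrite mem_nth ?orbT.
Qed.

End Excess.

(** With [w] the third vertex of the tile, [o1], [w], [o2] is the path to absorb, and [t1], [t2],
    [t3] is a tile. *)
Lemma bad_triangle : size s = 3 -> exists L', tiling x0 e setT L'.
Proof.
move=> s3; have [/= i1 j1] := edge_lt ij.
have iin : 's_i \in s by apply: mem_nth.
have jin : 's_j \in s by apply: mem_nth.
have nij' : 's_i != 's_j.
  by case: ends_o => -[-> ->] //; rewrite eq_sym.
have [p [q [rE pq]]] := perm3_rem us s3 iin.
have : 's_j \in [:: p; q].
  by rewrite -rE mem_rem_uniq // inE eq_sym nij' jin.
have [w pw] : exists w, 's_j \in [:: p; q] -> perm_eq s [:: 's_i; 's_j; w].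
  have [jp|jp] := eqVneq 's_j p.
    by exists q => _; apply: perm_trans pq _; rewrite jp; apply/permP => P /=; lia_counts.
  exists p; rewrite !inE (negbTE jp) => /eqP ->.
  by apply: perm_trans pq _; apply/permP => P /=; lia_counts.
move=> /pw {}pw.
have uw : uniq [:: 's_i; 's_j; w] by rewrite -(perm_uniq pw).
have win : w \in s by rewrite (perm_mem pw) !inE eqxx !orbT.
have [nwi nwj] : w != 's_i /\ w != 's_j.
  by move: uw; rewrite /= !inE negb_or !(eq_sym w) => /and3P[/andP[]].
have clq x y := triangle_clique e2_sym gs s3 (x := x) (y := y).
have wE x : e2 w x -> e w x.
  move: nwi nwj; rewrite /link; case: ends_o => -[-> ->] /negbTE h1 /negbTE h2;
  by rewrite h1 h2 !orbF.
have ewi : e w 's_i by apply: wE; apply: clq.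
have ewj : e w 's_j by apply: wE; apply: clq.
have [[a1 a2 a3] _ _] := frame_edges e_sym fr.
apply: (@path_finish w 's_i 's_j [:: (false, [:: t1; t2; t3])]) => //.
  by rewrite /= triangle_gadget a1 a2 a3.
by apply/permP => P; rewrite /cells /= (permP pw) /=; lia_counts.
Qed.

(** If [o3] is in the tile, it occupies the only attachment position, and triangle and tile form a
    closed set of 12 vertices. Otherwise four independent positions exist, at most one of them an
    attachment. *)
Lemma bad_nine : size s = 9 -> exists L', tiling x0 e setT L'.
Proof.
move=> s9; have d1 : d = 1 by rewrite /d /gdeg s9.
exfalso; have [o3s|o3s] := boolP (o3 \in s).
  apply: (@closed_absurd ([:: t1; t2; t3] ++ s)).
  - by rewrite size_cat s9.
  - by rewrite mem_cat !inE eqxx.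
  - have pl : index o3 s < size s by rewrite index_mem.
    have [ap o3c] := o3_att pl (nth_index x0 o3s).
    move=> x y; rewrite !mem_cat => /orP[xt|xs] xy.
      have [->//|->|/andP[_ /eqP->]] := tri_closed xt xy; first by rewrite orbT.
      by rewrite o3s orbT.
    have [//|yt] := boolP (y \in [:: t1; t2; t3]).
    have yU : y \in U by rewrite in_off.
    have xl : index x s < size s by rewrite index_mem.
    have xE : 's_(index x s) = x by rewrite nth_index.
    have [ax|ax] := boolP (attpos d (index x s)).
      have xo : x = o3.
        move: ax ap; rewrite d1 /= => /eqP x1 /eqP o1'.
        by rewrite -xE x1 -o1' nth_index.
      by rewrite (o3c y yU) ?orbT // -xo.
    rewrite -xE in xy; have := inner_e xl ax yU xy.
    by move/(subsetP (gnbs_sub e2_sym gs xl)); rewrite !inE => /andP[_ ->].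
have ij1 : (i, j) \in gedges 1 v by rewrite -d1.
have [ps [adm sps ups /and3P[lps _ _]]] := nine_admissible ij1.
apply: (@few_attachments ps) => //.
- by rewrite d1.
- by rewrite s9.
- by rewrite sps s9.
- apply: contra o3s => /mapP[p pin ->]; apply: mem_nth.
  by rewrite s9; apply: (allP lps).
- rewrite d1; apply: leq_trans (_ : count_mem 0 ps <= _); first exact: sub_count.
  by rewrite count_uniq_mem // leq_b1.
Qed.

Lemma bad_K4 : size s = 6 -> exists L', tiling x0 e setT L'.
Proof.
move=> s6; have d2 : d = 2 by rewrite /d /gdeg s6.
have [[a1 a2 a3] [b1 b2 b3] [u1 u2 u3]] := frame_edges e_sym fr.
have sE : s = [:: 's_0; 's_1; 's_2; 's_3; 's_4; 's_5].
  apply: (@eq_from_nth _ x0); rewrite s6 // => k.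
  by do 6 (case: k => [//|k]).
have nadj p q : p < 6 -> q < 6 -> ~~ (attpos 2 p && attpos 2 q) ->
    q \notin gnb 2 v p -> ~~ e 's_p 's_q.
  by move=> pl ql att nq; apply: nonadjacent; rewrite ?s6 ?d2.
have ndist p q : p < 6 -> q < 6 -> p != q -> 's_p != 's_q.
  by move=> pl ql; rewrite nth_uniq ?s6.
have gT : gadget x0 e (false, [:: t1; t2; t3]) by rewrite triangle_gadget a1 a2 a3.
have eE p q : (p, q) \in gedges 2 v -> (p, q) != (i, j) -> e 's_p 's_q.
  by move=> pE; apply: (@intact (p, q)); rewrite d2.
have eE' p q : (p, q) \in gedges 2 v -> (p, q) != (i, j) -> e 's_q 's_p.
  by move=> pE pij; rewrite e_sym eE.
(* If [ac], [ad] or [yb] is missing, the triangle [bcd] remains, and a x y is the path to absorb. *)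
have Px : (i, j) \in [:: (0, 2); (0, 3); (5, 1)] -> exists L', tiling x0 e setT L'.
  move=> h; apply: (@path_finish 's_4 's_0 's_5
    [:: (false, [:: t1; t2; t3]); (false, [:: 's_1; 's_2; 's_3])]).
  - by apply: eE' => //; move: h; rewrite !inE => /or3P[] /eqP->.
  - by apply: eE => //; move: h; rewrite !inE => /or3P[] /eqP->.
  - exact: nadj.
  - exact: ndist.
  - rewrite /= gT andbT triangle_gadget /=; apply/and3P; split; apply: eE => //;
    by move: h; rewrite !inE => /or3P[] /eqP->.
  - by rewrite [in X in perm_eq _ X]sE; apply/permP => P; rewrite /cells /=; lia_counts.
(* The mirror image: the triangle [acd] and the path x y b. *)
have Py : (i, j) \in [:: (1, 2); (1, 3); (0, 4)] -> exists L', tiling x0 e setT L'.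
  move=> h; apply: (@path_finish 's_5 's_4 's_1
    [:: (false, [:: t1; t2; t3]); (false, [:: 's_0; 's_2; 's_3])]).
  - by apply: eE' => //; move: h; rewrite !inE => /or3P[] /eqP->.
  - by apply: eE => //; move: h; rewrite !inE => /or3P[] /eqP->.
  - exact: nadj.
  - exact: ndist.
  - rewrite /= gT andbT triangle_gadget /=; apply/and3P; split; apply: eE => //;
    by move: h; rewrite !inE => /or3P[] /eqP->.
  - by rewrite [in X in perm_eq _ X]sE; apply/permP => P; rewrite /cells /=; lia_counts.
have att45 p : p < size s -> attpos d p -> p \in [:: 4; 5].
  by move=> _; rewrite d2 !inE.
(* If [cd] is missing, c, d and one of x, y are independent; the one different from [o3] is
   taken. *)
have [/eqP ij23|n23] := boolP ((i, j) == (2, 3)).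
  case: ij23 => i2 j3; exfalso.
  have [p [p45 po]] : exists p, p \in [:: 4; 5] /\ 's_p != o3.
    have [o4|n4] := eqVneq 's_4 o3; last by exists 4.
    by exists 5; split => //; rewrite -o4 ndist.
  apply: (@few_attachments [:: 2; 3; p]).
  - by rewrite d2 i2 j3; move: p45; rewrite !inE => /orP[] /eqP->; case: (v).
  - by move: p45; rewrite !inE => /orP[] /eqP->.
  - by rewrite s6; move: p45; rewrite !inE => /orP[] /eqP->.
  - by rewrite s6.
  - rewrite !inE !negb_or ![o3 == _]eq_sym po andbT.
    by apply/andP; split; apply/eqP => /o3_att; rewrite s6 d2 => -[].
  - by rewrite d2; move: p45; rewrite !inE => /orP[] /eqP->.
have [/eqP ij45|n45] := boolP ((i, j) == (4, 5)); last first.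
  have := ij; rewrite d2 !inE => ij'.
  have [|nx] := boolP ((i, j) \in [:: (0, 2); (0, 3); (5, 1)]); first exact: Px.
  have [|ny] := boolP ((i, j) \in [:: (1, 2); (1, 3); (0, 4)]); first exact: Py.
  exfalso; move: nx ny n23 n45 ij'; rewrite !inE.
  by do !case: (_ == _).
case: ij45 => i4 j5.
(* Now [xy] is missing. If [o3] is off the tile, x, y and c are three independent positions. *)
have [o3s|o3s] := boolP (o3 \in s); last first.
  exfalso; apply: (@two_attachments [:: 4; 5; 2]) => //.
  - by rewrite d2 i4 j5; case: (v).
  - by rewrite s6.
  - by rewrite s6.
  - apply: contra o3s; rewrite !inE => /or3P[] /eqP->; apply: mem_nth; by rewrite s6.
  - by rewrite d2.
  - by move=> p pl ap; have := att45 p pl ap; rewrite !inE => /orP[] ->; rewrite ?orbT.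
have ol : index o3 s < size s by rewrite index_mem.
have [ap _] := o3_att ol (nth_index x0 o3s).
(* [o3] is x or y, that is [o1] or [o2], hence [o1] by the frame. So [o1], [t1], [t3] form a
   triangle, and the path to absorb runs from [t2] through [o2] to the next vertex of the tile. *)
have o31 : o3 = o1.
  have := att45 _ ol ap; rewrite !inE => h.
  have : (o3 == 's_4) || (o3 == 's_5).
    by case/orP: h => /eqP E; rewrite -E nth_index // eqxx ?orbT.
  move: ends_o; rewrite i4 j5 => oo; case: (fr) => _ _ _ _ /orP[/eqP //|].
  by rewrite !inE negb_or => /andP[/negbTE n1 /negbTE n2]; case: oo => -[-> ->]; rewrite n1 n2.
rewrite o31 in b3.
have t2b p : p < 6 -> 's_p != o2 -> ~~ e t2 's_p.
  move=> pl np; apply/negP => tp; rewrite e_sym in tp.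
  have pU : 's_p \in U by apply/sU/mem_nth; rewrite s6.
  by move: np; rewrite (t2_nbr pU tp) eqxx.
have t2s p : p < 6 -> t2 != 's_p.
  move=> pl; apply: contraTneq (sU (mem_nth x0 (ltac:(by rewrite s6) : p < size s))) => <-.
  by rewrite in_off !inE eqxx orbT.
case: ends_o; rewrite i4 j5 => -[x4 y5].
  apply: (@path_finish 's_5 t2 's_1
    [:: (false, [:: 's_4; t1; t3]); (false, [:: 's_0; 's_2; 's_3])]).
  - by rewrite y5.
  - by apply: eE => //; rewrite i4 j5.
  - by apply: t2b => //; rewrite -y5 ndist.
  - exact: t2s.
  - rewrite /= !triangle_gadget x4 b1 b3 a3 /= andbT.
    by rewrite !eE ?i4 ?j5.
  - by rewrite [in X in perm_eq _ X]sE; apply/permP => P; rewrite /cells /=; lia_counts.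
apply: (@path_finish 's_4 t2 's_0
    [:: (false, [:: 's_5; t1; t3]); (false, [:: 's_1; 's_2; 's_3])]).
- by rewrite x4.
- by apply: eE' => //; rewrite i4 j5.
- by apply: t2b => //; rewrite -x4 ndist.
- exact: t2s.
- rewrite /= !triangle_gadget y5 b1 b3 a3 /= andbT.
  by rewrite !eE ?i4 ?j5.
- by rewrite [in X in perm_eq _ X]sE; apply/permP => P; rewrite /cells /=; lia_counts.
Qed.

Lemma bad_tile : exists L', tiling x0 e setT L'.
Proof.
have := gs; case/andP => /=; rewrite !inE => /or3P[] /eqP ss _.
- exact: bad_triangle.
- exact: bad_K4.
- exact: bad_nine.
Qed.

End BadTile.

Theorem cubic_tiling : exists L, tiling x0 e setT L.
Proof.
have T0 : 0 < #|T| by apply: leq_trans T12.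
have [x [y [z [xy yz xz]]]] := cubic_triangle e_sym e_irr e_cubic T0 (eq_leq al).
have T4 : 4 < #|T| by apply: leq_trans T12.
have [t1 [t2 [t3 [o1 [o2 [o3 fr]]]]]] := frame_exists e_sym e_irr e_conn e_cubic xy yz xz T4.
have cU := card_off_triangle fr.
have [[a1 a2 a3] _ _] := frame_edges e_sym fr.
have addT L : tiling x0 e (off_triangle t1 t2 t3) L -> exists L, tiling x0 e setT L.
  move=> tL; eexists; apply: tiling_triangle => //; try exact: a1 || exact: a2 || exact: a3.
  by apply: tiling_eq tL; rewrite setTD.
have [aU|aU] := leqP (alpha e) (alpha_in e (off_triangle t1 t2 t3)); last first.
  have [||| L tL] := @tiling_exists _ x0 e e_sym e_irr (off_triangle t1 t2 t3).
  - exact: (degenerate_proper e_conn e_cubic (off_triangle_proper fr)).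
  - by move=> w _; apply: cubic_deg3.
  - nlia.
  - exact: addT tL.
have no12 : o1 != o2 by case: fr.
have dg := link_degenerate e_sym e_irr e_conn e_cubic fr (eq_leq al) aU.
have [||L tL] := tiling_exists x0 (@link_sym _ e e_sym o1 o2) (link_irr e_irr no12) dg.
- exact: (link_deg3 e_sym e_cubic fr).
- have := alpha_link e_sym e_irr fr; nlia.
have [gL uL cL] := tL.
have [allg|] := boolP (all (gadget x0 e) L).
  by apply: (addT L); split.
case/allPn => g gin ng.
have [gg ug sg] := tiling_cell tL gin.
case: g gin ng gg ug sg => v s gin ng gg ug sg.
have : ~~ all (fun p => e (nth x0 s p.1) (nth x0 s p.2)) (gedges (gdeg s) v).
  by move: ng gg; rewrite /gadget /= => ng /andP[sz _]; rewrite sz in ng.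
case/allPn => -[i j] ij nij.
have tL' : tiling x0 (link e o1 o2) (off_triangle t1 t2 t3 :\: [set x in s]) (rem (v, s) L).
  by apply: (@tiling_behead _ _ _ _ _ (v, s)); apply: tiling_perm tL; apply: perm_to_rem.
apply: (bad_tile fr gg ug sg _ ij nij).
(* The other tiles do not contain [o1], so they cannot use the new edge. *)
case: (tL') => gL' uL' cL'; split; [|exact: uL'|exact: cL'].
apply/allP => -[v' s'] hin; have [gh uh sh] := tiling_cell tL' hin.
case/andP: (gh) => sz /allP edges; apply/andP; split => //; apply/allP => p pE.
have := edges p pE; rewrite /link /= => /orP[//|h].
have [dd' sz'] := gadget_size gh; have [dd sz2] := gadget_size gg.
have [/= p1 p2 _] := gedges_lt dd' pE; rewrite -sz' /= in p1 p2.
have [/= i1 j1 _] := gedges_lt dd ij; rewrite -sz2 /= in i1 j1.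
have o1s : o1 \in s.
  have : link e o1 o2 (nth x0 s i) (nth x0 s j) by case/andP: gg => _ /allP/(_ _ ij).
  have [iin jin] : nth x0 s i \in s /\ nth x0 s j \in s by split; apply: mem_nth.
  rewrite /link (negbTE nij) /= => /orP[] /andP[/eqP h1 /eqP h2].
    by rewrite h1 in iin.
  by rewrite h2 in jin.
have : o1 \in s'.
  have [pin qin] : nth x0 s' p.1 \in s' /\ nth x0 s' p.2 \in s' by split; apply: mem_nth.
  case/orP: h => /andP[/eqP h1 /eqP h2]; first by rewrite h1 in pin.
  by rewrite h2 in qin.
by move=> /sh; rewrite !inE o1s.
Qed.

End CubicTiling.

(** * Dissociation sets and degree counts *)

Section DegreeSums.
Variables (T : finType) (r : rel T).
Hypothesis r_sym : symmetric r.
Implicit Types (A B D : {set T}).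

Lemma card_nbhdI x A : #|nbhd r x :&: A| = \sum_(y in A) r x y.
Proof.
rewrite -sum1_card big_mkcond [RHS]big_mkcond; apply: eq_bigr => y _.
by rewrite !inE; case: (y \in A); rewrite ?andbF // andbT; case: (r x y).
Qed.

Lemma edge_count_sym A B :
  \sum_(x in A) #|nbhd r x :&: B| = \sum_(y in B) #|nbhd r y :&: A|.
Proof.
under eq_bigr do rewrite card_nbhdI.
rewrite exchange_big; apply: eq_bigr => y _; rewrite card_nbhdI.
by apply: eq_bigr => x _; rewrite r_sym.
Qed.

Lemma handshake : irreflexive r -> \sum_x #|nbhd r x| =
  2 * #|[set p : T * T | r p.1 p.2 & enum_rank p.1 < enum_rank p.2]|.
Proof.
move=> r_irr; pose E := [set p : T * T | r p.1 p.2].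
set lt := [set p | _ & _].
have -> : \sum_x #|nbhd r x| = #|E|.
  have -> : #|E| = \sum_(p : T * T) r p.1 p.2.
    by rewrite -sum1_card big_mkcond; apply: eq_bigr => p _; rewrite inE; case: (r _ _).
  rewrite -(pair_bigA _ (fun x y => r x y : nat)) /=; apply: eq_bigr => x _.
  by rewrite -sum1_card big_mkcond; apply: eq_bigr => y _; rewrite inE; case: (r _ _).
rewrite -(cardsID lt E) (setIidPr _); last first.
  by apply/subsetP => p; rewrite !inE => /andP[].
rewrite mul2n -addnn; congr (_ + _).
have sw_inj : injective (fun p : T * T => (p.2, p.1)) by move=> [a b] [c d] /= [-> ->].
rewrite -[RHS](card_imset _ sw_inj); apply: eq_card => -[a b].
apply/idP/imsetP => [|[[c d] cd [-> ->]]].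
  rewrite !inE /= => /andP[nlt rab]; exists (b, a) => //.
  rewrite !inE /= r_sym rab /= ltn_neqAle; move: nlt; rewrite rab /= -leqNgt => ->.
  rewrite andbT; apply: contraTneq rab => /val_inj/enum_rank_inj ->.
  by rewrite r_irr.
move: cd; rewrite !inE /= => /andP[rcd lcd].
by rewrite r_sym rcd /= -leqNgt ltnW.
Qed.

End DegreeSums.

Section Dissociation.
Variables (T : finType) (e : rel T).
Hypotheses (e_sym : symmetric e) (e_irr : irreflexive e) (e_cubic : cubic e).
Implicit Types (A B D : {set T}).

Lemma dissociationP D :
  reflect (forall x, x \in D -> #|nbhd e x :&: D| <= 1) (dissociation e D).
Proof.
have E x : [set y in D | e x y] = nbhd e x :&: D by apply/setP => y; rewrite !inE andbC.
by apply: (iffP forall_inP) => h x /h; rewrite E.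
Qed.

Lemma diss_witness : exists2 D, dissociation e D & #|D| = diss e.
Proof.
have d0 : dissociation e set0 by apply/dissociationP => x; rewrite inE.
case: (@arg_maxnP _ set0 (dissociation e) (fun S : {set T} => #|S|) d0) => D dD mD.
exists D => //; apply/eqP; rewrite eqn_leq leq_bigmax_cond //=.
by apply/bigmax_leqP => S /mD.
Qed.

Lemma cubic_degree_split x A : #|nbhd e x :&: A| + #|nbhd e x :&: ~: A| = 3.
Proof. by rewrite -(e_cubic x) -(cardsID A (nbhd e x)) setDE. Qed.

(** The inequality |A| - e(A) <= alpha is applied to the complement A of [D], and the edges between
    [D] and A are counted from both sides. *)
Lemma dissociation_bound D : dissociation e D ->
  4 * #|D| <= 2 * alpha e + \sum_(x in D) #|nbhd e x :&: D| + #|T|.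
Proof.
move=> dD; have := alpha_in_degree_sum e_sym e_irr (~: D).
have c3 A : \sum_(x in A) 3 = 3 * #|A| by rewrite sum_nat_const mulnC.
have h1 : \sum_(x in ~: D) #|nbhd e x :&: D| + \sum_(x in ~: D) #|nbhd e x :&: ~: D|
   = 3 * #|~: D|.
  by rewrite -big_split -c3; apply: eq_bigr => x _; apply: cubic_degree_split.
have h2 : \sum_(x in D) #|nbhd e x :&: D| + \sum_(x in D) #|nbhd e x :&: ~: D| = 3 * #|D|.
  by rewrite -big_split -c3; apply: eq_bigr => x _; apply: cubic_degree_split.
have h3 := edge_count_sym e_sym D (~: D).
have h4 := cardsC D; have h5 := alpha_in_mono e (subsetT (~: D)).
rewrite alphaE; nlia.
Qed.

Lemma dissociation_inner_le D : dissociation e D ->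
  \sum_(x in D) #|nbhd e x :&: D| <= #|D|.
Proof.
by move=> /dissociationP dD; rewrite -sum1_card; apply: leq_sum => x /dD.
Qed.

Lemma cubic_even : ~~ odd #|T|.
Proof.
have := handshake e_sym e_irr.
have -> : \sum_x #|nbhd e x| = 3 * #|T|.
  by rewrite mulnC -sum_nat_const; apply: eq_bigr => x _; apply: e_cubic.
by move=> h; have := congr1 odd h; rewrite !oddM /= => ->.
Qed.

(** A nonempty cubic graph on at most four vertices is K4. *)
Lemma cubic_card_gt : 0 < #|T| -> 4 < #|T| \/ alpha e = 1.
Proof.
case/card_gt0P => x _; have xN : x \notin nbhd e x by rewrite inE e_irr.
have := max_card (mem (x |: nbhd e x)); rewrite cardsU1 xN e_cubic => c4.
have [|lt4] := ltnP 4 #|T|; [by left|right].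
have adj a b : a != b -> e a b.
  move=> ab; have aN : a \notin nbhd e a by rewrite inE e_irr.
  have : a |: nbhd e a == setT by rewrite eqEcard subsetT cardsT cardsU1 aN e_cubic lt4.
  by move/eqP/setP/(_ b); rewrite !inE eq_sym (negbTE ab).
have [S [/independentP iS _ cS]] := alpha_in_witness e setT.
rewrite alphaE; apply/eqP; rewrite eqn_leq -{1}cS; apply/andP; split.
  apply/card_le1_eqP => a b aS bS; apply/eqP; apply: contraT => ab.
  by have := iS _ _ bS aS; rewrite adj // eq_sym.
by rewrite -(cards1 x); apply: alpha_in_ge; rewrite ?subsetT ?independent1.
Qed.

End Dissociation.

(* A bit sequence [b] marks the positions of a gadget that lie in the
   dissociation set. *)
Definition inner_deg d v (b : bitseq) p : nat :=
  count (fun q => nth false b q) (gnb d v p).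

(** The possible traces of a perfectly matched set: the mate of a marked position lies in the tile,
    or outside, reached from an attachment position. *)
Definition tile_ok d v (b : bitseq) : bool :=
  all (fun p => nth false b p ==>
    ((inner_deg d v b p <= 1) && ((inner_deg d v b p == 0) ==> attpos d p)))
    (iota 0 (gsize d)).

Definition mates_out d v (b : bitseq) : nat :=
  count (fun p => nth false b p && (inner_deg d v b p == 0)) (iota 0 (gsize d)).

(** The edge leaving the tile at such a position also leaves the dissociation set, since the mate is
    inside. *)
Definition exits d v (b : bitseq) : nat :=
  count (fun p => [&& nth false b p, attpos d p & inner_deg d v b p == 1])
    (iota 0 (gsize d)).

(** The coefficients make the totals balance: over all tiles, 4 - d sums to 6k, the marks sum to
    10k, and d sums to that of m + 2x plus a nonnegative rest. The two equality cases will be the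
    vertices off and on the matching. *)
Definition tile_bound d v (b : bitseq) : bool :=
  let m := mates_out d v b in let x := exits d v b in
  (4 + 3 * count id b <= 6 * (4 - d) + m + 2 * x) &&
  ((4 + 3 * count id b == 6 * (4 - d) + m + 2 * x) ==>
    ([&& count id b == 2 * (4 - d), m == 0, x == 2 & d != 1]
     || [&& (count id b).+1 == 2 * (4 - d), m == 1 & x == 0])).

Lemma tile_bound_all d v b : d \in [:: 1; 2; 3] -> size b = gsize d ->
  tile_ok d v b -> tile_bound d v b.
Proof.
move=> dd sb; have := @forall_degree (fun d v => all (fun b =>
  if tile_ok d v b then tile_bound d v b else true) (bitseqs (gsize d)))
  ltac:(vm_compute; reflexivity) d v dd.
move=> /allP /(_ b); rewrite -sb mem_bitseqs => /(_ isT).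
by case: ifP.
Qed.

(** * From a tiling to the contracted multigraph *)

Lemma attpos_gnb d v p q : d \in [:: 1; 2; 3] -> p < gsize d -> q < gsize d ->
  attpos d p -> attpos d q -> p != q -> q \in gnb d v p.
Proof.
move=> dd pl ql; have /allP := @forall_degree (fun d v => all (fun p =>
  all (fun q => [&& attpos d p, attpos d q & p != q] ==> (q \in gnb d v p))
  (iota 0 (gsize d))) (iota 0 (gsize d))) isT d v dd.
move=> /(_ p); rewrite mem_iota => /(_ pl) /allP /(_ q); rewrite mem_iota => /(_ ql).
by move=> h ap aq pq; move: h; rewrite ap aq pq.
Qed.

Lemma count_attpos d : d \in [:: 1; 2; 3] -> count (attpos d) (iota 0 (gsize d)) = d.
Proof. by rewrite !inE => /or3P[] /eqP->. Qed.

Lemma leq_sum_eq (I : finType) (F G : I -> nat) : (forall i, F i <= G i) ->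
  \sum_i G i <= \sum_i F i -> forall i, F i = G i.
Proof.
move=> FG GF i; apply/eqP; rewrite eqn_leq FG /=.
move: GF; rewrite (bigD1 i) //= [X in _ <= X](bigD1 i) //=.
have : \sum_(j | j != i) F j <= \sum_(j | j != i) G j by apply: leq_sum.
lia.
Qed.

Section FromTiling.
Variables (T : finType) (x0 : T) (e : rel T).
Hypotheses (e_sym : symmetric e) (e_irr : irreflexive e)
  (e_conn : connected_graph e) (e_cubic : cubic e).
Variables (L : seq (bool * seq T)) (D : {set T}) (k : nat).
Hypotheses (tL : tiling x0 e setT L) (D_mate : forall x, x \in D -> #|nbhd e x :&: D| = 1)
  (cD : #|D| = 10 * k) (cT : #|T| = 18 * k).

Local Notation n := (size L).

Definition Blk x : 'I_n := Ordinal (blk_lt tL (in_setT x)).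
Definition tl (w : 'I_n) : seq T := (nth (g0 T) L w).2.
Definition var (w : 'I_n) : bool := (nth (g0 T) L w).1.
Definition dg (w : 'I_n) : nat := gdeg (tl w).
Definition pos x : nat := index x (tl (Blk x)).
Definition att_vertex x : bool := attpos (dg (Blk x)) (pos x).
Definition cross : rel T := fun x y => e x y && (Blk x != Blk y).

Lemma tl_spec w : [/\ gadget x0 e (var w, tl w), uniq (tl w), dg w \in [:: 1; 2; 3]
  & size (tl w) = gsize (dg w)].
Proof.
have := tiling_cell tL (mem_nth (g0 T) (ltn_ord w)); rewrite /dg /tl /var.
case: (nth _ _ _) => v s [gg us _]; have [dd sz] := gadget_size gg.
by split.
Qed.

Lemma size_tl w : size (tl w) = 3 * (4 - dg w).
Proof.
by have [_ _ + ->] := tl_spec w; rewrite !inE => /or3P[] /eqP->.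
Qed.

Lemma mem_tl x w : (x \in tl w) = (Blk x == w).
Proof.
apply/idP/eqP => [xw|<-]; last exact: (blk_mem tL (in_setT x)).
by apply: val_inj; apply: (blk_eq tL (ltn_ord w) xw).
Qed.

Lemma pos_lt x : pos x < size (tl (Blk x)).
Proof. by rewrite index_mem mem_tl. Qed.

Lemma nth_pos x : nth x0 (tl (Blk x)) (pos x) = x.
Proof. by rewrite nth_index // mem_tl. Qed.

Lemma Blk_nth w p : p < size (tl w) -> Blk (nth x0 (tl w) p) = w.
Proof. by move=> pl; apply/eqP; rewrite -mem_tl mem_nth. Qed.

Lemma pos_nth w p : p < size (tl w) -> pos (nth x0 (tl w) p) = p.
Proof.
by move=> pl; rewrite /pos Blk_nth // index_uniq //; have [] := tl_spec w.
Qed.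

Lemma Blk_pos_inj x y : Blk x = Blk y -> pos x = pos y -> x = y.
Proof. by move=> b p; rewrite -(nth_pos x) -(nth_pos y) b p. Qed.

Let deg3 x : #|nbhd e x :&: setT| <= 3. Proof. exact: cubic_deg3. Qed.

(** A tile has no additional chords: inner positions are saturated, and two attachment positions are
    adjacent in the gadget. *)
Lemma in_tile_adj x y : Blk x = Blk y ->
  e x y = (pos y \in gnb (dg (Blk x)) (var (Blk x)) (pos x)).
Proof.
move=> bxy; have [gg us dd sz] := tl_spec (Blk x); set w := Blk x in gg us dd sz *.
have pl := pos_lt x; have ql : pos y < size (tl w) by rewrite /w bxy pos_lt.
rewrite -/w in pl; have xE : nth x0 (tl w) (pos x) = x := nth_pos x.
have yE : nth x0 (tl w) (pos y) = y by rewrite /w bxy nth_pos.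
have sub : {subset (var w, tl w).2 <= setT} by move=> z; rewrite inE.
have inn p q : p < size (tl w) -> q < size (tl w) -> ~~ attpos (dg w) p ->
    e (nth x0 (tl w) p) (nth x0 (tl w) q) = (q \in gnb (dg w) (var w) p).
  move=> pl' ql' na; rewrite -(mem_gnbs gg us pl' ql').
  have <- := inner_nbrs e_sym gg us sub pl' (deg3 _) na.
  by rewrite !inE andbT.
have [ax|ax] := boolP (attpos (dg w) (pos x)); last by rewrite -inn // xE yE.
have [ay|ay] := boolP (attpos (dg w) (pos y)); last first.
  rewrite e_sym -{1}xE -{1}yE inn // !mem_gnb -?sz // orbC //.
have [pq|pq] := eqVneq (pos x) (pos y).
  have -> : x = y by apply: Blk_pos_inj.
  rewrite e_irr; apply/esym/negP; rewrite mem_gnb -?sz // orbb.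
  by move=> /(gedges_lt dd)[_ _]; rewrite /= eqxx.
rewrite attpos_gnb -?sz //; apply: contraT; rewrite -xE -yE => ne.
have qn : pos y \in gnb (dg w) (var w) (pos x) by apply: attpos_gnb; rewrite -?sz.
have := subsetP (gnbs_sub e_sym gg pl) y.
by rewrite -{1}yE (mem_gnbs gg us pl ql) !inE xE => /(_ qn) /andP[exy _]; rewrite xE yE exy in ne.
Qed.

Lemma gnbs_cross x :
  nbhd e x = gnbs x0 (var (Blk x), tl (Blk x)) (pos x) :|: nbhd cross x
  /\ [disjoint gnbs x0 (var (Blk x), tl (Blk x)) (pos x) & nbhd cross x].
Proof.
have [gg us dd sz] := tl_spec (Blk x); have pl := pos_lt x.
have gB y : y \in gnbs x0 (var (Blk x), tl (Blk x)) (pos x) -> Blk y = Blk x.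
  move/(subsetP (gnbs_sub e_sym gg pl)); rewrite !inE => /andP[_].
  by rewrite mem_tl => /eqP.
split.
  apply/setP => y; rewrite in_setU !in_nbhd /cross.
  have [bxy|bxy] := eqVneq (Blk x) (Blk y); last first.
    rewrite andbT; case yg : (_ \in gnbs _ _ _) => //=.
    by move: bxy; rewrite (gB y yg) eqxx.
  rewrite andbF orbF (in_tile_adj bxy) -(mem_gnbs gg us pl) ?bxy ?nth_pos ?pos_lt //.
rewrite disjoints_subset; apply/subsetP => y /gB yB; rewrite !inE /cross yB eqxx.
by rewrite andbF.
Qed.

Lemma cross_sym : symmetric cross.
Proof. by move=> x y; rewrite /cross e_sym eq_sym. Qed.

Lemma cross_irr : irreflexive cross.
Proof. by move=> x; rewrite /cross e_irr. Qed.

Lemma card_cross x : #|nbhd cross x| = att_vertex x.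
Proof.
have [gg us dd sz] := tl_spec (Blk x); have [E d] := gnbs_cross x.
have := leq_card_setU (gnbs x0 (var (Blk x), tl (Blk x)) (pos x)) (nbhd cross x).
rewrite d -E e_cubic => -[_ /eqP]; rewrite (card_gnbs gg us (pos_lt x)) /att_vertex.
rewrite -/(dg _); case: (attpos _ _) => /=; lia.
Qed.

Lemma cross_unique x y z : cross x y -> cross x z -> y = z.
Proof.
move=> xy xz; have c : #|nbhd cross x| <= 1 by rewrite card_cross leq_b1.
by apply: (card_le1_eqP c); rewrite inE.
Qed.

Definition bits w : bitseq := map (mem D) (tl w).

Lemma nth_bits w p : p < size (tl w) -> nth false (bits w) p = (nth x0 (tl w) p \in D).
Proof. by move=> pl; rewrite (nth_map x0). Qed.

Lemma inner_deg_cross x :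
  #|nbhd e x :&: D| = inner_deg (dg (Blk x)) (var (Blk x)) (bits (Blk x)) (pos x)
    + #|nbhd cross x :&: D|.
Proof.
have [gg us dd sz] := tl_spec (Blk x); have [-> d] := gnbs_cross x.
set G := gnbs _ _ _ in d *; rewrite setIUl.
have := leq_card_setU (G :&: D) (nbhd cross x :&: D).
rewrite (disjointWl (subsetIl _ _)) ?(disjointWr (subsetIl _ _)) // => -[_ /eqP->].
congr (_ + _); rewrite /inner_deg.
have [_ ug /allP al] : [/\ size (gnb (dg (Blk x)) (var (Blk x)) (pos x)) = 3 - att_vertex x,
   uniq (gnb (dg (Blk x)) (var (Blk x)) (pos x)) &
   all (fun j => j < gsize (dg (Blk x))) (gnb (dg (Blk x)) (var (Blk x)) (pos x))].
  by apply: gnb_spec => //; rewrite -sz pos_lt.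
have -> : #|G :&: D| = #|[set y in [seq nth x0 (tl (Blk x)) q | q <- gnb (dg (Blk x)) (var (Blk x)) (pos x) & nth x0 (tl (Blk x)) q \in D]]|.
  apply: eq_card => y; rewrite !inE; apply/andP/mapP => [[/mapP[q qin ->] yD]|[q]].
    by exists q => //; rewrite mem_filter yD.
  by rewrite mem_filter => /andP[qD qin] ->; split=> //; apply/mapP; exists q.
rewrite cardsE (card_uniqP _) ?size_map; last first.
  rewrite map_inj_in_uniq ?filter_uniq // => p q.
  rewrite mem_filter => /andP[_ pin]; rewrite mem_filter => /andP[_ qin] /eqP.
  by rewrite nth_uniq ?sz ?al // => /eqP.
rewrite size_filter; apply: eq_in_count => q qin.
by rewrite /= nth_bits ?sz ?al.
Qed.

Lemma tile_sum (F : T -> nat) :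
  \sum_x F x = \sum_w \sum_(x | Blk x == w) F x.
Proof. by rewrite (partition_big Blk xpredT). Qed.

Lemma tile_count (F : T -> nat) (P : pred nat) w :
  (forall p, p < size (tl w) -> F (nth x0 (tl w) p) = P p) ->
  \sum_(x | Blk x == w) F x = count P (iota 0 (gsize (dg w))).
Proof.
have [_ us _ sz] := tl_spec w; move=> h.
rewrite (eq_bigl (fun x => x \in tl w)) => [|x]; last by rewrite mem_tl.
rewrite -big_uniq //= (big_nth x0) -sum1_count [RHS]big_mkcond -sz.
rewrite /index_iota subn0 big_seq [RHS]big_seq; apply: eq_bigr => p.
by rewrite mem_iota /= add0n => /h ->; case: (P p).
Qed.

Lemma sum_att w : \sum_(x | Blk x == w) att_vertex x = dg w.
Proof.
have [_ _ dd _] := tl_spec w.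
rewrite -[RHS](count_attpos dd); apply: (tile_count (F := fun x => att_vertex x : nat)).
by move=> p pl; rewrite /att_vertex Blk_nth // pos_nth.
Qed.

Lemma sum_D w : \sum_(x | Blk x == w) (x \in D) = count id (bits w).
Proof.
have [_ _ _ sz] := tl_spec w.
rewrite (tile_count (F := fun x => (x \in D) : nat) (P := nth false (bits w))).
  rewrite -sz -[in RHS](mkseq_nth false (bits w)) /mkseq count_map size_map.
  by apply: eq_count.
by move=> p pl; rewrite nth_bits.
Qed.

Definition mates w := mates_out (dg w) (var w) (bits w).
Definition exitn w := exits (dg w) (var w) (bits w).

Lemma cross_D_le x : #|nbhd cross x :&: D| <= att_vertex x.
Proof. by rewrite -card_cross subset_leq_card // subsetIl. Qed.

Lemma cross_split x : #|nbhd cross x :&: D| + #|nbhd cross x :&: ~: D| = att_vertex x.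
Proof. by rewrite -card_cross -(cardsID D (nbhd cross x)) setDE. Qed.

Lemma D_inner x : x \in D -> inner_deg (dg (Blk x)) (var (Blk x)) (bits (Blk x)) (pos x)
   + #|nbhd cross x :&: D| = 1.
Proof. by move=> xD; rewrite -inner_deg_cross D_mate. Qed.

Lemma sum_mates w : \sum_(x | Blk x == w) (x \in D) * #|nbhd cross x :&: D| = mates w.
Proof.
apply: (tile_count (F := fun x => (x \in D) * #|nbhd cross x :&: D|)) => p pl.
rewrite nth_bits //; case xD : (_ \in D); rewrite ?mul0n //= mul1n.
have := D_inner xD; rewrite Blk_nth // pos_nth //.
by case: (inner_deg _ _ _ _) => [|[|]] //=; case: #|_| => [|[|]].
Qed.

Lemma sum_exits w : \sum_(x | Blk x == w) (x \in D) * #|nbhd cross x :&: ~: D| = exitn w.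
Proof.
apply: (tile_count (F := fun x => (x \in D) * #|nbhd cross x :&: ~: D|)) => p pl.
rewrite nth_bits //; case xD : (_ \in D); rewrite ?mul0n //= mul1n.
have := D_inner xD; have := cross_split (nth x0 (tl w) p).
rewrite /att_vertex Blk_nth // pos_nth //.
case: (attpos _ _) => /=; last by lia.
by case: (inner_deg _ _ _ _) => [|[|]] //=; lia.
Qed.

Lemma tile_ok_bits w : tile_ok (dg w) (var w) (bits w).
Proof.
have [_ _ _ sz] := tl_spec w.
apply/allP => p; rewrite mem_iota /= add0n -sz => pl; apply/implyP.
rewrite nth_bits // => xD; have := D_inner xD.
have := cross_D_le (nth x0 (tl w) p); rewrite /att_vertex Blk_nth // pos_nth //.
by case: (attpos _ _) => /=; case: (inner_deg _ _ _ _) => [|[|]] //=; lia.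
Qed.

Lemma sum_codegree : \sum_w (4 - dg w) = 6 * k.
Proof.
suff : 3 * \sum_w (4 - dg w) = 18 * k by lia.
rewrite -cT -sum1_card tile_sum big_distrr /=; apply: eq_bigr => w _.
have [_ us _ _] := tl_spec w; rewrite -size_tl -(card_uniqP us) -sum1_card.
by apply: eq_bigl => x; rewrite mem_tl.
Qed.

(** Let [rho] count the ends of cross edges that miss [D]. Summing over the tiles gives
    [\sum_w G w + rho = \sum_w F w], so every bound [F w <= G w] is an equality and [rho]
    vanishes. *)
Lemma tiles_tight :
  (forall w, [\/ [/\ count id (bits w) = 2 * (4 - dg w), mates w = 0, exitn w = 2 & dg w != 1]
     | [/\ (count id (bits w)).+1 = 2 * (4 - dg w), mates w = 1 & exitn w = 0]]) /\
  (forall x y, cross x y -> (x \in D) || (y \in D)).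
Proof.
pose F w := 4 + 3 * count id (bits w).
pose G w := 6 * (4 - dg w) + mates w + 2 * exitn w.
have bound w : tile_bound (dg w) (var w) (bits w).
  have [_ _ dd sz] := tl_spec w.
  by apply: tile_bound_all (tile_ok_bits w); rewrite // size_map.
have FG w : F w <= G w by case/andP: (bound w).
have sF : \sum_w F w = 4 * n + 30 * k.
  rewrite big_split /= sum_nat_const card_ord -big_distrr /=.
  have -> : \sum_w count id (bits w) = #|D|.
    rewrite -(eq_bigr _ (fun w _ => sum_D w)) -tile_sum -sum1_card [RHS]big_mkcond /=.
    by apply: eq_bigr => x _; case: (x \in D).
  rewrite cD; lia.
pose rho := \sum_(x in ~: D) #|nbhd cross x :&: ~: D|.
have sdeg : \sum_w dg w + 6 * k = 4 * n.
  rewrite -sum_codegree -big_split /=.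
  rewrite (eq_bigr (fun=> 4)) ?sum_nat_const ?card_ord ?(mulnC n) // => w _.
  by have [_ _ + _] := tl_spec w; rewrite !inE => /or3P[] /eqP->.
have s1 : \sum_w mates w = \sum_(x in D) #|nbhd cross x :&: D|.
  rewrite -(eq_bigr _ (fun w _ => sum_mates w)) -tile_sum [RHS]big_mkcond.
  by apply: eq_bigr => x _; case: (x \in D); rewrite ?mul1n.
have s2 : \sum_w exitn w = \sum_(x in D) #|nbhd cross x :&: ~: D|.
  rewrite -(eq_bigr _ (fun w _ => sum_exits w)) -tile_sum [RHS]big_mkcond.
  by apply: eq_bigr => x _; case: (x \in D); rewrite ?mul1n.
have s3 : \sum_w mates w + 2 * \sum_w exitn w + rho = \sum_w dg w.
  rewrite -(eq_bigr _ (fun w _ => sum_att w)) -tile_sum.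
  rewrite -(eq_bigr _ (fun x _ => cross_split x)) big_split /=.
  rewrite (bigID (mem D)) /= [X in _ = _ + X](bigID (mem D)) /= -s1 -s2.
  have -> : \sum_(x | x \notin D) #|nbhd cross x :&: D| = \sum_w exitn w.
    rewrite s2 (edge_count_sym cross_sym); apply: eq_bigl => x; by rewrite inE.
  have -> : \sum_(x | x \notin D) #|nbhd cross x :&: ~: D| = rho.
    by apply: eq_bigl => x; rewrite inE.
  by rewrite mul2n -addnn !addnA.
have sG : \sum_w G w + rho = \sum_w F w.
  rewrite sF; have -> : \sum_w G w = 6 * (6 * k) + (\sum_w mates w + 2 * \sum_w exitn w).
    by rewrite -sum_codegree !big_distrr -!big_split; apply: eq_bigr => w _; rewrite /G -addnA.
  rewrite -addnA s3; move: sdeg; lia.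
have eFG : forall w, F w = G w by apply: leq_sum_eq => //; rewrite -sG leq_addr.
split.
  move=> w; case/andP: (bound w) => _ /implyP /(_ _).
  rewrite -/(mates w) -/(exitn w) => h.
  have {h} := h (introT eqP (eFG w)).
  by case/orP => [/and4P[/eqP ? /eqP ? /eqP ? ?]|/and3P[/eqP ? /eqP ? /eqP ?]]; [left|right].
have rho0 : rho = 0.
  move/eqP: sG; rewrite -(eq_bigr _ (fun w _ => eFG w)) -[X in _ == X]addn0.
  by rewrite eqn_add2l => /eqP.
move=> x y xy; apply: contraT; rewrite negb_or => /andP[xD yD].
have : #|nbhd cross x :&: ~: D| = 0.
  apply/eqP; rewrite -leqn0 -rho0 /rho (bigD1 x) ?inE //=; exact: leq_addr.
by move/cards0_eq/setP/(_ y); rewrite !inE xy yD.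
Qed.

(** * The contracted multigraph with its matching and orientation *)

Definition crossings : {set T * T} :=
  [set p | cross p.1 p.2 & enum_rank p.1 < enum_rank p.2].
Local Notation m := #|crossings|.
Definition ee (f : 'I_m) : T * T := enum_val f.
Definition hends (f : 'I_m) : 'I_n * 'I_n := (Blk (ee f).1, Blk (ee f).2).
(** The end of [f] in the tile [w]; meaningful only for [f] incident with [w]. *)
Definition endp (w : 'I_n) (f : 'I_m) : T :=
  if Blk (ee f).1 == w then (ee f).1 else (ee f).2.
Definition oppp (w : 'I_n) (f : 'I_m) : T :=
  if Blk (ee f).1 == w then (ee f).2 else (ee f).1.

Lemma ee_cross f : cross (ee f).1 (ee f).2 /\ enum_rank (ee f).1 < enum_rank (ee f).2.
Proof. by have := enum_valP f; rewrite inE => /andP[]. Qed.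

Lemma ee_Blk f : Blk (ee f).1 != Blk (ee f).2.
Proof. by have [/andP[]] := ee_cross f. Qed.

Lemma edge_of x y : cross x y -> exists f,
  [/\ endp (Blk x) f = x, oppp (Blk x) f = y, incident hends (Blk x) f &
    ee f = (x, y) \/ ee f = (y, x)].
Proof.
move=> xy; have bxy : Blk x != Blk y by case/andP: xy.
have [lt|ge] := ltnP (enum_rank x) (enum_rank y).
  have p : (x, y) \in crossings by rewrite inE /= xy.
  exists (enum_rank_in p (x, y)); rewrite /endp /oppp /incident /hends /ee enum_rankK_in //=.
  by rewrite eqxx; split => //; left.
have lt : enum_rank y < enum_rank x.
  rewrite ltn_neqAle ge andbT; apply: contraNneq bxy => /val_inj/enum_rank_inj ->.
  by rewrite eqxx.
have p : (y, x) \in crossings by rewrite inE /= cross_sym xy.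
exists (enum_rank_in p (y, x)); rewrite /endp /oppp /incident /hends /ee enum_rankK_in //=.
by rewrite eq_sym (negbTE bxy) eqxx orbT; split => //; right.
Qed.

Lemma endp_spec w f : f \in inc hends w ->
  Blk (endp w f) = w /\ cross (endp w f) (oppp w f).
Proof.
have [xy _] := ee_cross f.
rewrite inE /incident /endp /oppp /=; case: eqP => [//|_ /= /eqP ->].
by rewrite cross_sym.
Qed.

Lemma endp_inj w : {in inc hends w &, injective (endp w)}.
Proof.
move=> f g fi gi E; have [_ cf] := endp_spec fi; have [_ cg] := endp_spec gi.
rewrite -E in cg; have O := cross_unique cf cg.
have [_ lf] := ee_cross f; have [_ lg] := ee_cross g.
apply: enum_val_inj; rewrite -/(ee f) -/(ee g).
move: E O lf lg; rewrite /endp /oppp (surjective_pairing (ee f)) (surjective_pairing (ee g)) /=.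
case: ifP => _; case: ifP => _ /= -> -> //; first by move=> h1 /(ltn_trans h1); rewrite ltnn.
by move=> h1 /(ltn_trans h1); rewrite ltnn.
Qed.

(** Each attachment vertex carries exactly one cross edge, so the edges at [w] correspond to the
    attachment vertices of its tile. *)
Lemma card_inc_endp w (Q : pred T) :
  #|[set f in inc hends w | Q (endp w f)]| = #|[set x | [&& Blk x == w, att_vertex x & Q x]]|.
Proof.
rewrite -(card_in_imset (f := endp w)); last first.
  by move=> f g; rewrite !inE => /andP[fi _] /andP[gi _]; apply: endp_inj; rewrite inE.
apply: eq_card => x; rewrite [RHS]inE; apply/imsetP/and3P => [[f]|[/eqP xw ax Qx]].
  rewrite inE => /andP[fi Qf] ->; have [-> cf] := endp_spec fi; split => //.
  have : 0 < #|nbhd cross (endp w f)| by apply/card_gt0P; exists (oppp w f); rewrite inE.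
  by rewrite card_cross; case: (att_vertex _).
have : 0 < #|nbhd cross x| by rewrite card_cross ax.
case/card_gt0P => y; rewrite inE => xy; have [f [ef _ fi _]] := edge_of xy.
by exists f; rewrite -xw ?ef // !inE fi ef.
Qed.

Lemma card_inc_sum w (Q : pred T) :
  #|[set f in inc hends w | Q (endp w f)]| = \sum_(x | Blk x == w) (att_vertex x && Q x).
Proof.
rewrite card_inc_endp -sum1_card big_mkcond [RHS]big_mkcond; apply: eq_bigr => x _.
by rewrite inE; case: (Blk x == w) => //=; case: (_ && _).
Qed.

Lemma hmdeg w : mdeg hends w = dg w.
Proof.
rewrite -sum_att /mdeg.
have -> : inc hends w = [set f in inc hends w | predT (endp w f)].
  by apply/setP => f; rewrite inE andbT.
by rewrite card_inc_sum; apply: eq_bigr => x _; rewrite andbT.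
Qed.

Definition pos9 x : 'I_9 := inord (pos x).

Lemma pos_lt9 x : pos x < 9.
Proof.
have := pos_lt x; have [_ _ + ->] := tl_spec (Blk x).
by rewrite !inE => /or3P[] /eqP-> /=; lia.
Qed.

Lemma pos9E x : pos9 x = pos x :> nat.
Proof. by rewrite inordK // pos_lt9. Qed.

Definition hatt (w : 'I_n) (f : 'I_m) : 'I_9 := pos9 (endp w f).

Lemma hatt_valid : valid_attachment hends hatt.
Proof.
move=> w; split.
  move=> f g fi gi E; apply: (endp_inj fi gi).
  have [bf _] := endp_spec fi; have [bg _] := endp_spec gi.
  by apply: Blk_pos_inj; rewrite ?bf ?bg // -!pos9E -/(hatt w f) E.
have attE i : (i \in attset (mdeg hends w)) = attpos (dg w) i.
  have [_ _ + _] := tl_spec w; rewrite hmdeg inE !inE.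
  by case/or3P => /eqP->.
apply/setP => i; rewrite attE; apply/imsetP/idP => [[f fi ->]|ai].
  have [bf cf] := endp_spec fi; rewrite pos9E.
  have : 0 < #|nbhd cross (endp w f)| by apply/card_gt0P; exists (oppp w f); rewrite inE.
  by rewrite card_cross /att_vertex bf; case: (attpos _ _).
have [_ _ dd sz] := tl_spec w.
have il : i < size (tl w).
  by move: ai dd; rewrite sz !inE => + /or3P[] /eqP E; rewrite E /=; lia.
pose x := nth x0 (tl w) i; have bx : Blk x = w by apply: Blk_nth.
have px : pos x = i by apply: pos_nth.
have : 0 < #|nbhd cross x| by rewrite card_cross /att_vertex bx px ai.
case/card_gt0P => y; rewrite inE => xy; have [f [ef _ fi _]] := edge_of xy.
rewrite bx in ef fi; exists f; first by rewrite inE.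
by apply: val_inj; rewrite /hatt ef /= pos9E px.
Qed.

Definition hM : {set 'I_m} := [set f | ((ee f).1 \in D) && ((ee f).2 \in D)].
Definition hor (f : 'I_m) : bool := (ee f).1 \in D.

Lemma hM_endp w f : (f \in hM) = (endp w f \in D) && (oppp w f \in D).
Proof. by rewrite inE /endp /oppp; case: ifP => // _; rewrite andbC. Qed.

Lemma mates_gt0 w f : f \in hM -> incident hends w f -> 0 < mates w.
Proof.
rewrite (hM_endp w) => /andP[xD yD] fw.
have fi : f \in inc hends w by rewrite inE.
have [bx xy] := endp_spec fi; rewrite -sum_mates (bigD1 (endp w f)) ?bx //= xD mul1n.
rewrite addn_gt0; apply/orP; left; apply/card_gt0P; exists (oppp w f).
by rewrite !inE xy.
Qed.

Lemma coveredE w : covered hends hM w = (mates w == 1).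
Proof.
have [tt _] := tiles_tight; apply/exists_inP/eqP => [[f fM fw]|m1].
  by have := mates_gt0 fM fw; case: (tt w) => -[_ -> _].
have : 0 < mates w by rewrite m1.
rewrite -sum_mates lt0n sum_nat_eq0 negb_forall => /existsP[x].
rewrite negb_imply muln_eq0 negb_or => /andP[/eqP bx /andP[]].
rewrite eqb0 negbK -lt0n => xD /card_gt0P[y]; rewrite !inE => /andP[xy yD].
have [f [ef of' fw _]] := edge_of xy; rewrite bx in ef of' fw.
by exists f => //; rewrite (hM_endp w) ef of' xD.
Qed.

(** A tile has at most one vertex with its mate outside, and a tile with such a vertex has no exit.
    A cross edge between two tiles of this kind meets [D], hence has both ends in it. *)
Lemma hM_matching : induced_matching hends hM.
Proof.
have [tt noRR] := tiles_tight; split.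
  move=> f g fM gM nfg w; apply/negP => /andP[fw gw].
  have [fi gi] : f \in inc hends w /\ g \in inc hends w by rewrite !inE.
  have [bf cf] := endp_spec fi; have [bg cg] := endp_spec gi.
  move: (fM) (gM); rewrite !(hM_endp w) => /andP[fD foD] /andP[gD goD].
  have ne : endp w f != endp w g by apply: contra_neq nfg => /endp_inj; apply.
  have : 1 < mates w.
    rewrite -sum_mates (bigD1 (endp w f)) ?bf //= (bigD1 (endp w g)) ?bg ?eqxx ?(eq_sym _ (endp w f)) //=.
    rewrite fD gD !mul1n.
    have h1 : 0 < #|nbhd cross (endp w f) :&: D| by apply/card_gt0P; exists (oppp w f); rewrite !inE cf.
    have h2 : 0 < #|nbhd cross (endp w g) :&: D| by apply/card_gt0P; exists (oppp w g); rewrite !inE cg.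
    by rewrite -(addn1 1) leq_add // (leq_trans h2) ?leq_addr.
  by case: (tt w) => -[_ -> _].
move=> f; rewrite !coveredE => /eqP m1 /eqP m2.
have [xy _] := ee_cross f.
have no_exit x y : cross x y -> mates (Blk x) = 1 -> x \in D -> y \in D.
  move=> cxy mx xD; apply: contraT => yD.
  have : 0 < exitn (Blk x).
    rewrite -sum_exits (bigD1 x) //= xD mul1n addn_gt0; apply/orP; left.
    by apply/card_gt0P; exists y; rewrite !inE cxy.
  by case: (tt (Blk x)) => -[_ h h']; rewrite ?mx ?h' in h *.
rewrite inE; case/orP: (noRR _ _ xy) => xD; rewrite xD /= ?andbT.
  exact: no_exit xy m1 xD.
by apply: no_exit m2 xD; rewrite cross_sym.
Qed.

Lemma hM_degree1 w : mdeg hends w = 1 -> covered hends hM w.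
Proof.
rewrite hmdeg coveredE; have [tt _] := tiles_tight => d1.
by case: (tt w) => -[_ -> _] //; rewrite d1.
Qed.

(** A cross edge outside the matching has exactly one end in [D] and points away from it; an
    uncovered tile has exactly two exits. *)
Lemma hM_orientation : good_orientation hends hM.
Proof.
have [tt noRR] := tiles_tight.
exists hor => w; rewrite coveredE => nm.
have x2 : exitn w = 2 by case: (tt w) => -[_ h h2] //; rewrite h in nm.
rewrite -x2 -sum_exits.
pose Q x := (x \in D) && (nbhd cross x :&: ~: D != set0).
have -> : [set f | (f \notin hM) && (tail hends hor f == w)]
        = [set f in inc hends w | Q (endp w f)].
  apply/setP => f; have [xy _] := ee_cross f.
  have opp_unique z y : cross z y -> (nbhd cross z :&: ~: D != set0) = (y \notin D).
    move=> zy; apply/set0Pn/idP => [[u]|yD]; last by exists y; rewrite !inE zy.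
    by rewrite !inE => /andP[zu]; rewrite (cross_unique zy zu).
  have yx : cross (ee f).2 (ee f).1 by rewrite cross_sym.
  have bxy := ee_Blk f.
  rewrite inE [RHS]inE inE inE /tail /hor /incident /endp /Q /=.
  have := noRR _ _ xy.
  case xD : ((ee f).1 \in D) => /=.
    move=> _; case: (eqVneq (Blk (ee f).1) w) => [<-|_] /=.
      by rewrite xD (opp_unique _ _ xy) andbT.
    by rewrite andbF (opp_unique _ _ yx) xD andbF andbF.
  move=> yD; case: (eqVneq (Blk (ee f).1) w) => [bw|_] /=.
    by rewrite xD -bw eq_sym (negbTE bxy).
  by rewrite yD (opp_unique _ _ yx) xD andbT.
rewrite card_inc_sum; apply: eq_bigr => x _.
rewrite /Q; case: (x \in D); rewrite ?andbF ?mul0n //= mul1n.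
have := cross_split x; rewrite -card_gt0.
by case: (att_vertex x) => /=; case: #|nbhd cross x :&: ~: D| => [|[|]] //=; lia.
Qed.

(** In both equality cases marks and outside mates of a tile add up to 2(4 - d). The mates therefore
    total 12k - 10k = 2k, two for each edge of the matching. *)
Lemma card_hM : #|hM| = k.
Proof.
pose r : rel T := fun x y => [&& cross x y, x \in D & y \in D].
have r_sym : symmetric r by move=> x y; rewrite /r cross_sym; do 2 case: (_ \in D).
have r_irr : irreflexive r by move=> x; rewrite /r cross_irr.
have := handshake r_sym r_irr.
have -> : #|[set p : T * T | r p.1 p.2 & enum_rank p.1 < enum_rank p.2]| = #|hM|.
  rewrite -(card_imset hM (@enum_val_inj _ _)); apply: eq_card => p.
  rewrite inE; apply/andP/imsetP => [[/and3P[cp d1 d2] lt]|[f]].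
    have pc : p \in crossings by rewrite inE cp.
    by exists (enum_rank_in pc p); rewrite ?inE /ee enum_rankK_in // d1.
  by rewrite inE => /andP[d1 d2] ->; have [cf lf] := ee_cross f; rewrite /r cf d1 d2.
have -> : \sum_x #|nbhd r x| = \sum_w mates w.
  rewrite -(eq_bigr _ (fun w _ => sum_mates w)) -tile_sum; apply: eq_bigr => x _.
  case xD : (x \in D); rewrite ?mul1n ?mul0n.
    by apply: eq_card => y; rewrite !inE /r xD.
  by apply: eq_card0 => y; rewrite !inE /r xD andbF.
have [tt _] := tiles_tight.
have : \sum_w (mates w + count id (bits w)) = \sum_w 2 * (4 - dg w).
  apply: eq_bigr => w _; case: (tt w) => -[h1 h2 _] //; rewrite h2 -h1; lia.
rewrite big_split /= -[RHS]big_distrr /= sum_codegree.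
have -> : \sum_w count id (bits w) = #|D|.
  rewrite -(eq_bigr _ (fun w _ => sum_D w)) -tile_sum -sum1_card [RHS]big_mkcond /=.
  by apply: eq_bigr => x _; case: (x \in D).
by rewrite cD; lia.
Qed.

Lemma hconnected : 0 < #|T| -> mconnected hends.
Proof.
move=> T0; have [y0 _] := card_gt0P T0.
split; first by apply: leq_ltn_trans (ltn_ord (Blk y0)).
have conn x y : connect e x y -> connect (madj hends) (Blk x) (Blk y).
  case/connectP => p pp ->; elim: p x pp => [|z p IH] x /=; first by [].
  case/andP => xz /IH; apply: connect_trans.
  have [->|bxz] := eqVneq (Blk x) (Blk z); first exact: connect0.
  apply: connect1; apply/existsP.
  have xzc : cross x z by rewrite /cross xz.
  have [f [_ _ _ [fE|fE]]] := edge_of xzc; exists f; rewrite /hends fE /= eqxx ?orbT //.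
have rep w : exists x, Blk x = w.
  exists (nth x0 (tl w) 0); apply: Blk_nth; rewrite size_tl.
  by have [_ _ + _] := tl_spec w; rewrite !inE => /or3P[] /eqP->.
move=> w w'; have [x <-] := rep w; have [y <-] := rep w'.
exact/conn/e_conn.2.
Qed.

Lemma hweights : 3 * ncount hends 1 + 2 * ncount hends 2 + ncount hends 3 = 6 * k.
Proof.
have nc i : ncount hends i = \sum_w (dg w == i).
  rewrite /ncount -sum1_card big_mkcond; apply: eq_bigr => w _.
  by rewrite inE hmdeg; case: (_ == _).
rewrite !nc -sum_codegree !big_distrr /= -!big_split /=; apply: eq_bigr => w _.
by have [_ _ + _] := tl_spec w; rewrite !inE => /or3P[] /eqP->.
Qed.

Theorem tiling_inGk : 0 < #|T| -> inGk e k.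
Proof.
move=> T0; exists n, m, hends, var, hatt, (fun x => (Blk x, pos9 x)).
split.
- split; [|exact: hconnected| |exact: hweights|].
  + by move=> f; apply: ee_Blk.
  + move=> w; rewrite hmdeg; have [_ _ + _] := tl_spec w.
    by rewrite !inE => /or3P[] /eqP->.
  + exists hM; split; [exact: card_hM|exact: hM_matching|exact: hM_degree1|exact: hM_orientation].
- exact: hatt_valid.
- split=> [x y xy|x].
    have bxy : Blk x = Blk y := congr1 fst xy.
    have pxy : pos9 x = pos9 y := congr1 snd xy.
    by apply: Blk_pos_inj => //; rewrite -!pos9E pxy.
  rewrite /cvertex /= hmdeg pos9E; have [_ _ _ <-] := tl_spec (Blk x); exact: pos_lt.
- move=> [w i]; rewrite /cvertex /= hmdeg; have [_ _ _ <-] := tl_spec w => il.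
  exists (nth x0 (tl w) i); rewrite Blk_nth //; congr (_, _).
  by apply: val_inj; rewrite /= pos9E pos_nth.
- move=> x y; rewrite /cadj /= hmdeg.
  have [bxy|bxy] := eqVneq (Blk x) (Blk y).
    rewrite in_tile_adj // /gadj !pos9E /=.
    have [_ _ dd sz] := tl_spec (Blk x).
    have ply : pos y < size (tl (Blk x)) by rewrite bxy pos_lt.
    rewrite mem_gnb -?sz ?pos_lt //.
    case: (_ || _) => //=; apply/esym/negbTE/negP => /existsP[f].
    case/andP => /andP[/orP hE _] _; have := ee_Blk f.
    have -> : Blk (ee f).1 = Blk (ee f).2; last by rewrite eqxx.
    by case: hE => /eqP hE; have := congr1 fst hE; have := congr1 snd hE; rewrite /= => -> ->.
  rewrite /=; apply/idP/existsP => [xy|[f]].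
    have xyc : cross x y by rewrite /cross xy.
    have [f [ef of' _ fE]] := edge_of xyc; exists f.
    have ey : endp (Blk y) f = y.
      by case: fE => fE; rewrite /endp fE /= ?eqxx // (negbTE bxy).
    rewrite /hatt ef ey !eqxx !andbT /hends.
    by case: fE => -> /=; rewrite eqxx ?orbT.
  case/andP => /andP[fE /eqP hx] /eqP hy; have [xy _] := ee_cross f.
  have fe : (Blk (endp (Blk x) f) = Blk x /\ Blk (endp (Blk y) f) = Blk y) /\
      e (endp (Blk x) f) (endp (Blk y) f).
    have [/andP[exy _]] := ee_cross f; move=> _.
    case/orP: fE => /eqP hE; have h1 := congr1 fst hE; have h2 := congr1 snd hE;
      rewrite /= in h1 h2; rewrite /endp h1 eqxx.
      by rewrite (negbTE bxy) h2.
    by rewrite eq_sym (negbTE bxy) h2 e_sym.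
  case: fe => -[b1 b2]; have -> : endp (Blk x) f = x.
    by apply: Blk_pos_inj => //; rewrite -!pos9E -/(hatt _ _) hx.
  have -> // : endp (Blk y) f = y.
  by apply: Blk_pos_inj => //; rewrite -!pos9E -/(hatt _ _) hy.
Qed.

End FromTiling.

(** * From the multigraph to the extremal numbers *)

(** The vertices c, d of K4^* and p1, q1, p2, q2 of the 9-vertex gadgets: adjacent pairs that join
    the dissociation set whatever happens at the attachments. *)
Definition core_pos (d : nat) : seq nat :=
  match d with 2 => [:: 2; 3] | 1 => [:: 3; 4; 6; 7] | _ => [::] end.

Lemma ord9_forall (P : pred nat) : all P (iota 0 9) -> forall i : 'I_9, P i.
Proof. by move=> /allP h i; apply: h; rewrite mem_iota ltn_ord. Qed.

Lemma core_matching d v (i j l : 'I_9) : d \in [:: 1; 2] ->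
  (i \in attset d) || ((i : nat) \in core_pos d) ->
  (j \in attset d) || ((j : nat) \in core_pos d) ->
  (l \in attset d) || ((l : nat) \in core_pos d) ->
  gadj d v i j -> gadj d v i l -> j = l.
Proof.
pose good d v i := [seq j <- iota 0 9 | (attpos d j || (j \in core_pos d)) &&
  (((i, j) \in gedges d v) || ((j, i) \in gedges d v))].
have chk : all (fun d => all (fun v => all (fun i =>
   (attpos d i || (i \in core_pos d)) ==> (size (good d v i) <= 1)) (iota 0 9))
   [:: true; false]) [:: 1; 2] by vm_compute.
move=> dd; have attE (p : 'I_9) : (p \in attset d) = attpos d p.
  by move: dd; rewrite !inE => /orP[] /eqP->.
rewrite !attE => hi hj hl ij il.
have v2 : v \in [:: true; false] by case: v {ij il}.
have /allP/(_ _ dd)/allP/(_ _ v2)/ord9_forall/(_ i) := chk; rewrite hi /= => sz.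
have jg : (j : nat) \in good d v i.
  by rewrite mem_filter hj mem_iota /= add0n ltn_ord !andbT; exact: ij.
have lg : (l : nat) \in good d v i.
  by rewrite mem_filter hl mem_iota /= add0n ltn_ord !andbT; exact: il.
apply: val_inj => /=; case: (good d v i) sz jg lg => [|a [|]] //= _.
by rewrite !inE => /eqP-> /eqP->.
Qed.

Lemma att_core_nonadjacent d v (i j : 'I_9) : d \in [:: 1; 2; 3] -> i \in attset d ->
  (j : nat) \in core_pos d -> gadj d v i j = false.
Proof.
move=> dd ai cj; have chk := @forall_degree (fun d v => all (fun i => all (fun j =>
  attpos d i && (j \in core_pos d) ==> ~~ (((i, j) \in gedges d v) || ((j, i) \in gedges d v)))
  (iota 0 9)) (iota 0 9)) isT d v dd.
have := ord9_forall (ord9_forall chk i) j.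
have -> : attpos d i by move: dd ai; rewrite !inE => /or3P[] /eqP->.
by rewrite cj /= => /negbTE.
Qed.

Section FromH.
Variables (T : finType) (e : rel T) (k n m : nat) (ends : 'I_m -> 'I_n * 'I_n)
  (variant : 'I_n -> bool) (att : 'I_n -> 'I_m -> 'I_9) (phi : T -> 'I_n * 'I_9).
Hypotheses (loopless : mloopless ends) (deg3 : mmaxdeg3 ends)
  (weights : 3 * ncount ends 1 + 2 * ncount ends 2 + ncount ends 3 = 6 * k)
  (att_ok : valid_attachment ends att) (phi_inj : injective phi)
  (phi_vertex : forall x, cvertex ends (phi x))
  (phi_onto : forall p, cvertex ends p -> exists x, phi x = p)
  (phi_adj : forall x y, e x y = cadj ends variant att (phi x) (phi y)).
Variables (M : {set 'I_m}) (o : 'I_m -> bool).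
Hypotheses (cM : #|M| = k) (matM : matching ends M)
  (orient : forall w, ~~ covered ends M w ->
     #|[set f | (f \notin M) && (tail ends o f == w)]| = 2).

Local Notation d w := (mdeg ends w).

Lemma tail_incident f : incident ends (tail ends o f) f.
Proof. by rewrite /tail /incident; case: (o f); rewrite eqxx ?orbT. Qed.

(** Degree zero is impossible: a vertex lies on an edge of [M] or has two outgoing edges. *)
Lemma deg_in w : d w \in [:: 1; 2; 3].
Proof.
have : 0 < d w.
  have [/exists_inP[f _ fw]|nc] := boolP (covered ends M w).
    by apply/card_gt0P; exists f; rewrite inE.
  have /card_gt0P[f] : 0 < #|[set f | (f \notin M) && (tail ends o f == w)]| by rewrite orient.
  rewrite inE => /andP[_ /eqP tw]; apply/card_gt0P; exists f.
  by rewrite inE -tw tail_incident.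
by have := deg3 w; rewrite !inE; case: (d w) => [|[|[|[|]]]].
Qed.

Lemma sum_codeg : \sum_w (4 - d w) = 6 * k.
Proof.
have nc i : ncount ends i = \sum_w (d w == i).
  rewrite /ncount -sum1_card big_mkcond; apply: eq_bigr => w _.
  by rewrite inE; case: (_ == _).
rewrite -weights !nc !big_distrr /= -!big_split /=; apply: eq_bigr => w _.
by have := deg_in w; rewrite !inE => /or3P[] /eqP->.
Qed.

Lemma phi_sum (F : 'I_n * 'I_9 -> nat) :
  \sum_x F (phi x) = \sum_w \sum_(i < 9 | i < gsize (d w)) F (w, i).
Proof.
rewrite pair_big_dep /= (eq_bigl (fun p => p \in phi @: setT)).
  rewrite big_imset /=; last by move=> x y _ _; apply: phi_inj.
  by apply: eq_big => x; rewrite ?inE // -surjective_pairing.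
move=> p; apply/idP/imsetP => [|[x _ ->]]; last exact: phi_vertex.
by case/phi_onto => x <-; exists x.
Qed.

Lemma gsize_deg w : gsize (d w) = 3 * (4 - d w).
Proof. by have := deg_in w; rewrite !inE => /or3P[] /eqP->. Qed.

Lemma gsize_le9 w : gsize (d w) <= 9.
Proof. by have := deg_in w; rewrite !inE => /or3P[] /eqP->. Qed.

Lemma sum_ord9 (P : pred 'I_9) w :
  \sum_(i < 9 | i < gsize (d w)) P i
  = count id [seq P (inord i) | i <- iota 0 (gsize (d w))].
Proof.
rewrite count_map -sum1_count [RHS]big_mkcond /=.
have -> : iota 0 (gsize (d w)) = index_iota 0 (gsize (d w)) by rewrite /index_iota subn0.
rewrite big_mkord (big_ord_widen 9 (fun i => if P (inord i) then 1 else 0) (gsize_le9 w)).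
by apply: eq_bigr => i _; rewrite inord_val; case: (P i).
Qed.

Lemma cardT_H : #|T| = 18 * k.
Proof.
rewrite -sum1_card (phi_sum (fun=> 1)).
have -> : \sum_w \sum_(i < 9 | i < gsize (d w)) 1 = \sum_w 3 * (4 - d w).
  apply: eq_bigr => w _; rewrite (sum_ord9 predT) -gsize_deg.
  by rewrite count_map (eq_count (a2 := predT)) // count_predT size_iota.
by rewrite -big_distrr /= sum_codeg; lia.
Qed.

(** Each gadget contributes at most a third of its vertices. *)
Lemma alpha_H : alpha e <= 6 * k.
Proof.
rewrite alphaE; have [S [/independentP iS _ <-]] := alpha_in_witness e setT.
pose inS p := [exists x in S, phi x == p].
have inSP x : inS (phi x) = (x \in S).
  apply/exists_inP/idP => [[y yS /eqP/phi_inj <-] //|xS]; by exists x.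
suff : 3 * #|S| <= 18 * k by lia.
have -> : #|S| = \sum_x (inS (phi x) : nat).
  by rewrite -sum1_card big_mkcond; apply: eq_bigr => x _; rewrite inSP; case: (x \in S).
rewrite (phi_sum (fun p => inS p : nat)) -cardT_H -sum1_card (phi_sum (fun=> 1)) big_distrr.
apply: leq_sum => w _; rewrite (sum_ord9 (fun i => inS (w, i))) (sum_ord9 predT).
rewrite [X in _ <= X]count_map (eq_count (a1 := preim _ _) (a2 := predT)) //.
rewrite count_predT size_iota.
set b := [seq _ | _ <- _]; have sb : size b = gsize (d w) by rewrite size_map size_iota.
rewrite -sb; apply: (independent_bits (deg_in w) sb (v := variant w)).
apply/allP => p pE; have [p1 p2 _] := gedges_lt (deg_in w) pE.
apply/negP; rewrite !(nth_map 0) ?size_iota // !nth_iota // !add0n.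
case/andP => /exists_inP[x xS /eqP xE] /exists_inP[y yS /eqP yE].
have := iS x y xS yS; rewrite phi_adj xE yE /cadj /= eqxx /gadj /=.
have g9 := gsize_le9 w.
rewrite !inordK ?(leq_trans _ g9) // -surjective_pairing pE.
by [].
Qed.

(** * The dissociation set prescribed by matching and orientation *)

Definition out_edge (w : 'I_n) (f : 'I_m) : bool :=
  (f \in M) || (~~ covered ends M w && (tail ends o f == w)).

(** A covered vertex contributes the attachment of its matching edge, an uncovered one the
    attachments of its two outgoing edges. *)
Definition att_in (w : 'I_n) : {set 'I_9} :=
  [set att w f | f in [set f in inc ends w | out_edge w f]].

Definition chosen (p : 'I_n * 'I_9) : bool :=
  (p.2 \in att_in p.1) || ((p.2 : nat) \in core_pos (d p.1)).

Definition HD : {set T} := [set x | chosen (phi x)].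

Lemma att_in_sub w : att_in w \subset attset (d w).
Proof.
have [_ <-] := att_ok w; apply/subsetP => i /imsetP[f fi ->].
by apply: imset_f; move: fi; rewrite inE => /andP[].
Qed.

Lemma att_in_edge w f : f \in inc ends w -> (att w f \in att_in w) = out_edge w f.
Proof.
move=> fi; apply/imsetP/idP => [[g gi E]|fo]; last by exists f; rewrite // inE fi.
move: gi; rewrite inE => /andP[gi go]; have [inj _] := att_ok w.
by rewrite (inj _ _ fi gi E).
Qed.

Lemma out_edge_M w f : covered ends M w -> out_edge w f = (f \in M).
Proof. by rewrite /out_edge => ->; rewrite orbF. Qed.

Lemma card_att_in w :
  #|att_in w| = #|[set f in inc ends w | out_edge w f]|.
Proof.
have [inj _] := att_ok w; apply: card_in_imset => f g.
by rewrite !inE => /andP[fi _] /andP[gi _]; apply: inj; rewrite inE.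
Qed.

Lemma card_att_covered w : covered ends M w -> #|att_in w| = 1.
Proof.
move=> cw; rewrite card_att_in; apply/eqP; rewrite eqn_leq; apply/andP; split.
  apply/card_le1_eqP => f g; rewrite !inE !out_edge_M // => /andP[fw fM] /andP[gw gM].
  apply/eqP; apply: contraT => nfg.
  by have := matM gM fM nfg w; rewrite fw gw.
have /exists_inP[f fM fw] := cw; apply/card_gt0P; exists f.
by rewrite !inE fw out_edge_M.
Qed.

Lemma card_att_uncovered w : ~~ covered ends M w -> #|att_in w| = 2.
Proof.
move=> nc; rewrite card_att_in -(orient nc); apply: eq_card => f.
rewrite !inE /out_edge nc /=; have [fM|fM] /= := boolP (f \in M).
  apply/negbTE/negP => /andP[fw _]; case/exists_inP: nc; by exists f.
apply/andP/idP => [[] //|/eqP tw]; split; last by apply/eqP.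
by rewrite -tw tail_incident.
Qed.

Lemma card_covered : \sum_w covered ends M w <= 2 * k.
Proof.
have -> : \sum_w covered ends M w = #|[set w | covered ends M w]|.
  rewrite -sum1_card [RHS]big_mkcond; apply: eq_bigr => w _.
  by rewrite inE; case: (covered _ _ _).
apply: leq_trans (_ : #|[set (ends f).1 | f in M] :|: [set (ends f).2 | f in M]| <= _).
  apply/subset_leq_card/subsetP => w; rewrite inE => /exists_inP[f fM fw].
  rewrite inE; case/orP: fw => /eqP wE; apply/orP; [left|right]; apply/imsetP; by exists f.
apply: leq_trans (leq_card_setU _ _) _.
by rewrite mul2n -addnn -cM leq_add // leq_imset_card.
Qed.

(** The core has 2(3 - d) vertices; two attachment vertices join it, or only one if [w] is
    covered. *)
Lemma chosen_count w :
  2 * (4 - d w) <= \sum_(i < 9 | i < gsize (d w)) chosen (w, i) + covered ends M w.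
Proof.
have core (S : {set 'I_9}) : S \subset attset (d w) ->
    \sum_(i < 9 | i < gsize (d w)) ((i \in S) || ((i : nat) \in core_pos (d w)))
    = #|S| + size (core_pos (d w)).
  move=> /subsetP sS.
  have sA i : i \in S -> attpos (d w) i.
    by move/sS; have := deg_in w; rewrite !inE => /or3P[] /eqP->.
  have -> : \sum_(i < 9 | i < gsize (d w)) ((i \in S) || ((i : nat) \in core_pos (d w)))
     = \sum_(i < 9 | i < gsize (d w)) ((i \in S) + ((i : nat) \in core_pos (d w))).
    apply: eq_bigr => i _; case iS : (i \in S) => //=.
    have := sA i iS; have := deg_in w; rewrite !inE => /or3P[] /eqP->;
    by rewrite /= ?inE //; do ?[case/orP]; move/eqP->.
  rewrite big_split /=; congr (_ + _).
    rewrite -sum1_card big_mkcond [RHS]big_mkcond; apply: eq_bigr => i _.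
    case iS : (i \in S); rewrite ?if_same //.
    have := sA i iS; have := deg_in w; rewrite !inE => /or3P[] /eqP-> /=.
    + by move/eqP->.
    + by case/orP => /eqP->.
    + by move=> ->.
  rewrite (sum_ord9 (fun i => (i : nat) \in core_pos (d w))).
  have := deg_in w; rewrite !inE => /or3P[] /eqP-> /=; by rewrite ?inordK.
rewrite (core _ (att_in_sub w)).
have [cw|nc] := boolP (covered ends M w).
  rewrite card_att_covered //.
  by have := deg_in w; rewrite !inE => /or3P[] /eqP->.
rewrite card_att_uncovered //.
have := deg_in w; rewrite !inE => /or3P[] /eqP E; rewrite E //.
Qed.

Lemma card_HD : 10 * k <= #|HD|.
Proof.
have -> : #|HD| = \sum_w \sum_(i < 9 | i < gsize (d w)) chosen (w, i).
  rewrite -(phi_sum (fun p => chosen p : nat)) -sum1_card big_mkcond.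
  by apply: eq_bigr => x _; rewrite inE; case: (chosen _).
have : \sum_w 2 * (4 - d w) <=
    \sum_w (\sum_(i < 9 | i < gsize (d w)) chosen (w, i) + covered ends M w).
  by apply: leq_sum => w _; apply: chosen_count.
rewrite -[X in X <= _]big_distrr /= sum_codeg [X in _ <= X]big_split /= => h.
rewrite -(leq_add2r (\sum_w covered ends M w)); apply: leq_trans h.
have := card_covered; move: (\sum_w _) => A; lia.
Qed.

Lemma chosen_link p q f : chosen p -> chosen q ->
  (ends f == (p.1, q.1)) || (ends f == (q.1, p.1)) ->
  att p.1 f = p.2 -> att q.1 f = q.2 ->
  [/\ f \in M, f \in inc ends p.1 & p.1 != q.1].
Proof.
move=> cp cq fE ap aq.
have [fp fq npq] : [/\ f \in inc ends p.1, f \in inc ends q.1 & p.1 != q.1].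
  rewrite !inE /incident; have := loopless f.
  by case/orP: fE => /eqP-> /= ?; rewrite !eqxx ?orbT // eq_sym.
split => //.
have notcore r : f \in inc ends r.1 -> att r.1 f = r.2 -> chosen r -> out_edge r.1 f.
  move=> fr ar; rewrite /chosen -ar (att_in_edge fr) => /orP[//|].
  have [_ E] := att_ok r.1.
  have : att r.1 f \in attset (d r.1) by rewrite -E imset_f.
  by have := deg_in r.1; rewrite !inE => /or3P[] /eqP-> /=; do ?[move/eqP-> => //];
     do ?[case/orP => /eqP-> //].
have := notcore _ fp ap cp; have := notcore _ fq aq cq.
rewrite /out_edge; case: (f \in M) => //= /andP[_ /eqP tq] /andP[_ /eqP tp].
by move: npq; rewrite -tp -tq eqxx.
Qed.

(** Chosen vertices of different tiles are adjacent only along an edge of [M], and its ends have no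
    chosen neighbour in their own tiles. Inside a tile, core and attachment vertices induce maximum
    degree one, or the tile is a triangle with at most two chosen vertices. *)
Lemma HD_dissociation : dissociation e HD.
Proof.
apply/dissociationP => x; rewrite inE => cx; apply/card_le1_eqP => y z.
rewrite !in_setI !in_nbhd !inE !phi_adj => /andP[xy cy] /andP[xz cz].
apply: phi_inj; move: xy xz.
case: (phi x) (phi y) (phi z) cx cy cz => [w i] [w1 j] [w2 l] cx cy cz.
rewrite /cadj /=.
have attw f u : f \in inc ends u -> att u f \in attset (d u).
  by move=> fu; have [_ <-] := att_ok u; apply: imset_f.
have pos_ok u p : chosen (u, p) -> (p \in attset (d u)) || ((p : nat) \in core_pos (d u)).
  by rewrite /chosen /= => /orP[/(subsetP (att_in_sub u))->|->]; rewrite ?orbT.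
have gadjxx (v : bool) (p : 'I_9) : gadj (d w) v p p = false.
  rewrite /gadj orbb; apply/negP => /(gedges_lt (deg_in w))[_ _].
  by rewrite /= eqxx.
have mixed f p q u : f \in M -> f \in inc ends w -> att w f = p -> chosen (w, q) ->
    gadj (d w) u p q -> False.
  move=> fM fw fp cq pq; have cw : covered ends M w.
    by apply/exists_inP; exists f => //; move: fw; rewrite inE.
  have pin : p \in att_in w by rewrite -fp att_in_edge // /out_edge fM.
  case/orP: cq => /= [qin|qc].
    have c1 : #|att_in w| <= 1 by rewrite card_att_covered.
    by move: pq; rewrite ((card_le1_eqP c1) p q pin qin) gadjxx.
  by move: pq; rewrite att_core_nonadjacent ?deg_in // (subsetP (att_in_sub w)).
case/orP => [/andP[/eqP E1 ij]|/existsP[f /andP[/andP[fE /eqP fi] /eqP fj]]];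
case/orP => [/andP[/eqP E2 il]|/existsP[g /andP[/andP[gE /eqP gi] /eqP gl]]].
- subst w1 w2; congr (_, _).
  have [d3|d12] := boolP (d w == 3); last first.
    apply: (core_matching (v := variant w) _ (pos_ok _ _ cx) (pos_ok _ _ cz) (pos_ok _ _ cy)) => //.
    by have := deg_in w; rewrite !inE (negbTE d12) orbF.
  have ca p : chosen (w, p) -> p \in att_in w.
    by rewrite /chosen /= (eqP d3) orbF.
  apply/eqP; apply: contraT => njl.
  have nij : i != j by apply: contraTneq ij => ->; rewrite gadjxx.
  have nil' : i != l by apply: contraTneq il => ->; rewrite gadjxx.
  have : 3 <= #|att_in w|.
    apply: (@leq_trans #|[set p in [:: i; j; l]]|).
      by rewrite cardsE (card_uniqP _) //= !inE negb_or nij nil' eq_sym njl.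
    by apply/subset_leq_card/subsetP => p; rewrite !inE => /or3P[] /eqP->; apply: ca.
  by have [cw|nc] := boolP (covered ends M w);
    [rewrite card_att_covered|rewrite card_att_uncovered].
- subst w1; have [gM gw _] := chosen_link (p := (w, i)) (q := (w2, l)) cx cz gE gi gl.
  by case: (mixed g i j (variant w) gM gw gi cy ij).
- subst w2; have [fM fw _] := chosen_link (p := (w, i)) (q := (w1, j)) cx cy fE fi fj.
  by case: (mixed f i l (variant w) fM fw fi cz il).
- have [fM fw n1] := chosen_link (p := (w, i)) (q := (w1, j)) cx cy fE fi fj.
  have [gM gw n2] := chosen_link (p := (w, i)) (q := (w2, l)) cx cz gE gi gl.
  have [inj _] := att_ok w.
  have fg : f = g by apply: inj => //; rewrite fi gi.
  subst g; have E : w1 = w2.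
    rewrite /= in n1 n2; case/orP: fE gE => /eqP -> /orP[] /eqP; case; try by [].
    - by move=> a b; rewrite b eqxx in n1.
    - by move=> a b; rewrite a eqxx in n1.
  by rewrite -fj -gl E.
Qed.

Hypotheses (e_sym : symmetric e) (e_irr : irreflexive e) (e_cubic : cubic e).

(** From diss >= 10k, 3 diss <= 2 alpha + 18k and alpha <= 6k it follows that alpha = 6k and diss =
    10k. *)
Lemma H_extremal : 5 * alpha e = 3 * diss e.
Proof.
have b D : dissociation e D -> 3 * #|D| <= 2 * alpha e + 18 * k.
  move=> dD; have := dissociation_bound e_sym e_irr e_cubic dD.
  have := dissociation_inner_le dD; rewrite cardT_H; lia.
have hd : #|HD| <= diss e by apply: leq_bigmax_cond HD_dissociation.
have h1 := b _ HD_dissociation; have h2 := card_HD; have h3 := alpha_H.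
have [D dD cD] := diss_witness e; have h4 := b _ dD.
rewrite cD in h4; clear b; move: (#|HD|) hd h1 h2 h3 h4 => *; nlia.
Qed.

End FromH.

Lemma inGk_extremal (T : finType) (e : rel T) k : symmetric e -> irreflexive e ->
  cubic e -> inGk e k -> 5 * alpha e = 3 * diss e.
Proof.
move=> e_sym e_irr e_cubic [n [m [ends [variant [att [phi [H va [inj vert] onto adj]]]]]]].
case: H => lo _ md wt [M [cM [mM _] _ [o ori]]].
exact: (H_extremal lo md wt va inj vert onto adj cM mM ori).
Qed.

Lemma extremal_inGk (T : finType) (e : rel T) : symmetric e -> irreflexive e ->
  connected_graph e -> cubic e -> 5 * alpha e = 3 * diss e ->
  exists k, 0 < k /\ inGk e k.
Proof.
move=> e_sym e_irr e_conn e_cubic eq53.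
have T0 : 0 < #|T| := e_conn.1; have [x0 _] := card_gt0P T0.
have [T4|a1] := cubic_card_gt e_irr e_cubic T0; last by move: eq53; rewrite a1; lia.
have brooks := cubic_alpha_ge e_sym e_irr e_conn e_cubic T4.
have [D dD cD] := diss_witness e.
have b1 := dissociation_bound e_sym e_irr e_cubic dD.
have b2 := dissociation_inner_le dD; rewrite cD in b1 b2.
have ev := cubic_even e_sym e_irr e_cubic.
(* 6 divides alpha: 5 alpha = 3 diss supplies the factor 3, and n = 3 alpha is even. *)
pose k := alpha e %/ 6.
have cT : #|T| = 18 * k by move: ev; rewrite /k; nlia.
have cDk : diss e = 10 * k by rewrite /k; nlia.
have full : \sum_(x in D) #|nbhd e x :&: D| = #|D| by nlia.
have mate x : x \in D -> #|nbhd e x :&: D| = 1.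
  move=> xD; have le := (dissociationP e D dD); apply/eqP; rewrite eqn_leq le //= lt0n.
  apply/negP => /eqP n0; have : \sum_(x in D) #|nbhd e x :&: D| < #|D|.
    rewrite (big_setD1 x) //= n0 add0n (cardsD1 x D) xD ltnS -sum1_card.
    by apply: leq_sum => z /setD1P[_ /le].
  by rewrite full ltnn.
have al : 3 * alpha e = #|T| by nlia.
have T12 : 12 < #|T| by nlia.
have [L tL] := cubic_tiling x0 e_sym e_irr e_conn e_cubic T12 al.
exists k; split; first by nlia.
apply: (tiling_inGk e_sym e_irr e_conn e_cubic tL mate _ cT T0).
by rewrite cD.
Qed.

Local Open Scope ring_scope.

Theorem theorem4 (T : finType) (e : rel T)
    (e_sym : symmetric e) (e_irr : irreflexive e)
    (G_conn : connected_graph e) (G_cubic : cubic e) :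
  ((alpha e)%:R = (3%:R / 5%:R) * (diss e)%:R :> rat) <->
  (exists k : nat, (0 < k)%N /\ inGk e k).
Proof.
have nat_eq : ((alpha e)%:R = (3%:R / 5%:R) * (diss e)%:R :> rat) <->
    (5 * alpha e = 3 * diss e)%N.
  split=> [h|h].
    by apply/eqP; rewrite -(Num.Theory.eqr_nat rat) !GRing.natrM h; apply/eqP; field.
  have -> : (alpha e)%:R = (5 * alpha e)%:R / 5%:R :> rat by rewrite GRing.natrM; field.
  by rewrite h GRing.natrM; field.
split=> [/nat_eq|[k [_ /inGk_extremal ext]]]; first exact: extremal_inGk.
by apply/nat_eq; apply: ext.
Qed.
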